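(* Let $0<r_1<r_2$, let $\Omega=\{r_1<r<r_2\}\subset\mathbb{R}^3$ (spherical coordinates $(r,\theta,\phi)$, $r$ the distance to the origin), let $g,q,b,z_d\in\mathbb{R}$, $\alpha>0$, and let $u,p,u_\alpha,p_\alpha$ be the states and adjoint states defined in the context. Then: i) \begin{align*} u(r,\theta,\phi)&=g \frac{r_1^2}{3}\left[\frac{1}{2}-\frac{1}{2}\left( \frac{r}{r_1}\right)^2+\left(\frac{r_2}{r_1} \right)^3-\frac{r_2}{r}\left(\frac{r_2}{r_1} \right)^2 \right]+q \frac{r_2^2}{r_1} \left( \frac{r_1}{r}-1\right)+ b,\\ p(r,\theta,\phi)&=g r_1^2 \frac{r^2}{6} \left( \frac{1}{20} \left( \frac{r}{r_1}\right)^2+\left( \frac{r_2}{r}\right)\left( \frac{r_2}{r_1}\right)^2-\frac{1}{3}\left( \frac{r_2}{r_1}\right)^3-\frac{1}{6}\right)+qr_2^2 \frac{r}{2}\left(\frac{r}{3r_1}-1 \right)-\frac{r^2}{6}(b-z_d)+\frac{F_1}{r}+F_2, \end{align*} where \begin{align*} F_1 &= g r_1^2r_2^3 \left( -\frac{1}{9} \left( \frac{r_2}{r_1}\right)^3+\frac{1}{5}\left( \frac{r_2}{r_1}\right)^2-\frac{1}{18} \right) + q r_2^4 \left( \frac{1}{3}\left( \frac{r_2}{r_1}\right)-\frac{1}{2}\right)-\frac{r_2^3}{3}(b-z_d),\\ F_2&= g \frac{r_1^4}{9}\left(\frac{7}{40}- \left( \frac{r_2}{r_1}\right)^3\right) +q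 r_1\frac{r_2^2}{3}+\frac{r_1^2}{6}(b-z_d)-\frac{F_1}{r_1}. \end{align*} ii) \begin{align*} u_{\alpha }(r,\theta,\phi)&= g\frac{r_1^2}{3}\left[\frac{1}{2}-\frac{1}{\alpha r_1}-\frac{1}{2} \left( \frac{r}{r_1}\right)^2+\left( \frac{r_2}{r_1}\right)^3 \left(1+\frac{1}{\alpha r_1} \right) -\frac{r_2}{r} \left( \frac{r_2}{r_1}\right)^2\right] +q \frac{r_2^2}{r_1}\left( \frac{r_1}{r}-1-\frac{1}{\alpha r_1}\right)+b,\\ p_{\alpha }(r,\theta,\phi)&= g r_1^2\frac{r^2}{6} \left(\frac{1}{20} \left(\frac{r}{r_1} \right)^2+\left(\frac{r_2}{r}\right)\left(\frac{r_2}{r_1} \right)^2-\frac{1}{3}\left(\frac{r_2}{r_1} \right)^3 \left(1+\frac{1}{\alpha r_1} \right)-\frac{1}{6}+\frac{1}{3\alpha r_1} \right)\\ &\quad+q r_2^2 \frac{r}{2} \left( \frac{r}{3 r_1}-1+\frac{r}{3\alpha r_1^2}\right)- \frac{r^2}{6}(b-z_d)+\frac{F_{1\alpha}}{r}+F_{2\alpha}, \end{align*} where \begin{align*} F_{1\alpha} &= g r_1^2 r_2^3\left(-\frac{1}{9} \left( \frac{r_2}{r_1}\right)^3 \left(1+\frac{1}{\alpha r_1} \right)+\frac{1}{5} \left( \frac{r_2}{r_1}\right)^2-\frac{1}{18}\left( 1-\frac{2}{\alpha r_1}\right) \right)\\ &\quad+ q r_2^4 \left( \frac{1}{3}\left(\frac{r_2}{r_1}\right)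 \left(1+\frac{1}{\alpha r_1} \right)-\frac{1}{2} \right)-\frac{r_2^3}{3 }(b-z_d),\\ F_{2\alpha} &= g \frac{r_1^4}{9} \left[\frac{7}{40}-\frac{7}{10\alpha r_1}+\frac{1}{\alpha^2 r_1^2}-\left( \frac{r_2}{r_1}\right)^3\left( 1-\frac{1}{\alpha r_1}+\frac{1}{\alpha^2 r_1^2}\right)\right]\\ &\quad+q r_1\frac{r_2^2}{3} \left( 1-\frac{1}{\alpha r_1}+\frac{1}{\alpha^2 r_1^2}\right)+\frac{r_1^2}{6}(b-z_d)\left(1-\frac{2}{\alpha r_1} \right)-\frac{F_{1\alpha}}{r_1}\left( 1+\frac{1}{\alpha r_1}\right). \end{align*}
   Context: $\Gamma_1=\{r=r_1\}$, $\Gamma_2=\{r=r_2\}$; $\partial/\partial n$ is the outward normal derivative. The following are the unique (variational, $H^1(\Omega)$) solutions of the respective mixed problems: $u$: $-\Delta u=g$ in $\Omega$, $u|_{\Gamma_1}=b$, $-\frac{\partial u}{\partial n}|_{\Gamma_2}=q$; $p$ (adjoint state): $-\Delta p=u-z_d$ in $\Omega$, $p|_{\Gamma_1}=0$, $\frac{\partial p}{\partial n}|_{\Gamma_2}=0$; $u_\alpha$: $-\Delta u_\alpha=g$ in $\Omega$, $-\frac{\partial u_\alpha}{\partial n}|_{\Gamma_1}=\alpha(u_\alpha-b)$, $-\frac{\partial u_\alpha}{\partial n}|_{\Gamma_2}=q$; $p_\alpha$ (adjoint state): $-\Delta p_\alpha=u_\alpha-z_d$ in $\Omega$, $-\frac{\partial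 p_\alpha}{\partial n}|_{\Gamma_1}=\alpha p_\alpha$, $\frac{\partial p_\alpha}{\partial n}|_{\Gamma_2}=0$. *)

(* Defs.v *)
From HB Require Import structures.
From mathcomp Require Import all_boot all_order all_algebra.
From mathcomp Require Import all_classical all_reals all_analysis.
From mathcomp Require Import measurable_realfun.

Set Implicit Arguments.
Unset Strict Implicit.
Unset Printing Implicit Defensive.

Import Order.TTheory GRing.Theory Num.Theory.
Import numFieldNormedType.Exports.

Local Open Scope classical_set_scope.
Local Open Scope ring_scope.

(* [measurableTypeR R] is the carrier of [lebesgue_measure]; it is convertible
   to [R]. *)
Notation space3 R :=
  (measurableTypeR R * measurableTypeR R * measurableTypeR R)%type.

Section geometry.
Context {R : realType}.

Definition volume : {measure set (space3 R) -> \bar R} :=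
  (lebesgue_measure \x lebesgue_measure \x lebesgue_measure)%E.

(* The library norm on a product type is the sup norm, not this one. *)
Definition enorm (x : space3 R) : R :=
  Num.sqrt (x.1.1 ^+ 2 + x.1.2 ^+ 2 + x.2 ^+ 2).

Definition shell (r1 r2 : R) : set (space3 R) :=
  [set x | r1 < enorm x < r2].

Definition sphere (rho : R) : set (space3 R) := [set x | enorm x = rho].

End geometry.

Section surface_measure.
Context {R : realType}.

(* [t.1] is the polar angle and [t.2] the azimuth. *)
Definition spherical (rho : R) (t : measurableTypeR R * measurableTypeR R) :
    space3 R :=
  (rho * (sin t.1 * cos t.2), rho * (sin t.1 * sin t.2), rho * cos t.1).

Definition angles : set (measurableTypeR R * measurableTypeR R) :=
  `[0, pi] `*` `[0, 2 * pi].

(* Area on the sphere of radius rho: dS = rho^2 sin(theta) dtheta dphi. *)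
Definition surface (rho : R) (A : set (space3 R)) : \bar R :=
  (\int[lebesgue_measure \x lebesgue_measure]_(t in
      angles `&` spherical rho @^-1` A) (rho ^+ 2 * sin t.1)%:E)%E.

Lemma measurable_angles : measurable angles.
Proof. by apply: measurableX; exact: measurable_itv. Qed.

Lemma measurable_sin_cos :
  measurable_fun setT (sin : measurableTypeR R -> measurableTypeR R) /\
  measurable_fun setT (cos : measurableTypeR R -> measurableTypeR R).
Proof.
by split; apply: continuous_measurable_fun; [exact: continuous_sin|
  exact: continuous_cos].
Qed.

Lemma measurable_spherical (rho : R) : measurable_fun setT (spherical rho).
Proof.
have [ms mc] := measurable_sin_cos.
have ms1 := measurableT_comp ms (@measurable_fst _ _ (measurableTypeR R)
  (measurableTypeR R)).
have ms2 := measurableT_comp ms (@measurable_snd _ _ (measurableTypeR R)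
  (measurableTypeR R)).
have mc1 := measurableT_comp mc (@measurable_fst _ _ (measurableTypeR R)
  (measurableTypeR R)).
have mc2 := measurableT_comp mc (@measurable_snd _ _ (measurableTypeR R)
  (measurableTypeR R)).
apply: measurable_fun_pair; first apply: measurable_fun_pair.
- by apply: measurable_funM => //; exact: measurable_funM.
- by apply: measurable_funM => //; exact: measurable_funM.
- exact: measurable_funM.
Qed.

Section surface_is_measure.
Variable rho : R.

Let density_ge0 t : angles t -> (0 <= (rho ^+ 2 * sin t.1)%:E)%E.
Proof.
move=> [/=]; rewrite in_itv/= => /andP[t0 tpi] _.
by rewrite lee_fin mulr_ge0 ?sqr_ge0// sin_ge0_pi// t0.
Qed.

Let surface0 : surface rho set0 = 0%E.
Proof. by rewrite /surface preimage_set0 setI0 integral_set0. Qed.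

Let surface_ge0 A : (0 <= surface rho A)%E.
Proof. by apply: integral_ge0 => t [/density_ge0]. Qed.

Let surface_sigma_additive : semi_sigma_additive (surface rho).
Proof.
move=> F mF tF mUF; rewrite /surface; apply: cvg_toP.
  apply: ereal_nondecreasing_is_cvgn => m n mn.
  apply: lee_sum_nneg_natr => // k _ _.
  exact: surface_ge0.
rewrite preimage_bigcup setI_bigcupr ge0_integral_bigcup//=.
- move=> k; apply: measurableI; first exact: measurable_angles.
  by rewrite -[X in measurable X]setTI; exact: measurable_spherical.
- apply/measurable_funTS/measurable_EFinP; apply: measurable_funM => //.
  apply: (measurableT_comp measurable_sin_cos.1).
  exact: measurable_fst.
- by move=> t [k _ [/density_ge0]].
- move=> i j _ _ [t [[_ Fi] [_ Fj]]]; apply: tF => //.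
  by exists (spherical rho t).
Qed.

HB.instance Definition _ := isMeasure.Build _ _ _ (surface rho)
  surface0 surface_ge0 surface_sigma_additive.

End surface_is_measure.
End surface_measure.

Section sobolev.
Context {R : realType}.
Implicit Types (D : set (space3 R)) (u v T S : space3 R -> R).
Implicit Types (G H : 'I_3 -> space3 R -> R).

Definition axis (i : 'I_3) : space3 R :=
  ((i == 0 :> nat)%:R, (i == 1 :> nat)%:R, (i == 2 :> nat)%:R).

Definition partial (i : 'I_3) u : space3 R -> R := 'D_(axis i) u.

Fixpoint of_class (n : nat) u : Prop :=
  continuous u /\
  if n is m.+1 then
    forall i, (forall x, derivable u x (axis i)) /\ of_class m (partial i u)
  else True.

Definition test_function D (phi : space3 R -> R) : Prop :=
  [/\ forall n, of_class n phi,
      compact (closure [set x | phi x != 0])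
    & closure [set x | phi x != 0] `<=` D].

Definition L2 (mu : {measure set (space3 R) -> \bar R}) D u : Prop :=
  u \_ D \in Lfun mu 2%:E.

Definition L2_cvg (mu : {measure set (space3 R) -> \bar R}) D
    (u_ : nat -> space3 R -> R) u : Prop :=
  'N[mu]_2%:E[EFin \o ((u_ k \- u)%R \_ D)]%E @[k --> \oo] --> 0%E.

Definition weak_gradient D u G : Prop :=
  forall phi, test_function D phi -> forall i,
    \int[volume]_(x in D) (u x * partial i phi x) =
    - \int[volume]_(x in D) (G i x * phi x).

(* [T] is the boundary value of [u] under the continuous extension to
   H^1(shell) of the restriction map C^1 -> L^2(boundary). *)
Definition trace (r1 r2 : R) u G T : Prop :=
  exists phi : nat -> space3 R -> R,
    [/\ forall k, of_class 1 (phi k),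
        L2_cvg volume (shell r1 r2) phi u,
        forall i,
          L2_cvg volume (shell r1 r2) (fun k => partial i (phi k)) (G i),
        L2_cvg (surface r1) (sphere r1) phi T
      & L2_cvg (surface r2) (sphere r2) phi T].

(* u is in H^1(shell), with gradient [G] and boundary trace [T]; both are
   determined by u almost everywhere, and the shell being a bounded smooth
   domain every H^1 function has such a trace. *)
Definition sobolev (r1 r2 : R) u G T : Prop :=
  [/\ L2 volume (shell r1 r2) u,
      (forall i, L2 volume (shell r1 r2) (G i)) /\
        weak_gradient (shell r1 r2) u G,
      L2 (surface r1) (sphere r1) T,
      L2 (surface r2) (sphere r2) T
    & trace r1 r2 u G T].

End sobolev.

Section mixed_problems.
Context {R : realType}.
Variables r1 r2 : R.
Local Notation Omega := (shell r1 r2).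

(* Variational form of  - Delta u = f in Omega,  u = b on r = r1,
   - du/dn = q on r = r2: test functions vanish on r = r1. *)
Definition dirichlet_solution (f : space3 R -> R) (b q : R) (u : space3 R -> R)
    : Prop :=
  exists G T,
    [/\ sobolev r1 r2 u G T,
        {ae surface r1, forall x, sphere r1 x -> T x = b}
      & forall v H S, sobolev r1 r2 v H S ->
          {ae surface r1, forall x, sphere r1 x -> S x = 0} ->
          \int[volume]_(x in Omega) (\sum_i G i x * H i x) =
          \int[volume]_(x in Omega) (f x * v x)
          - \int[surface r2]_(x in sphere r2) (q * S x)].

(* Variational form of  - Delta u = f in Omega,
   - du/dn = alpha (u - b) on r = r1,  - du/dn = q on r = r2. *)
Definition robin_solution (alpha : R) (f : space3 R -> R) (b q : R)
    (u : space3 R -> R) : Prop :=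
  exists G T,
    sobolev r1 r2 u G T /\
    forall v H S, sobolev r1 r2 v H S ->
      \int[volume]_(x in Omega) (\sum_i G i x * H i x)
      + \int[surface r1]_(x in sphere r1) (alpha * (T x - b) * S x) =
      \int[volume]_(x in Omega) (f x * v x)
      - \int[surface r2]_(x in sphere r2) (q * S x).

End mixed_problems.

(* Main.v *)
From HB Require Import structures.
Require Import Defs.
From mathcomp Require Import all_boot all_order all_algebra.
From mathcomp Require Import all_classical all_reals all_analysis.
From mathcomp Require Import measurable_realfun ring lra.
Set Implicit Arguments.
Unset Strict Implicit.
Unset Printing Implicit Defensive.
Import Order.TTheory GRing.Theory Num.Theory.
Import numFieldNormedType.Exports.
Local Open Scope classical_set_scope.
Local Open Scope ring_scope.

(* Each radial function f = A r^4 + B r^2 + C r + D / r + E extends to a C^1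
   function on the whole space, and the divergence theorem on the shell for the
   field grad f multiplied by an H^1 function v is exactly the weak form of the
   problem solved by f; so the explicit solutions are checked by algebra.  The
   divergence theorem is only needed for radial fields: in spherical coordinates
   it is the fundamental theorem of calculus along each ray, for v of class C^1,
   and it passes to H^1 by L^2 limits.  Spherical coordinates themselves come from
   two applications of plane polar coordinates, obtained by Tonelli from the
   one-dimensional substitutions x = y cot phi and y = r sin phi.  Uniqueness
   follows by testing with the difference of two solutions: its gradient and its
   trace on the inner sphere vanish, hence so does the function itself. *)

(** * Change of variables *)

(** The powers r^4, r^2, r, 1/r, 1 are dictated by the adjoint problem: the state combines r^2, 1/r
    and 1, and -Delta sends r^4, r^2, r to multiples of r^2, 1, 1/r, while 1/r and 1 are harmonic
    and stay free for the two boundary conditions. In terms of the flux W(r) = r^2 f'(r) one has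
    Delta f = W'(r) / r^2, which is why a radial field is always given by a pair [W], [w] with w =
    W'. Each H^1 function comes with C^1 functions converging to it together with gradients and
    boundary values, so an identity only has to be proved for C^1 functions and its terms shown
    continuous in L^2. The explicit formulas are singular at the origin, whereas [trace] asks for
    functions of class C^1 on the whole space; hence their modification inside r < r1. Substitution
    rules are stated for nonnegative integrands, so that they compose through Tonelli without any
    integrability to track; signed integrands come last. *)

Section with_density.
Context d (T : measurableType d) (R : realType).
Variables (nu : {measure set T -> \bar R}) (w : T -> R).
Hypotheses (mw : measurable_fun setT w) (w0 : forall t, 0 <= w t).
Local Open Scope ereal_scope.

Definition with_density (A : set T) : \bar R := \int[nu]_(t in A) (w t)%:E.

Let with_density0 : with_density set0 = 0.
Proof. by rewrite /with_density integral_set0. Qed.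

Let with_density_ge0 A : 0 <= with_density A.
Proof. by apply: integral_ge0 => t _; rewrite lee_fin. Qed.

Let with_density_sigma_additive : semi_sigma_additive with_density.
Proof.
move=> F mF tF mUF; rewrite /with_density; apply: cvg_toP.
  apply: ereal_nondecreasing_is_cvgn => m n mn.
  apply: lee_sum_nneg_natr => // k _ _.
  exact: with_density_ge0.
rewrite ge0_integral_bigcup//=.
- exact/measurable_funTS/measurable_EFinP.
- by move=> t _; rewrite lee_fin.
Qed.

HB.instance Definition _ := isMeasure.Build _ _ _ with_density
  with_density0 with_density_ge0 with_density_sigma_additive.

Definition density_measure : {measure set T -> \bar R} := with_density.

Import HBNNSimple.

(** Both sides are monotone limits along simple functions increasing to [f], so only indicators
    remain, and on an indicator the density measure is by definition an integral of [w]. *)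
Lemma ge0_integral_density (f : T -> \bar R) :
  measurable_fun setT f -> (forall t, 0 <= f t) ->
  \int[density_measure]_t f t = \int[nu]_t (f t * (w t)%:E).
Proof.
move=> mf f0; pose h := nnsfun_approx measurableT mf.
have mwE : measurable_fun setT (EFin \o w) by exact/measurable_EFinP.
have fE x : f x = lim ((EFin \o h n) x @[n --> \oo]).
  by apply/esym/cvg_lim => //; exact: cvg_nnsfun_approx.
transitivity (lim (\int[density_measure]_x (EFin \o h n) x @[n --> \oo])).
  under eq_integral do rewrite fE.
  apply: monotone_convergence => //.
  - by move=> n; apply/measurable_EFinP.
  - by move=> n x _ /=; rewrite lee_fin.
  - by move=> x _ a b ab; rewrite lee_fin; exact/lefP/nd_nnsfun_approx.
have -> : \int[nu]_t (f t * (w t)%:E) =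
    lim (\int[nu]_x ((EFin \o h n) x * (w x)%:E) @[n --> \oo]).
  have fg x : f x * (w x)%:E = lim ((EFin \o h n) x * (w x)%:E @[n --> \oo]).
    by apply/esym/cvg_lim => //; apply: cvgeZr => //; exact: cvg_nnsfun_approx.
  under eq_integral do rewrite fg.
  apply: monotone_convergence => //.
  - by move=> n; apply/emeasurable_funM => //; exact/measurable_EFinP.
  - by move=> n x _ /=; rewrite mule_ge0 ?lee_fin.
  - move=> x _ a b ab/=; rewrite lee_wpmul2r ?lee_fin//.
    exact/lefP/nd_nnsfun_approx.
suff E n : \int[density_measure]_x (EFin \o h n) x =
    \int[nu]_x ((EFin \o h n) x * (w x)%:E) by under eq_fun do rewrite E.
under eq_integral do rewrite /= fimfunE -fsumEFin//.
have indic m r : measurable_fun setT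
    (fun x => (r * \1_(h m @^-1` [set r]) x)%:E).
  by apply/measurable_EFinP; exact: measurable_funM.
rewrite ge0_integral_fsum//; last by move=> m y Ey; exact: nnfun_muleindic_ge0.
under [RHS]eq_integral => x xE.
  rewrite [(EFin \o h n) x]/= fimfunE -fsumEFin// ge0_mule_fsuml => [|y]; last first.
    exact: nnfun_muleindic_ge0.
  over.
rewrite ge0_integral_fsum//; last 2 first.
  - by move=> y; apply: emeasurable_funM => //; exact: indic.
  - move=> m y Ey; rewrite mule_ge0 ?lee_fin //= -lee_fin EFinM; exact: nnfun_muleindic_ge0.
apply: eq_fsbigr => r rhn.
rewrite integralZl_indic_nnsfun// integral_indic// setIT.
under [RHS]eq_integral do rewrite EFinM -muleA.
have [->|r0] := eqVneq r 0%R.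
  rewrite mul0e; under eq_integral do rewrite mul0e.
  by rewrite integral0.
have {}r0 : (0 <= r)%R.
  by move: rhn; rewrite inE => -[x _ <-].
rewrite ge0_integralZl//; last 2 first.
  - by apply: emeasurable_funM => //; exact/measurable_EFinP.
  - by move=> x _; rewrite mule_ge0 ?lee_fin.
congr (_ * _); rewrite /density_measure/= /with_density integral_mkcond.
by apply: eq_integral => x _; rewrite epatch_indic/= muleC.
- exact: indic.
Qed.

End with_density.

(** * Calculus of substitution rules for nonnegative integrands *)

Section transfer.
Context d1 d2 (T1 : measurableType d1) (T2 : measurableType d2) (R : realType).
Local Open Scope ereal_scope.
Implicit Types (mu : {measure set T1 -> \bar R}) (nu : {measure set T2 -> \bar R})
  (u : T1 -> R) (w : T2 -> R) (g : T2 -> T1).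

(* [mu] with density [u] is the image under [g] of [nu] with density [w]. *)
Definition transfer mu u nu w g := forall f : T1 -> \bar R,
  measurable_fun setT f -> (forall x, 0 <= f x) ->
  \int[mu]_x (f x * (u x)%:E) = \int[nu]_t (f (g t) * (w t)%:E).

(** Agreement on sets says that [mu] with density [u] is the pushforward under [g] of [nu] with
    density [w]; equal measures have equal integrals. *)
Lemma transfer_sets mu u nu w g :
  measurable_fun setT u -> (forall x, (0 <= u x)%R) ->
  measurable_fun setT w -> (forall t, (0 <= w t)%R) ->
  measurable_fun setT g ->
  (forall A, measurable A ->
    \int[mu]_(x in A) (u x)%:E = \int[nu]_(t in g @^-1` A) (w t)%:E) ->
  transfer mu u nu w g.
Proof.
move=> mu_ u0 mw w0 mg H f mf f0.
rewrite -!ge0_integral_density//=; last exact: measurableT_comp.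
rewrite -(@ge0_integral_pushforward _ _ _ _ _ _ mg _ setT)//=.
by apply: eq_measure_integral => A mA _; rewrite /= /with_density H.
Qed.

(** Values of the map at points of weight 0 do not contribute. This permits simplifying a composed
    formula that is only valid off the zeros of [sin]. *)
Lemma transfer_congr mu u u' nu w w' g g' :
  u =1 u' -> w =1 w' -> (forall t, w t != 0%R -> g t = g' t) ->
  transfer mu u nu w g -> transfer mu u' nu w' g'.
Proof.
move=> uu ww gg H f mf f0.
transitivity (\int[mu]_x (f x * (u x)%:E)).
  by apply: eq_integral => x _; rewrite uu.
rewrite H//; apply: eq_integral => t _; rewrite -ww.
by have [->|/gg ->//] := eqVneq (w t) 0%R; rewrite !mule0.
Qed.

Lemma transferM mu u nu w g (k : T1 -> R) : measurable_fun setT g ->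
  measurable_fun setT k -> (forall x, (0 <= k x)%R) ->
  transfer mu u nu w g ->
  transfer mu (fun x => k x * u x)%R nu (fun t => k (g t) * w t)%R g.
Proof.
move=> mg mk k0 H f mf f0; under eq_integral do rewrite EFinM muleA.
rewrite (H (fun x => f x * (k x)%:E)).
- by apply: eq_integral => t _; rewrite EFinM muleA.
- by apply: emeasurable_funM => //; exact/measurable_EFinP.
- by move=> x; rewrite mule_ge0 ?lee_fin.
Qed.

Lemma transferD mu u u' nu w w' g : measurable_fun setT g ->
  measurable_fun setT u -> (forall x, (0 <= u x)%R) ->
  measurable_fun setT u' -> (forall x, (0 <= u' x)%R) ->
  measurable_fun setT w -> (forall x, (0 <= w x)%R) ->
  measurable_fun setT w' -> (forall x, (0 <= w' x)%R) ->
  transfer mu u nu w g -> transfer mu u' nu w' g ->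
  transfer mu (fun x => u x + u' x)%R nu (fun t => w t + w' t)%R g.
Proof.
move=> mg m1 p1 m2 p2 m3 p3 m4 p4 H1 H2 f mf f0.
under eq_integral do rewrite EFinD ge0_muleDr ?lee_fin//.
under [RHS]eq_integral do rewrite EFinD ge0_muleDr ?lee_fin//.
have mfg : measurable_fun setT (fun t => f (g t)) by exact: measurableT_comp.
rewrite !ge0_integralD//; first by rewrite H1// H2//.
all: try by (move=> x _; rewrite mule_ge0 ?lee_fin).
all: by apply: emeasurable_funM => //; exact/measurable_EFinP.
Qed.

(** Multiplication by a nonnegative weight commutes with positive and negative parts, so the rule
    passes to signed integrands part by part. *)
Lemma transfer_integral mu u nu w g (f : T1 -> \bar R) :
  (forall x, (0 <= u x)%R) -> (forall x, (0 <= w x)%R) ->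
  measurable_fun setT f -> transfer mu u nu w g ->
  \int[mu]_x (f x * (u x)%:E) = \int[nu]_t (f (g t) * (w t)%:E).
Proof.
move=> u0 w0 mf H; rewrite integralE [RHS]integralE.
have E1 d (T : measurableType d) (h : T -> \bar R) (k : T -> R) :
    (forall x, (0 <= k x)%R) ->
  ((fun x => h x * (k x)%:E)^\+ = fun x => h^\+ x * (k x)%:E) /\
  ((fun x => h x * (k x)%:E)^\- = fun x => h^\- x * (k x)%:E).
  move=> k0; split; apply/funext => x; rewrite ?funeposE ?funenegE.
    by rewrite maxe_pMl ?lee_fin// mul0e.
  by rewrite -mulNe maxe_pMl ?lee_fin// mul0e.
have [-> ->] := E1 _ _ f u u0.
have [-> ->] := E1 _ _ (f \o g) w w0.
rewrite (funepos_comp f g) (funeneg_comp f g).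
by rewrite !H//; [exact: measurable_funeneg|exact: measurable_funepos].
Qed.

End transfer.

Lemma transfer_ae d (T : measurableType d) (R : realType)
    (mu : {measure set T -> \bar R}) (u w : T -> R) :
  measurable_fun setT u -> measurable_fun setT w ->
  {ae mu, forall x, u x = w x} -> transfer mu u mu w id.
Proof.
move=> mu_ mw uw f mf f0; apply: ae_eq_integral => //.
- by apply: emeasurable_funM => //; exact/measurable_EFinP.
- by apply: emeasurable_funM => //; exact/measurable_EFinP.
- by apply: filterS uw => x /= -> _.
Qed.

Lemma transfer_comp d1 d2 d3 (T1 : measurableType d1) (T2 : measurableType d2)
    (T3 : measurableType d3) (R : realType)
    (mu : {measure set T1 -> \bar R}) (nu : {measure set T2 -> \bar R})
    (xi : {measure set T3 -> \bar R}) u w v g h :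
  measurable_fun setT g -> transfer mu u nu w g -> transfer nu w xi v h ->
  transfer mu u xi v (g \o h).
Proof.
move=> mg H1 H2 f mf f0; rewrite H1//.
apply: (H2 (f \o g)); first exact: (measurableT_comp mf mg).
by move=> x; exact: f0.
Qed.

(** * Substitutions in products, by Tonelli *)

Section product_sigma_finite.
Local Open Scope ereal_scope.
Context d1 d2 (T1 : measurableType d1) (T2 : measurableType d2) (R : realType).
Variables (m1 : {sigma_finite_measure set T1 -> \bar R})
  (m2 : {sigma_finite_measure set T2 -> \bar R}).

(* [m1 \x m2] itself already carries the library's sigma-finite structure for
   subprobabilities, which hides any other instance on that key. *)
Definition sfprod : set (T1 * T2) -> \bar R := m1 \x m2.

HB.instance Definition _ := Measure.on sfprod.

Let product_sigma_finite : sigma_finite setT sfprod.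
Proof.
have /sigma_finiteP [F [TF ndF mF]] := sigma_finiteT m1.
have /sigma_finiteP [G [TG ndG mG]] := sigma_finiteT m2.
exists (fun n => F n `*` G n).
  apply/esym; rewrite -subTset => -[x y] _ /=.
  have [i _ Fix] : (\bigcup_i F i) x by rewrite -TF.
  have [j _ Gjy] : (\bigcup_i G i) y by rewrite -TG.
  exists (maxn i j) => //; split => /=.
  - by move: Fix; apply/subsetPset/ndF; rewrite leq_maxl.
  - by move: Gjy; apply/subsetPset/ndG; rewrite leq_maxr.
move=> n; have [mFn Fn] := mF n; have [mGn Gn] := mG n.
split; first exact: measurableX.
by rewrite /sfprod/= product_measure1E// lte_mul_pinfty// ge0_fin_numE.
Qed.

HB.instance Definition _ := Measure_isSigmaFinite.Build _ _ _ sfprod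
  product_sigma_finite.

End product_sigma_finite.

Section transfer_product.
Context (R : realType).
Local Open Scope ereal_scope.

(** The inner integral of Tonelli is transformed while the outer variable is frozen; the map and
    both weights may therefore depend on that variable as a parameter. *)
Lemma transfer_prod d d1 d2 (S : measurableType d) (T1 : measurableType d1)
    (T2 : measurableType d2) (m : {sigma_finite_measure set S -> \bar R})
    (mu : {sigma_finite_measure set T1 -> \bar R})
    (nu : {sigma_finite_measure set T2 -> \bar R})
    (u : S * T1 -> R) (w : S * T2 -> R) (g : S * T2 -> T1) :
  measurable_fun setT u -> (forall x, (0 <= u x)%R) ->
  measurable_fun setT w -> (forall t, (0 <= w t)%R) ->
  measurable_fun setT g ->
  (forall s, transfer mu (fun x => u (s, x)) nu (fun t => w (s, t))
     (fun t => g (s, t))) ->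
  transfer (sfprod m mu) u (sfprod m nu) w (fun t => (t.1, g t)).
Proof.
move=> mu_ u0 mw w0 mg H f mf f0.
have mfg : measurable_fun setT (fun t : S * T2 => f (t.1, g t)).
  by apply: measurableT_comp => //; exact: measurable_fun_pair.
rewrite !fubini_tonelli1//; first last.
- by move=> x; rewrite mule_ge0 ?lee_fin.
- by apply: emeasurable_funM => //; exact/measurable_EFinP.
- by move=> x; rewrite mule_ge0 ?lee_fin.
- by apply: emeasurable_funM => //; exact/measurable_EFinP.
apply: eq_integral => s _; rewrite /fubini_F/=.
rewrite (H s (fun x => f (s, x)))//.
exact: (measurableT_comp mf).
Qed.

Lemma transfer_prodl d d1 d2 (S : measurableType d) (T1 : measurableType d1)
    (T2 : measurableType d2) (m : {sigma_finite_measure set S -> \bar R})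
    (mu : {sigma_finite_measure set T1 -> \bar R})
    (nu : {sigma_finite_measure set T2 -> \bar R})
    (u : T1 * S -> R) (w : T2 * S -> R) (g : T2 * S -> T1) :
  measurable_fun setT u -> (forall x, (0 <= u x)%R) ->
  measurable_fun setT w -> (forall t, (0 <= w t)%R) ->
  measurable_fun setT g ->
  (forall s, transfer mu (fun x => u (x, s)) nu (fun t => w (t, s))
     (fun t => g (t, s))) ->
  transfer (sfprod mu m) u (sfprod nu m) w (fun t => (g t, t.2)).
Proof.
move=> mu_ u0 mw w0 mg H f mf f0.
have mfg : measurable_fun setT (fun t : T2 * S => f (g t, t.2)).
  by apply: measurableT_comp => //; exact: measurable_fun_pair.
rewrite !fubini_tonelli2//; first last.
- by move=> x; rewrite mule_ge0 ?lee_fin.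
- by apply: emeasurable_funM => //; exact/measurable_EFinP.
- by move=> x; rewrite mule_ge0 ?lee_fin.
- by apply: emeasurable_funM => //; exact/measurable_EFinP.
apply: eq_integral => s _; rewrite /fubini_G/=.
rewrite (H s (fun x => f (x, s)))//.
exact: (measurableT_comp mf).
Qed.

Lemma transfer_swap d1 d2 (T1 : measurableType d1)
    (T2 : measurableType d2)
    (mu : {sigma_finite_measure set T1 -> \bar R})
    (nu : {sigma_finite_measure set T2 -> \bar R}) (u : T1 * T2 -> R) :
  measurable_fun setT u -> (forall x, (0 <= u x)%R) ->
  transfer (sfprod mu nu) u (sfprod nu mu) (fun t => u (t.2, t.1))
    (fun t => (t.2, t.1)).
Proof.
move=> mu_ u0 f mf f0.
have ms : measurable_fun setT (fun t : T2 * T1 => (t.2, t.1)).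
  by apply: measurable_fun_pair; [exact: measurable_snd|exact: measurable_fst].
rewrite fubini_tonelli2//; first last.
- by move=> x; rewrite mule_ge0 ?lee_fin.
- by apply: emeasurable_funM => //; exact/measurable_EFinP.
rewrite fubini_tonelli1//; first last.
- by move=> x; rewrite mule_ge0 ?lee_fin.
- apply: emeasurable_funM => //; last apply/measurable_EFinP.
    exact: (measurableT_comp mf).
  exact: (measurableT_comp mu_).
Qed.

Lemma transfer_assoc d1 d2 d3 (T1 : measurableType d1)
    (T2 : measurableType d2) (T3 : measurableType d3)
    (m1 : {sigma_finite_measure set T1 -> \bar R})
    (m2 : {sigma_finite_measure set T2 -> \bar R})
    (m3 : {sigma_finite_measure set T3 -> \bar R}) (u : T1 * T2 * T3 -> R) :
  measurable_fun setT u -> (forall x, (0 <= u x)%R) ->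
  transfer (sfprod (sfprod m1 m2) m3) u (sfprod m1 (sfprod m2 m3))
    (fun t => u ((t.1, t.2.1), t.2.2)) (fun t => ((t.1, t.2.1), t.2.2)).
Proof.
move=> mu_ u0 f mf f0.
have ms : measurable_fun setT (fun t : T1 * (T2 * T3) => ((t.1, t.2.1), t.2.2)).
  apply: measurable_fun_pair; first apply: measurable_fun_pair => //.
    by apply: measurableT_comp => //; exact: measurable_snd.
  by apply: measurableT_comp => //; exact: measurable_snd.
have mF : measurable_fun setT (fun x => f x * (u x)%:E).
  by apply: emeasurable_funM => //; exact/measurable_EFinP.
have F0 x : 0 <= f x * (u x)%:E by rewrite mule_ge0 ?lee_fin.
rewrite fubini_tonelli1// fubini_tonelli1//; first last.
- move=> x; exact: integral_ge0.
- exact: (measurable_fun_fubini_tonelli_F (fun x => f x * (u x)%:E)).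
have mF' : measurable_fun setT (fun t : T1 * (T2 * T3) =>
   f ((t.1, t.2.1), t.2.2) * (u ((t.1, t.2.1), t.2.2))%:E).
  exact: (measurableT_comp mF).
rewrite fubini_tonelli1//.
apply: eq_integral => a _; rewrite /fubini_F/= fubini_tonelli1//.
exact: (measurableT_comp mF' (@pair1_measurable _ _ _ _ a)).
Qed.

Lemma transfer_assocV d1 d2 d3 (T1 : measurableType d1)
    (T2 : measurableType d2) (T3 : measurableType d3)
    (m1 : {sigma_finite_measure set T1 -> \bar R})
    (m2 : {sigma_finite_measure set T2 -> \bar R})
    (m3 : {sigma_finite_measure set T3 -> \bar R}) (u : T1 * (T2 * T3) -> R) :
  measurable_fun setT u -> (forall x, (0 <= u x)%R) ->
  transfer (sfprod m1 (sfprod m2 m3)) u (sfprod (sfprod m1 m2) m3)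
    (fun t => u (t.1.1, (t.1.2, t.2))) (fun t => (t.1.1, (t.1.2, t.2))).
Proof.
move=> mu_ u0 f mf f0.
have ms : measurable_fun setT (fun t : T1 * T2 * T3 => (t.1.1, (t.1.2, t.2))).
  apply: measurable_fun_pair; last apply: measurable_fun_pair => //.
    by apply: measurableT_comp => //; exact: measurable_fst.
  by apply: measurableT_comp => //; exact: measurable_fst.
have mfs : measurable_fun setT (fun t : T1 * T2 * T3 => f (t.1.1, (t.1.2, t.2))).
  exact: (measurableT_comp mf ms).
have mus : measurable_fun setT
    (fun t : T1 * T2 * T3 => u (t.1.1, (t.1.2, t.2))).
  exact: (measurableT_comp mu_ ms).
rewrite (transfer_assoc _ _ _ mus _ mfs)//.
by apply: eq_integral => -[a [b c]] _.
Qed.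

End transfer_product.

(** * Spherical coordinates *)

Section lebesgue_transfer.
Context {R : realType}.
Local Notation T := (measurableTypeR R).
Local Notation lambda := (@lebesgue_measure R).

(** The image under [g] of Lebesgue measure with density [w] gives every half-open interval its
    length, so it is Lebesgue measure by uniqueness. *)
Lemma lebesgue_transfer (w : T -> R) (g : T -> T) :
  measurable_fun setT w -> (forall t, 0 <= w t) -> measurable_fun setT g ->
  (forall x y : R, x < y ->
    (\int[lambda]_(t in g @^-1` `]x, y]%classic) (w t)%:E = (y - x)%:E)%E) ->
  transfer lambda (cst 1) lambda w g.
Proof.
move=> mw w0 mg H; apply: transfer_sets => // A mA.
rewrite (_ : \int[_]_(x in A) _ = \int[lambda]_(x in A) (cst 1 x))%E//.
rewrite integral_cst//= mul1e.
rewrite (@lebesgue_measure_unique _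
  (pushforward (density_measure lambda mw w0) (g : T -> measurableTypeR R)) _ A mA)//.
move=> _ [[x y] _ <-] /=; rewrite /pushforward/=/with_density.
rewrite lebesgue_measure_itv/= lte_fin; case: ifPn => [xy|]; first by rewrite H.
by rewrite -leNgt => yx; rewrite set_itv_ge ?bnd_simp -?leNgt// preimage_set0 integral_set0.
Qed.

Lemma affine_transfer (a b : R) : a != 0 ->
  transfer lambda (cst 1) lambda (cst `|a|) (fun t : T => a * t + b).
Proof.
move=> a0.
have mg : measurable_fun setT (fun t : T => a * t + b : T).
  by apply: measurable_funD => //; apply: measurable_funM.
apply: lebesgue_transfer => //.
move=> x y xy.
rewrite (_ : \int[_]_(t in _) _ = \int[lambda]_(t in (fun t : T => a * t + b)%R @^-1` `]x, y]) (cst `|a|%:E t))%E//.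
rewrite integral_cst//; last first.
  by rewrite -[X in measurable X]setTI; exact: mg.
have [a_gt0|a_le0] := ltP 0 a.
  have -> : (fun t : T => a * t + b) @^-1` `]x, y] = `](x - b) / a, (y - b) / a]%classic.
    apply/seteqP; split => t /=; rewrite !in_itv/= ltr_pdivrMr// ler_pdivlMr//;
      by rewrite ltrBlDr lerBrDr mulrC.
  rewrite /= lebesgue_measure_itv/= lte_fin ltr_pM2r ?invr_gt0// ltrD2r xy -EFinB -EFinM.
  by congr (_%:E); rewrite gtr0_norm//; field.
(* A decreasing map moves the closed end of the interval to the left; the length is the same. *)
have a_lt0 : a < 0 by rewrite lt_neqAle a0.
have -> : (fun t : T => a * t + b) @^-1` `]x, y] = `[(y - b) / a, (x - b) / a[%classic.
  apply/seteqP; split => t /=; rewrite !in_itv/= ltr_ndivlMr// ler_ndivrMr//;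
    by rewrite ltrBlDr lerBrDr mulrC andbC.
rewrite /= lebesgue_measure_itv/= lte_fin ltr_nM2r ?invr_lt0// ltrD2r xy -EFinB -EFinM.
by congr (_%:E); rewrite ltr0_norm//; field.
Qed.

Lemma measurable_sin : measurable_fun setT (sin : T -> T).
Proof. by have [] := @measurable_sin_cos R. Qed.

Lemma measurable_cos : measurable_fun setT (cos : T -> T).
Proof. by have [] := @measurable_sin_cos R. Qed.

(** Inversion is continuous away from 0, and the point 0 is a measurable piece of its own. *)
Lemma measurable_inv : measurable_fun setT (GRing.inv : T -> T).
Proof.
rewrite -(setUv [set (0 : T)]).
apply/measurable_funU => //; first exact: measurableC.
split.
  exact: measurable_fun_set1.
apply: open_continuous_measurable_fun; first exact: closed_openC.
by move=> x; rewrite inE/= => /eqP x0; exact: inv_continuous.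
Qed.

Definition arc_indic (phi : T) : R := \1_(`]0, pi[%classic : set T) phi.

Lemma tan_pihalfB (t : R) : tan (pi / 2 - t) = cos t / sin t.
Proof. by rewrite /tan sinB cosB sin_pihalf cos_pihalf !mul0r !mul1r subr0 add0r. Qed.

(** At a fixed height y > 0 the angle phi in ]0, pi[ parametrizes the whole line by x = y cot phi,
    decreasingly, with |dx| = y / sin^2 phi dphi. *)
Lemma cot_transfer (y : R) : 0 < y ->
  transfer lambda (cst 1) lambda
    (fun phi : T => arc_indic phi * (y * (sin phi ^+ 2)^-1))
    (fun phi : T => y * (cos phi / sin phi)).
Proof.
move=> y0; have ms := measurable_sin; have mc := measurable_cos.
have mg : measurable_fun setT (fun phi : T => y * (cos phi / sin phi) : T).
  apply: measurable_funM => //; apply: measurable_funM => //.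
  exact: (measurableT_comp measurable_inv ms).
have mw : measurable_fun setT (fun phi : T => y * (sin phi ^+ 2)^-1).
  apply: measurable_funM => //.
  by apply: (measurableT_comp measurable_inv); exact: measurable_funX.
have w0 (phi : R) : 0 <= y * (sin phi ^+ 2)^-1.
  by rewrite mulr_ge0 ?invr_ge0 ?sqr_ge0// ltW.
apply: lebesgue_transfer => //.
- by apply: measurable_funM => //; apply: measurable_indic; exact: measurable_itv.
- by move=> t; rewrite mulr_ge0.
move=> a b ab.
(* The inverse of phi -> y cot phi. Writing cot phi as tan (pi/2 - phi) lets [atan] supply the range
   and the monotonicity. *)
pose phi c : R := pi / 2 - atan (c / y).
have pa (c : R) : - (pi / 2) < atan c < pi / 2 by rewrite atan_gtNpi2 atan_ltpi2.
have phiI (c : R) : 0 < phi c < pi.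
  by rewrite /phi; have := pa (c / y); move: (atan _) => x; lra.
have phiab : phi b < phi a.
  by rewrite /phi ltrD2l ltrN2 lt_atan// ltr_pM2r ?invr_gt0.
have Fphi (c : R) : y * tan (pi / 2 - phi c) = c.
  by rewrite /phi subKr atanK mulrC divfK// gt_eqF.
have E : (fun t : T => y * (cos t / sin t)) @^-1` `]a, b] `&` `]0, pi[ =
   `[phi b, phi a[%classic.
  apply/seteqP; split => t /=; rewrite !in_itv/= -tan_pihalfB.
    move=> [/andP[ta tb] t0]; rewrite /phi.
    have tI : pi / 2 - t \in `](- (pi/2)), (pi/2)[ by rewrite in_itv/=; lra.
    move: ta tb; rewrite mulrC -ltr_pdivrMr// -ler_pdivlMr// => ta tb.
    rewrite -[t](subKr (pi / 2)) lerD2l ltrD2l lerN2 ltrN2 -(tanK tI).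
    by rewrite lt_atan// le_atan.
  move=> /andP[tb ta]; have := phiI a; have := phiI b => /andP[b1 b2] /andP[a1 a2].
  have tI : pi / 2 - t \in `](- (pi/2)), (pi/2)[ by rewrite in_itv/=; lra.
  have cI (c : R) : atan c \in `](- (pi/2)), (pi/2)[ by rewrite in_itv/=; exact: pa.
  split; last by lra.
  rewrite mulrC -ltr_pdivrMr// -ler_pdivlMr//.
  rewrite -{1}(atanK (a / y)) -{1}(atanK (b / y)) !(leNgt, ltr_tan)//.
  rewrite -leNgt; move: ta tb; rewrite /phi; lra.
(* Closing the interval costs nothing and keeps it inside ]0, pi[, where [sin] is positive; there -y
   cot is an antiderivative of the weight. *)
transitivity (\int[lambda]_(t in `[phi b, phi a]) (y * (sin t ^+ 2)^-1)%:E)%E.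
  rewrite -integral_itv_bndo_bndc; last exact/measurable_funTS/measurable_EFinP.
  rewrite -E integral_mkcondr; apply: eq_integral => t _.
  by rewrite epatch_indic/= EFinM muleC.
have sin0 t : t \in `[phi b, phi a] -> 0 < sin t.
  rewrite in_itv/= => /andP[ht1 ht2]; apply: sin_gt0_pi.
  by have := phiI a; have := phiI b; move: ht1 ht2; lra.
have dF t : t \in `[phi b, phi a] ->
    is_derive t 1 (fun t => - (y * tan (pi / 2 - t))) (y * (sin t ^+ 2)^-1).
  move=> tI; have st := sin0 _ tI.
  have c0 : cos (pi / 2 - t) != 0.
    by rewrite cosB cos_pihalf sin_pihalf mul0r add0r mul1r gt_eqF.
  have dt := is_derive_tan c0.
  have dB : is_derive t 1 (fun t : R => pi / 2 - t) (-1).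
    by rewrite -[-1]add0r; apply: is_deriveB.
  have dc := @is_derive1_comp _ (@tan R) _ t _ _ dt dB.
  have := is_deriveN (is_deriveZ y dc).
  move=> D; apply: (@is_derive_eq _ _ _ _ _ _ _ _ D).
  rewrite mulrN1 scalerN opprK.
  by rewrite cosB cos_pihalf sin_pihalf mul0r add0r mul1r.
rewrite (@continuous_FTC2 _ _ (fun t => - (y * tan (pi / 2 - t))))//.
- by rewrite !Fphi -EFinB; congr (_%:E); lra.
- apply: continuous_in_subspaceT => t /[!inE] tI.
  apply: cvgM; first exact: cvg_cst.
  apply: cvgV; first by rewrite expf_neq0// gt_eqF// sin0.
  by apply: cvgM; exact: continuous_sin.
- split.
  + by move=> t tI; have /dF[] : t \in `[phi b, phi a] by exact: subset_itv_oo_cc.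
  + apply: cvg_at_right_filter.
    have /dF[+ _] : phi b \in `[phi b, phi a] by rewrite in_itv/= lexx ltW.
    by move=> /derivable1_diffP/differentiable_continuous.
  + apply: cvg_at_left_filter.
    have /dF[+ _] : phi a \in `[phi b, phi a] by rewrite in_itv/= lexx ltW.
    by move=> /derivable1_diffP/differentiable_continuous.
- move=> t tI; have /dF D : t \in `[phi b, phi a] by exact: subset_itv_oo_cc.
  by rewrite derive1E derive_val.
Qed.

End lebesgue_transfer.

(** * Polar coordinates in the upper half-plane *)

Section polar.
Context {R : realType}.
Local Notation T := (measurableTypeR R).
Local Notation lambda := (@lebesgue_measure R).

Definition pos_indic (y : R) : R := (0 < y)%R%:R.

Lemma measurable_pos_indic : measurable_fun setT (pos_indic : T -> R).
Proof.
rewrite (_ : pos_indic = \1_(`]0, +oo[%classic : set R)).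
  by apply: measurable_indic; exact: measurable_itv.
by apply/funext => y; rewrite /pos_indic indicE mem_setE in_itv/= andbT.
Qed.

Lemma measurable_arc_indic : measurable_fun setT (@arc_indic R).
Proof. by apply: measurable_indic; exact: measurable_itv. Qed.

Lemma arc_indicE (phi : R) : arc_indic phi = (0 < phi < pi)%R%:R.
Proof. by rewrite /arc_indic indicE mem_setE in_itv. Qed.

Lemma pos_indic_ge0 y : 0 <= pos_indic y.
Proof. by rewrite /pos_indic ler0n. Qed.

Lemma arc_indic_ge0 (y : T) : 0 <= arc_indic y.
Proof. by rewrite arc_indicE ler0n. Qed.

Lemma pos_indicM_ge0 y : 0 <= pos_indic y * y.
Proof. by rewrite /pos_indic; case: ltP => [/ltW|]; rewrite ?mul1r ?mul0r. Qed.

Lemma measurable_fstX d1 d2 (T1 : measurableType d1) (T2 : measurableType d2)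
   d3 (T3 : measurableType d3) (f : T1 -> T3) :
  measurable_fun setT f -> measurable_fun setT (fun t : T1 * T2 => f t.1).
Proof. by move=> mf; apply: (measurableT_comp mf); exact: measurable_fst. Qed.

Lemma measurable_sndX d1 d2 (T1 : measurableType d1) (T2 : measurableType d2)
   d3 (T3 : measurableType d3) (f : T2 -> T3) :
  measurable_fun setT f -> measurable_fun setT (fun t : T1 * T2 => f t.2).
Proof. by move=> mf; apply: (measurableT_comp mf); exact: measurable_snd. Qed.

Lemma measurable_idR : measurable_fun setT (id : T -> R).
Proof. exact: measurable_id. Qed.

End polar.

Ltac meas := repeat first
  [ exact: measurable_cst | exact: measurable_idR | exact: measurable_id
  | exact: measurable_fst | exact: measurable_snd
  | exact: (measurable_fstX measurable_idR) | exact: (measurable_sndX measurable_idR)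
  | exact: (measurable_fstX measurable_sin) | exact: (measurable_fstX measurable_cos)
  | exact: (measurable_sndX measurable_sin) | exact: (measurable_sndX measurable_cos)
  | exact: (measurable_fstX measurable_pos_indic) | exact: (measurable_sndX measurable_pos_indic)
  | exact: (measurable_fstX measurable_arc_indic) | exact: (measurable_sndX measurable_arc_indic)
  | exact: measurable_pos_indic | exact: measurable_arc_indic
  | exact: measurable_sin | exact: measurable_cos
  | apply: measurable_fun_pair | apply: measurable_funM | apply: measurable_funD
  | apply: measurable_funN
  | apply: measurable_funX | apply: (measurableT_comp measurable_inv) ].

Section polar_coordinates.
Context {R : realType}.
Local Notation T := (measurableTypeR R).
Local Notation lambda := (@lebesgue_measure R).

(** For fixed y, x = y cot phi gives dx = y / sin^2 phi dphi; for fixed phi, y = r sin phi gives dy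
    = sin phi dr. The weights multiply to r. *)
Lemma half_polar :
  transfer (sfprod lambda lambda) (fun p => pos_indic p.2)
    (sfprod lambda lambda)
    (fun t => arc_indic t.1 * (pos_indic t.2 * t.2))
    (fun t => (t.2 * cos t.1, t.2 * sin t.1)).
Proof.
pose w (t : T * T) : R :=
  arc_indic t.1 * ((pos_indic t.2 * t.2) * (sin t.1 ^+ 2)^-1).
have mw : measurable_fun setT w by meas.
have w0 t : 0 <= w t.
  by rewrite mulr_ge0 ?arc_indic_ge0// mulr_ge0 ?pos_indicM_ge0// invr_ge0 sqr_ge0.
pose g (t : T * T) : T := t.2 * (cos t.1 / sin t.1).
have mg : measurable_fun setT g by meas.
have H1 : transfer (sfprod lambda lambda) (fun p => pos_indic p.2)
    (sfprod lambda lambda) w (fun t => (g t, t.2)).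
  apply: transfer_prodl => //; first by meas.
  move=> y /=; rewrite /w/g/=.
  have [y0|y0] := ltP 0 y; last first.
    have p0 : pos_indic y = 0 by rewrite /pos_indic ltNge y0.
    move=> f mf f0; rewrite p0.
    under eq_integral do rewrite mule0.
    under [RHS]eq_integral do rewrite !(mul0r, mulr0) mule0.
    by rewrite !integral0.
  have p1 : pos_indic y = 1 by rewrite /pos_indic y0.
  by apply: transfer_congr (cot_transfer y0) => // x; rewrite ?p1 ?mul1r.
pose v (t : T * T) : R := arc_indic t.1 * (pos_indic t.2 * t.2).
have mv : measurable_fun setT v by meas.
have v0 t : 0 <= v t by rewrite mulr_ge0 ?arc_indic_ge0 ?pos_indicM_ge0.
pose h (t : T * T) : T := t.2 * sin t.1.
have mh : measurable_fun setT h by meas.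
have H2 : transfer (sfprod lambda lambda) w (sfprod lambda lambda) v
    (fun t => (t.1, h t)).
  apply: transfer_prod => //.
  move=> phi /=; rewrite /w /v /h/=.
  case/boolP : (0 < phi < pi) => phi0; last first.
    have p0 : arc_indic (phi : T) = 0 by rewrite arc_indicE (negbTE phi0).
    move=> f mf f0; rewrite p0.
    under eq_integral do rewrite !(mul0r, mulr0) mule0.
    under [RHS]eq_integral do rewrite !(mul0r, mulr0) mule0.
    by rewrite !integral0.
  have p1 : arc_indic (phi : T) = 1 by rewrite arc_indicE phi0.
  have s0 : 0 < sin phi by rewrite sin_gt0_pi.
  have sN0 : sin phi != 0 by rewrite gt_eqF.
  (* For fixed phi this is a scaling by a positive number, which turns the condition y > 0 into r >
     0. *)
  have := @transferM _ _ T T R lambda (cst 1) lambda (cst `|sin phi|)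
    (fun t : T => sin phi * t + 0)
    (fun y => pos_indic y * y * (sin phi ^+ 2)^-1).
  have m1 : measurable_fun setT (fun t : T => sin phi * t + 0 : T) by meas.
  have m2 : measurable_fun setT (fun y : T => pos_indic y * y * (sin phi ^+ 2)^-1 : R).
    by meas.
  have k0 x : 0 <= pos_indic x * x * (sin phi ^+ 2)^-1.
    by rewrite mulr_ge0 ?pos_indicM_ge0// invr_ge0 sqr_ge0.
  move=> /(_ m1 m2 k0 (affine_transfer 0 sN0)).
  apply: transfer_congr.
  - by move=> x; rewrite p1 /= mulr1 mul1r.
  - move=> r /=; rewrite p1 mul1r addr0 gtr0_norm// /pos_indic pmulr_rgt0//.
    by field.
  - by move=> t _; rewrite addr0 mulrC.
have mg2 : measurable_fun setT (fun t : T * T => (g t, t.2)) by meas.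
have := transfer_comp mg2 H1 H2.
(* A nonzero weight forces sin phi > 0, so r sin phi times cot phi is r cos phi. *)
apply: transfer_congr => // t; rewrite /v /g /h/= arc_indicE.
case: (boolP (0 < t.1 < pi)) => [t1 _|]; last by rewrite mul0r eqxx.
have s0 : sin t.1 != 0 by rewrite gt_eqF// sin_gt0_pi.
by congr (_, _); field.
Qed.

End polar_coordinates.

(** * Polar coordinates in the whole plane *)

Section spherical_coordinates.
Context {R : realType}.
Local Notation T := (measurableTypeR R).
Local Notation lambda := (@lebesgue_measure R).

Lemma transfer_ae_lebesgue (u w : T -> R) (s : seq R) :
  measurable_fun setT u -> measurable_fun setT w ->
  (forall x, x \notin s -> u x = w x) -> transfer lambda u lambda w id.
Proof.
move=> mu_ mw uw; apply: transfer_ae => //.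
exists [set` s]; split.
- apply: countable_measurable; first exact: measurable_set1.
  exact: finite_set_countable (finite_seq s).
- apply: countable_lebesgue_measure0; exact: finite_set_countable (finite_seq s).
- by move=> x /= uwx; apply/negPn/negP => /uw.
Qed.

(** Reflection through the origin exchanges the two half-planes; it is the affine rule with slope -1
    in each coordinate in turn. *)
Lemma reflect_transfer :
  transfer (sfprod lambda lambda) (fun p => pos_indic (- p.2))
    (sfprod lambda lambda) (fun p => pos_indic p.2)
    (fun p => (- p.1, - p.2) : T * T).
Proof.
have mN : measurable_fun setT (fun x : T => - x : T) by meas.
have mpN : measurable_fun setT (fun x : T => pos_indic (- x)).
  exact: (measurableT_comp measurable_pos_indic mN).
have NA k : measurable_fun setT (k : T -> R) -> (forall x, 0 <= k x) ->
    transfer lambda k lambda (fun x => k (- x)) (fun x : T => - x : T).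
  move=> mk k0.
  have N1 : (-1 : R) != 0 by rewrite oppr_eq0 oner_eq0.
  have mg : measurable_fun setT (fun t : T => -1 * t + 0 : T) by meas.
  apply: transfer_congr (transferM mg mk k0 (affine_transfer 0 N1)).
  - by move=> x; rewrite mulr1.
  - by move=> x /=; rewrite normrN normr1 mulr1 mulN1r addr0.
  - by move=> x _; rewrite mulN1r addr0.
have H1 : transfer (sfprod lambda lambda) (fun p => pos_indic (- p.2))
    (sfprod lambda lambda) (fun p => pos_indic (- p.2))
    (fun p => (- p.1, p.2) : T * T).
  apply: (@transfer_prodl _ _ _ _ _ _ _ _ _ _ _ _ (fun p : T * T => - p.1 : T)).
  - exact: (measurable_sndX mpN).
  - by move=> ?; exact: pos_indic_ge0.
  - exact: (measurable_sndX mpN).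
  - by move=> ?; exact: pos_indic_ge0.
  - exact: (measurable_fstX mN).
  - move=> y /=; apply: (NA (cst (pos_indic (- y)))); first exact: measurable_cst.
    by move=> ?; exact: pos_indic_ge0.
have H2 : transfer (sfprod lambda lambda) (fun p => pos_indic (- p.2))
    (sfprod lambda lambda) (fun p => pos_indic p.2)
    (fun p => (p.1, - p.2) : T * T).
  apply: (@transfer_prod _ _ _ _ _ _ _ _ _ _ _ _ (fun p : T * T => - p.2 : T)).
  - exact: (measurable_sndX mpN).
  - by move=> ?; exact: pos_indic_ge0.
  - by meas.
  - by move=> ?; exact: pos_indic_ge0.
  - exact: (measurable_sndX mN).
  - move=> x /=.
    apply: transfer_congr (NA (fun y => pos_indic (- y)) mpN _) => // y.
      by rewrite opprK.
by apply: transfer_comp H1 H2; meas; exact: (measurable_fstX mN).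
Qed.

Definition turn_indic (phi : T) : R := arc_indic phi + arc_indic (phi - pi : T).

Lemma turn_indic_ge0 phi : 0 <= turn_indic phi.
Proof. by rewrite addr_ge0// arc_indic_ge0. Qed.

Lemma measurable_turn_indic : measurable_fun setT turn_indic.
Proof.
apply: measurable_funD; first by meas.
by apply: (measurableT_comp measurable_arc_indic); meas.
Qed.

(** Off the line y = 0, which is null, the plane is the upper half-plane and its reflection through
    the origin. On the reflected half the angle is shifted by pi, and the sign changes of [cos] and
    [sin] under this shift undo the reflection. *)
Lemma plane_polar :
  transfer (sfprod lambda lambda) (cst 1) (sfprod lambda lambda)
    (fun t => turn_indic t.1 * (pos_indic t.2 * t.2))
    (fun t => (t.2 * cos t.1, t.2 * sin t.1)).
Proof.
have mN : measurable_fun setT (fun x : T => - x : T) by meas.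
have mpN : measurable_fun setT (fun x : T => pos_indic (- x)).
  exact: (measurableT_comp measurable_pos_indic mN).
have mB : measurable_fun setT (fun x : T => x - pi : T) by meas.
have maB : measurable_fun setT (fun x : T => arc_indic (x - pi : T)).
  exact: (measurableT_comp measurable_arc_indic mB).
have H0 : transfer (sfprod lambda lambda) (cst 1) (sfprod lambda lambda)
    (fun p => pos_indic p.2 + pos_indic (- p.2)) (fun p => (p.1, p.2)).
  apply: (@transfer_prod _ _ _ _ _ _ _ _ _ _ _ _ (fun p : T * T => p.2)) => //.
  - by apply: measurable_funD; [meas|exact: (measurable_sndX mpN)].
  - by move=> x; rewrite addr_ge0// pos_indic_ge0.
  - by meas.
  - move=> x /=; apply: (@transfer_ae_lebesgue (cst 1) (fun t => pos_indic t + pos_indic (- t)) [:: 0]) => //.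
      by apply: measurable_funD; [meas|exact: mpN].
    by move=> y; rewrite inE /pos_indic oppr_gt0 => /lt_total/orP[] y0;
      rewrite y0 ?(le_gtF (ltW y0)) ?add0r ?addr0.
have H1 : transfer (sfprod lambda lambda) (fun p => pos_indic (- p.2))
    (sfprod lambda lambda)
    (fun t => arc_indic (t.1 - pi : T) * (pos_indic t.2 * t.2))
    (fun t => (t.2 * cos t.1, t.2 * sin t.1)).
  have Hs : transfer (sfprod lambda lambda)
      (fun t => arc_indic t.1 * (pos_indic t.2 * t.2)) (sfprod lambda lambda)
      (fun t => arc_indic (t.1 - pi : T) * (pos_indic t.2 * t.2))
      (fun t => (t.1 - pi, t.2) : T * T).
    apply: (@transfer_prodl _ _ _ _ _ _ _ _ _ _ _ _ (fun p : T * T => p.1 - pi : T)).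
    - by meas.
    - by move=> t; rewrite mulr_ge0 ?arc_indic_ge0 ?pos_indicM_ge0.
    - by apply: measurable_funM; [exact: (measurable_fstX maB)|meas].
    - by move=> t; rewrite mulr_ge0 ?arc_indic_ge0 ?pos_indicM_ge0.
    - exact: (measurable_fstX mB).
    - move=> r /=.
      have mg : measurable_fun setT (fun t : T => 1 * t + - pi : T) by meas.
      have mk : measurable_fun setT (fun t : T => arc_indic t * (pos_indic r * r)).
        by meas.
      have k0 t : 0 <= arc_indic (t : T) * (pos_indic r * r).
        by rewrite mulr_ge0 ?arc_indic_ge0 ?pos_indicM_ge0.
      apply: transfer_congr
        (transferM mg mk k0 (affine_transfer (- pi) (oner_neq0 R))).
      + by move=> x; rewrite mulr1.
      + by move=> x /=; rewrite normr1 mulr1 mul1r.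
      + by move=> x _; rewrite mul1r.
  have m1 : measurable_fun setT (fun p : T * T => (- p.1, - p.2) : T * T) by meas.
  have m2 : measurable_fun setT (fun t : T * T => (t.2 * cos t.1, t.2 * sin t.1) : T * T) by meas.
  have Hc := transfer_comp (measurableT_comp m1 m2)
    (transfer_comp m1 reflect_transfer half_polar) Hs.
  apply: transfer_congr Hc => // t _ /=.
  have E1 : cos (t.1 - pi) = - cos t.1 by rewrite -[in RHS](subrK pi t.1) cosDpi opprK.
  have E2 : sin (t.1 - pi) = - sin t.1 by rewrite -[in RHS](subrK pi t.1) sinDpi opprK.
  by rewrite E1 E2 !mulrN !opprK.
have mg : measurable_fun setT (fun t : T * T => (t.2 * cos t.1, t.2 * sin t.1) : T * T).
  by meas.
have mi : measurable_fun setT (fun p : T * T => (p.1, p.2)) by meas.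
have H2 := transferD mg _ _ _ _ _ _ _ _ half_polar H1.
apply: transfer_congr (transfer_comp mi H0 (H2 _ _ _ _ _ _ _ _)) => //.
- by move=> t; rewrite /turn_indic mulrDl.
- by meas.
- exact: (measurable_sndX mpN).
- by meas.
- by move=> t; rewrite mulr_ge0 ?arc_indic_ge0 ?pos_indicM_ge0.
- by apply: measurable_funM; [exact: (measurable_fstX maB)|meas].
- by move=> t; rewrite mulr_ge0 ?arc_indic_ge0 ?pos_indicM_ge0.
Qed.

End spherical_coordinates.

(** * Spherical coordinates for volume and for surface area *)

Section spherical_transfer.
Context {R : realType}.
Local Notation T := (measurableTypeR R).
Local Notation lambda := (@lebesgue_measure R).

Definition full_indic (phi : T) : R := \1_(`[0, 2 * pi]%classic : set T) phi.

Lemma full_indicE (phi : R) : full_indic phi = (0 <= phi <= 2 * pi)%R%:R.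
Proof. by rewrite /full_indic indicE mem_setE in_itv. Qed.

Lemma full_indic_ge0 phi : 0 <= full_indic phi.
Proof. by rewrite full_indicE. Qed.

Lemma measurable_full_indic : measurable_fun setT full_indic.
Proof. by apply: measurable_indic; exact: measurable_itv. Qed.

Let mf1 d (U : measurableType d) :
  measurable_fun setT (fun t : T * U => full_indic t.1).
Proof. exact: (measurable_fstX measurable_full_indic). Qed.

Lemma two_arcs (p x : R) : 0 < p -> x != 0 -> x != p -> x != 2 * p ->
  ((0 < x < p)%R + (0 < x - p < p)%R)%N = (0 <= x <= 2 * p)%R.
Proof.
rewrite subr_gt0 ltrBlDr mulrDl !mul1r => p0.
case: (ltgtP x 0) => // hx _; case: (ltgtP x p) => // hp _;
  case: (ltgtP x (p + p)) => // hpp _; exfalso; lra.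
Qed.

(** The closed interval of azimuths in [angles] and the two open arcs of [plane_polar] differ at 0,
    pi and 2 pi only. *)
Lemma plane_polar_full :
  transfer (sfprod lambda lambda) (cst 1) (sfprod lambda lambda)
    (fun t => full_indic t.1 * (pos_indic t.2 * t.2))
    (fun t => (t.2 * cos t.1, t.2 * sin t.1)).
Proof.
have mt : measurable_fun setT (fun t : T * T => turn_indic t.1).
  exact: (measurable_fstX measurable_turn_indic).
have mf : measurable_fun setT (fun t : T * T => full_indic t.1).
  exact: (measurable_fstX measurable_full_indic).
have mp : measurable_fun setT (fun t : T * T => pos_indic t.2 * t.2 : R) by meas.
have H : transfer (sfprod lambda lambda)
    (fun t => turn_indic t.1 * (pos_indic t.2 * t.2)) (sfprod lambda lambda)
    (fun t => full_indic t.1 * (pos_indic t.2 * t.2)) (fun t => (t.1, t.2)).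
  apply: (@transfer_prodl _ _ _ _ _ _ _ _ _ _ _ _ (fun p : T * T => p.1)).
  - exact: measurable_funM.
  - by move=> t; rewrite mulr_ge0 ?turn_indic_ge0 ?pos_indicM_ge0.
  - exact: measurable_funM.
  - by move=> t; rewrite mulr_ge0 ?full_indic_ge0 ?pos_indicM_ge0.
  - by meas.
  move=> r /=; apply: (@transfer_ae_lebesgue _
    (fun x => turn_indic x * (pos_indic r * r))
    (fun x => full_indic x * (pos_indic r * r)) [:: 0; pi; 2 * pi]).
  - by apply: measurable_funM => //; exact: measurable_turn_indic.
  - by apply: measurable_funM => //; exact: measurable_full_indic.
  - move=> x; rewrite !inE !negb_or => /and3P[x0 x1 x2]; congr (_ * _).
    by rewrite /turn_indic !arc_indicE full_indicE -natrD two_arcs ?pi_gt0.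
have mg : measurable_fun setT (fun t : T * T => (t.2 * cos t.1, t.2 * sin t.1) : T * T).
  by meas.
by apply: transfer_congr (transfer_comp mg plane_polar H).
Qed.

(** The point [t] is ((theta, phi), r), and r^2 sin theta is the Jacobian of spherical
    coordinates. *)
Definition ball_density (t : T * T * T) : R :=
  \1_(@angles R) t.1 * (pos_indic t.2 * (t.2 ^+ 2 * sin t.1.1)).

(** The polar angle ranges over a closed interval in [angles] but over an open arc in [half_polar];
    the factor [sin] vanishes at the two ends, which reconciles them pointwise. *)
Lemma angle_indicE (t : T * T) : \1_(@angles R) t * sin t.1 =
  arc_indic t.1 * full_indic t.2 * sin t.1.
Proof.
rewrite indicE arc_indicE full_indicE.
have -> : (t \in angles) = (0 <= t.1 <= pi) && (0 <= t.2 <= 2 * pi).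
  by apply/idP/idP; rewrite inE /angles /= !in_itv/= => /andP.
case: (0 <= t.2 <= _); rewrite ?andbF ?mulr0// andbT mulr1.
rewrite !le_eqVlt; case: eqP => [<-|_]; first by rewrite sin0 !mulr0.
by case: eqP => [->|_]; first by rewrite sinpi !mulr0.
Qed.

Lemma ball_density_ge0 t : 0 <= ball_density t.
Proof.
have -> : ball_density t = (\1_(@angles R) t.1 * sin t.1.1) * (pos_indic t.2 * (t.2 ^+ 2)).
  by rewrite /ball_density; ring.
rewrite angle_indicE mulr_ge0//; last by rewrite mulr_ge0 ?sqr_ge0.
rewrite mulrAC mulr_ge0 ?full_indic_ge0// arc_indicE.
by case: (boolP (0 < _ < _)) => [/sin_gt0_pi/ltW|]; rewrite ?mul1r ?mul0r.
Qed.

Lemma spherical_transfer_sfprod :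
  transfer (sfprod (sfprod lambda lambda) lambda) (cst 1) (sfprod (sfprod lambda lambda) lambda)
    ball_density (fun t => spherical t.2 t.1).
Proof.
have mpp : measurable_fun setT (fun t : T * T => (t.2 * cos t.1, t.2 * sin t.1) : T * T).
  by meas.
have mw0 : measurable_fun setT (fun t : T * T => full_indic t.1 * (pos_indic t.2 * t.2)).
  by apply: measurable_funM; [exact: mf1|meas].
have m1 := @measurable_fst _ _ (T * T)%type T.
have m2 := @measurable_snd _ _ T (T * T)%type.
(* A0 uses cylindrical coordinates ((phi, s), z); HB then sends (theta, r) to
   (s, z) = (r sin theta, r cos theta). *)
have A0 : transfer (sfprod (sfprod lambda lambda) lambda) (cst 1) (sfprod (sfprod lambda lambda) lambda)
    (fun t => full_indic t.1.1 * (pos_indic t.1.2 * t.1.2))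
    (fun t => ((t.1.2 * cos t.1.1, t.1.2 * sin t.1.1), t.2)).
  apply: (@transfer_prodl _ _ _ _ _ _ _ _ _ _ (cst 1) _
    (fun p : T * T * T => (p.1.2 * cos p.1.1, p.1.2 * sin p.1.1) : T * T)) => //.
  - exact: (measurableT_comp mw0 m1).
  - by move=> t; rewrite mulr_ge0 ?full_indic_ge0 ?pos_indicM_ge0.
  - exact: (measurableT_comp mpp m1).
  - by move=> z; exact: plane_polar_full.
have A1 := transfer_assoc lambda lambda lambda (measurableT_comp mw0 m1)
   (fun t => mulr_ge0 (full_indic_ge0 _) (pos_indicM_ge0 _)).
pose B (t : T * T) : R := arc_indic t.1 * (pos_indic t.2 * (t.2 ^+ 2 * sin t.1)).
have mB : measurable_fun setT B by meas.
have B0 t : 0 <= B t.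
  rewrite /B arc_indicE; case/boolP : (0 < t.1 < pi) => [/sin_gt0_pi/ltW|].
    by rewrite mul1r => ?; rewrite mulr_ge0// mulr_ge0// sqr_ge0.
  by rewrite mul0r.
pose gB (t : T * T) : T * T := (t.2 * sin t.1, t.2 * cos t.1).
have mgB : measurable_fun setT gB by meas.
have HB : transfer (sfprod lambda lambda) (fun p => pos_indic p.1 * p.1)
    (sfprod lambda lambda) B gB.
  have mp : measurable_fun setT (fun p : T * T => pos_indic p.1) by meas.
  have msw : measurable_fun setT (fun p : T * T => (p.2, p.1)) by meas.
  have S := transfer_swap lambda lambda mp (fun=> pos_indic_ge0 _).
  (* The Jacobian s of the cylindrical step is carried along as a factor. [transferM] wants it
     nonnegative everywhere, hence the absolute value, which is s itself where s > 0. *)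
  have mk : measurable_fun setT (fun p : T * T => `|p.1 : R| : R).
    by apply: measurableT_comp => //; exact: (measurable_fstX measurable_idR).
  have := transferM (measurableT_comp msw mpp) mk (fun p => normr_ge0 _)
    (transfer_comp msw S half_polar).
  apply: transfer_congr => //.
  - move=> p; rewrite /pos_indic.
    by case: ltP => p0; rewrite ?mulr0 ?mul0r// mulr1 mul1r gtr0_norm.
  - move=> t; rewrite /B /= arc_indicE /pos_indic.
    case/boolP : (0 < t.1 < pi) => [/sin_gt0_pi t1|]; last by rewrite !mul0r mulr0.
    case: ltP => t2; last by rewrite !(mul0r, mulr0).
    by rewrite gtr0_norm ?mulr_gt0//; ring.
have A2 : transfer (sfprod lambda (sfprod lambda lambda))
    (fun t => full_indic t.1 * (pos_indic t.2.1 * t.2.1))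
    (sfprod lambda (sfprod lambda lambda)) (fun t => full_indic t.1 * B t.2)
    (fun t => (t.1, gB t.2)).
  apply: (@transfer_prod _ _ _ _ _ _ _ _ _ _ _ _
      (fun p : T * (T * T) => gB p.2)) => //.
  - apply: measurable_funM; first exact: mf1.
    apply: (measurableT_comp (_ : measurable_fun setT
      (fun t : T * T => pos_indic t.1 * t.1 : R)) m2).
    by meas.
  - by move=> t; rewrite mulr_ge0 ?full_indic_ge0 ?pos_indicM_ge0.
  - by apply: measurable_funM; [exact: mf1|exact: (measurableT_comp mB m2)].
  - by move=> t; rewrite mulr_ge0 ?full_indic_ge0.
  - exact: (measurableT_comp mgB m2).
  - by move=> phi; exact: (transferM mgB (measurable_cst _)
      (fun=> full_indic_ge0 phi) HB).
have mw2 : measurable_fun setT (fun t : T * (T * T) => full_indic t.1 * B t.2).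
  by apply: measurable_funM; [exact: mf1|exact: (measurableT_comp mB m2)].
have w20 (t : T * (T * T)) : 0 <= full_indic t.1 * B t.2.
  by rewrite mulr_ge0 ?full_indic_ge0.
have A3 := transfer_assocV lambda lambda lambda mw2 w20.
pose C (t : T * T * T) : R := full_indic t.1.1 * B (t.1.2, t.2).
pose C' (t : T * T * T) : R := full_indic t.1.2 * B (t.1.1, t.2).
have mfst3 := measurableT_comp (@measurable_fst _ _ T T) m1.
have msnd3 := measurableT_comp (@measurable_snd _ _ T T) m1.
have mthird := @measurable_snd _ _ (T * T)%type T.
have mC : measurable_fun setT C.
  apply: measurable_funM; first exact: (measurableT_comp measurable_full_indic mfst3).
  exact: (measurableT_comp mB (measurable_fun_pair msnd3 mthird)).
have mC' : measurable_fun setT C'.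
  apply: measurable_funM; first exact: (measurableT_comp measurable_full_indic msnd3).
  exact: (measurableT_comp mB (measurable_fun_pair mfst3 mthird)).
(* The variables now stand as ((phi, theta), r); [spherical] takes the polar angle first. *)
have A4 : transfer (sfprod (sfprod lambda lambda) lambda) C
    (sfprod (sfprod lambda lambda) lambda) C' (fun t => ((t.1.2, t.1.1), t.2)).
  apply: (@transfer_prodl _ _ _ _ _ _ _ _ _ _ _ _
      (fun p : T * T * T => (p.1.2, p.1.1) : T * T)) => //.
  - by move=> t; rewrite /C mulr_ge0 ?full_indic_ge0.
  - by move=> t; rewrite /C' mulr_ge0 ?full_indic_ge0.
  - exact: measurable_fun_pair.
  - move=> r; apply: transfer_swap.
      exact: (measurableT_comp mC (pair2_measurable r)).
    by move=> t; rewrite /C mulr_ge0 ?full_indic_ge0.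
have g0m : measurable_fun setT (fun t : T * T * T =>
   ((t.1.2 * cos t.1.1, t.1.2 * sin t.1.1), t.2) : T * T * T).
  by apply: measurable_fun_pair => //; exact: (measurableT_comp mpp m1).
have g1m : measurable_fun setT (fun t : T * (T * T) => ((t.1, t.2.1), t.2.2)).
  apply: measurable_fun_pair; first apply: measurable_fun_pair => //.
    exact: (measurableT_comp (@measurable_fst _ _ T T) m2).
  exact: (measurableT_comp (@measurable_snd _ _ T T) m2).
have g2m : measurable_fun setT (fun t : T * (T * T) => (t.1, gB t.2)).
  by apply: measurable_fun_pair => //; exact: (measurableT_comp mgB m2).
have g3m : measurable_fun setT (fun t : T * T * T => (t.1.1, (t.1.2, t.2))).
  by apply: measurable_fun_pair => //; exact: measurable_fun_pair.
have A01 := transfer_comp g0m A0 A1.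
have m01 := measurableT_comp g0m g1m.
have A02 := transfer_comp m01 A01 A2.
have m02 := measurableT_comp m01 g2m.
have A03 := transfer_comp m02 A02 A3.
have m03 := measurableT_comp m02 g3m.
have A04 := transfer_comp m03 A03 A4.
apply: transfer_congr A04 => //.
- move=> t; rewrite /ball_density /C' /B /=.
  transitivity (arc_indic t.1.1 * full_indic t.1.2 * sin t.1.1 * (pos_indic t.2 * t.2 ^+ 2)); first ring.
  by rewrite -angle_indicE; ring.
- by move=> t _; rewrite /spherical/= !mulrA.
Qed.

(** [volume] and the iterated [sfprod] are the same measure by conversion. *)
Lemma spherical_transfer :
  transfer volume (cst 1) (sfprod (sfprod lambda lambda) lambda)
    ball_density (fun t => spherical t.2 t.1).
Proof. exact: spherical_transfer_sfprod. Qed.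

(** Since [surface] is defined through the angles, its definition is this rule on indicators, and
    [transfer_sets] extends it to integrands. *)
Lemma surface_transfer (rho : R) : transfer (surface rho) (cst 1)
  (sfprod lambda lambda) (fun t => \1_(@angles R) t * (rho ^+ 2 * sin t.1))
  (spherical rho).
Proof.
have ma := @measurable_angles R.
have d0 t : 0 <= \1_(@angles R) t * (rho ^+ 2 * sin t.1).
  rewrite mulrCA mulr_ge0 ?sqr_ge0// angle_indicE mulrAC mulr_ge0 ?full_indic_ge0//.
  rewrite arc_indicE; case: (boolP (0 < _ < _)) => [/sin_gt0_pi/ltW|]; by rewrite ?mul1r ?mul0r.
apply: transfer_sets => //.
- by apply: measurable_funM; [exact: measurable_indic|meas].
- exact: measurable_spherical.
move=> A mA; rewrite (_ : \int[_]_(x in A) _ = \int[surface rho]_(x in A) (cst 1 x))%E//.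
rewrite integral_cst// mul1e /= /surface setIC integral_mkcondr.
by apply: eq_integral => t _; rewrite epatch_indic/= muleC -EFinM.
Qed.

End spherical_transfer.

(** * Radial divergence theorem for functions of class C^1 *)

(** The two difference quotients are the same function of the increment; directional derivatives
    thereby become one-variable calculus. *)
Lemma is_derive_line (R : realType) (V W : normedModType R) (f : V -> W)
    (x v : V) (t : R) (d : W) :
  is_derive (t *: v + x) v f d <->
  is_derive t (1 : R) (fun h => f (h *: v + x)) d.
Proof.
have E : (fun h => h^-1 *: ((f \o shift (t *: v + x)) (h *: v) - f (t *: v + x)))
    = (fun h : R => h^-1 *: (((fun s => f (s *: v + x)) \o shift t) (h *: 1) -
         f (t *: v + x))).
  apply/funext => h /=; congr (_ *: (f _ - _)).
  by rewrite addrA -scalerDl [h *: 1]mulr1.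
by split=> -[]; rewrite /derivable /derive ?E => D1 D2; constructor;
  rewrite /derivable /derive ?E.
Qed.

(** * Continuous functions on space: measurability and local boundedness *)

Section space3.
Context {R : realType}.
Local Notation T := (measurableTypeR R).
Implicit Types (x v p : space3 R) (f : space3 R -> R).

Lemma ball_space3 x (e : R) y : ball x e y <->
  [/\ `|x.1.1 - y.1.1| < e, `|x.1.2 - y.1.2| < e & `|x.2 - y.2| < e].
Proof. by split=> [[[? ?] ?]|[? ? ?]]; [split|split; [split|]]. Qed.

(** The measurable sets are those of the product, generated by rectangles; an open set is the
    countable union of the cubes with rational centre and half-side 1/(n+1) that it contains. *)
Lemma open_measurable_space3 (U : set (space3 R)) : open U -> measurable U.
Proof.
move=> oU.
pose B (q : rat * rat * rat * nat) : set (space3 R) :=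
  (`]ratr q.1.1.1 - q.2.+1%:R^-1, ratr q.1.1.1 + q.2.+1%:R^-1[ `*`
   `]ratr q.1.1.2 - q.2.+1%:R^-1, ratr q.1.1.2 + q.2.+1%:R^-1[) `*`
   `]ratr q.1.2 - q.2.+1%:R^-1, ratr q.1.2 + q.2.+1%:R^-1[.
pose F q : set (space3 R) := if `[< B q `<=` U >] then B q else set0.
have -> : U = \bigcup_q F q.
  apply/seteqP; split => [x Ux|x [q _]]; last first.
    by rewrite /F; case: asboolP => // BU /BU.
  move: oU; rewrite openE => /(_ _ Ux) /nbhs_ballP[e /= e0 xeU].
  (* Half of [e]: a cube of half-side d whose centre is within d of [x] stays within 2 d < e of
     [x]. *)
  have [N _ /(_ N (leqnn N)) /=] := near_infty_natSinv_lt (PosNum (divr_gt0 e0 (ltr0Sn R 1))).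
  rewrite ltr_pdivlMr// => HN.
  have N0 : 0 < (N.+1%:R^-1 : R) by rewrite invr_gt0.
  set d := N.+1%:R^-1 in HN N0.
  have rat_near (a : R) : {q : rat | a - d < ratr q < a + d}.
    by apply/cid; have [|q] := @rat_in_itvoo R (a - d) (a + d); [lra|exists q; rewrite in_itv in p].
  have [q1 h1] := rat_near x.1.1; have [q2 h2] := rat_near x.1.2.
  have [q3 h3] := rat_near x.2.
  have Bx : B (q1, q2, q3, N) x.
    by rewrite /B /= !in_itv/= -/d; repeat split; lra.
  exists (q1, q2, q3, N) => //; rewrite /F asboolT// => y.
  rewrite /B /= !in_itv/= -/d => -[[y1 y2] y3]; apply: xeU.
  by apply/ball_space3; rewrite !ltr_norml; split; lra.
apply: countable_bigcupT_measurable => // q; rewrite /F; case: asboolP => // _.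
by apply: measurableX; [apply: measurableX|]; exact: measurable_itv.
Qed.

Lemma continuous_measurable_space3 f : continuous f -> measurable_fun setT f.
Proof.
move=> /continuousP cf; apply: (measurability _ (RGenOpens.measurableE R)).
move=> _ [_ [a [b ->] <-]]; rewrite setTI; apply: open_measurable_space3.
exact/cf/interval_open.
Qed.

Lemma continuous_bounded_box f (r : R) : continuous f ->
  exists2 M, 0 <= M & forall x, `|x.1.1| <= r -> `|x.1.2| <= r -> `|x.2| <= r ->
  `|f x| <= M.
Proof.
move=> cf; pose K : set (space3 R) := (`[- r, r] `*` `[- r, r]) `*` `[- r, r].
have cK : compact K.
  by apply: compact_setX; [apply: compact_setX|]; exact: segment_compact.
have /compact_bounded [M [Mr HM]] := continuous_compact (continuous_subspaceT cf) cK.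
exists (Num.max 0 (M + 1)); first by rewrite le_max lexx.
move=> x x1 x2 x3; rewrite le_max; apply/orP; right.
apply: (HM (M + 1)); first by rewrite ltrDl.
by exists x => //; rewrite /K /= !in_itv/= -!ler_norml.
Qed.

End space3.

(** * The Euclidean norm, the shell and the spheres *)

Section enorm.
Context {R : realType}.
Local Notation T := (measurableTypeR R).
Implicit Types (x v p : space3 R) (f : space3 R -> R).

Definition coord x (i : 'I_3) : R :=
  if i == 0 :> nat then x.1.1 else if i == 1 :> nat then x.1.2 else x.2.

Lemma big_ord3 (F : 'I_3 -> R) : \sum_i F i = F 0 + F 1 + F 2.
Proof.
rewrite !big_ord_recr big_ord0/= add0r.
by congr (F _ + F _ + F _); exact: val_inj.
Qed.

Lemma ord3P (i : 'I_3) : [\/ i = 0, i = 1 | i = 2].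
Proof.
by case: i => [[|[|[|//]]] Hi]; [apply: Or31|apply: Or32|apply: Or33]; exact: val_inj.
Qed.

Definition sqnorm x : R := x.1.1 ^+ 2 + x.1.2 ^+ 2 + x.2 ^+ 2.

Lemma sqnorm_ge0 x : 0 <= sqnorm x.
Proof. by rewrite !addr_ge0// sqr_ge0. Qed.

Lemma sqr_enorm x : enorm x ^+ 2 = sqnorm x.
Proof. by rewrite sqr_sqrtr// sqnorm_ge0. Qed.

Lemma enorm_ge0 x : 0 <= enorm x. Proof. exact: sqrtr_ge0. Qed.

Lemma coord_le_enorm x i : `|coord x i| <= enorm x.
Proof.
rewrite -(ler_pXn2r (ltn0Sn 1)) ?nnegrE ?normr_ge0 ?enorm_ge0//.
rewrite sqr_enorm real_normK ?num_real// /sqnorm.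
by case: (ord3P i) => ->; rewrite /coord/=; have := sqr_ge0 x.1.1;
  have := sqr_ge0 x.1.2; have := sqr_ge0 x.2; lra.
Qed.

Lemma continuous_fst1 : continuous (fun x => x.1.1 : R).
Proof. by move=> x; apply: (@continuous_comp _ _ _ fst fst); exact: cvg_fst. Qed.

Lemma continuous_fst2 : continuous (fun x => x.1.2 : R).
Proof.
by move=> x; apply: (@continuous_comp _ _ _ fst snd); [exact: cvg_fst|exact: cvg_snd].
Qed.

Lemma continuous_snd3 : continuous (fun x => x.2 : R).
Proof. by move=> x; exact: cvg_snd. Qed.

Lemma continuous_coord i : continuous (coord ^~ i).
Proof.
case: (ord3P i) => ->; [exact: continuous_fst1|exact: continuous_fst2|
  exact: continuous_snd3].
Qed.

Lemma continuous_sqnorm : continuous sqnorm.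
Proof.
have sq (g : space3 R -> R) : continuous g -> continuous (fun x => g x ^+ 2).
  by move=> cg x; apply: cvgM; exact: cg.
move=> x; apply: cvgD; [apply: cvgD|].
- exact: (sq _ continuous_fst1).
- exact: (sq _ continuous_fst2).
- exact: (sq _ continuous_snd3).
Qed.

Lemma continuous_enorm : continuous (@enorm R).
Proof.
move=> x; apply: (@continuous_comp _ _ _ sqnorm Num.sqrt).
  exact: continuous_sqnorm.
exact: sqrt_continuous.
Qed.

Lemma measurable_enorm : measurable_fun setT (@enorm R).
Proof. exact: continuous_measurable_space3 continuous_enorm. Qed.

Lemma measurable_coord i : measurable_fun setT (coord ^~ i).
Proof. exact: continuous_measurable_space3 (@continuous_coord i). Qed.

Lemma measurable_shell (r1 r2 : R) : measurable (shell r1 r2).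
Proof.
rewrite (_ : shell r1 r2 = setT `&` @enorm R @^-1` `]r1, r2[%classic).
  exact: (measurable_enorm measurableT (measurable_itv _)).
by rewrite setTI; apply/seteqP; split => x /=; rewrite in_itv.
Qed.

Lemma measurable_sphere (r : R) : measurable (@sphere R r).
Proof.
rewrite (_ : sphere r = setT `&` @enorm R @^-1` [set r]).
  exact: (measurable_enorm measurableT (measurable_set1 _)).
by rewrite setTI.
Qed.

Lemma enorm_spherical (r : R) t : 0 <= r -> enorm (spherical r t) = r.
Proof.
move=> r0; rewrite /enorm /spherical/=.
rewrite (_ : _ + _ = r ^+ 2) ?sqrtr_sqr ?ger0_norm//.
have := cos2Dsin2 t.1; have := cos2Dsin2 t.2.
move: (cos t.2) (sin t.2) (cos t.1) (sin t.1) => a b c d H1 H2.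
transitivity (r ^+ 2 * (d ^+ 2 * (a ^+ 2 + b ^+ 2) + c ^+ 2)); first ring.
by rewrite H1 mulr1 addrC H2 mulr1.
Qed.

Lemma sphericalE (r : R) t : spherical r t = r *: spherical 1 t.
Proof. by rewrite /spherical !mul1r. Qed.

Lemma coord_spherical (r : R) t i : coord (spherical r t) i = r * coord (spherical 1 t) i.
Proof. by case: (ord3P i) => ->; rewrite /coord/= ?mul1r. Qed.

Lemma continuous_bounded_ball f (r : R) : continuous f ->
  exists2 M, 0 <= M & forall x, enorm x <= r -> `|f x| <= M.
Proof.
move=> /(continuous_bounded_box r)[M M0 HM]; exists M => // x xr.
apply: HM; apply: le_trans xr.
- exact: (coord_le_enorm x 0).
- exact: (coord_le_enorm x 1).
- exact: (coord_le_enorm x 2).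
Qed.

End enorm.

(** * Directional derivatives of C^1 functions *)

Section directional.
Context {R : realType}.
Local Notation T := (measurableTypeR R).
Implicit Types (x v p : space3 R) (f : space3 R -> R).

(** The mean value theorem on [0, s] or [s, 0]; the bound on [c] keeps the intermediate point near
    [p], where continuity of the partial derivative can be used. *)
Lemma mvt_axis f p i (s : R) : (forall x, derivable f x (axis i)) ->
  exists2 c, `|c| <= `|s| & f (s *: axis i + p) - f p =
     s * partial i f (c *: axis i + p).
Proof.
move=> df; pose g (h : R) : R := f (h *: axis i + p).
have dg (h : R) : is_derive h (1 : R) g (partial i f (h *: axis i + p)).
  exact: ((@is_derive_line R _ _ f p (axis i) h _).1
    (derivableP (df (h *: axis i + p)))).
have cg : continuous g.
  move=> h; apply/differentiable_continuous/derivable1_diffP.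
  by have [] := dg h.
have g0 : g 0 = f p by rewrite /g scale0r add0r.
rewrite -g0 -/(g s); have [s0|s0] := leP 0 s.
  have [c + ->] := MVT_segment s0 (fun h _ => dg h) (continuous_subspaceT cg).
  rewrite in_itv/= => /andP[c0 cs]; exists c; first by rewrite !ger0_norm.
  by rewrite subr0 mulrC.
have [c + E] := MVT_segment (ltW s0) (fun h _ => dg h) (continuous_subspaceT cg).
rewrite in_itv/= => /andP[c0 cs]; exists c.
  by rewrite ler0_norm// (ltr0_norm s0) lerN2.
by rewrite -opprB E; lra.
Qed.

(** [of_class] speaks of the axes only, while differentiation along rays needs every direction. The
    increment h v is split into three moves parallel to the axes; the mean value theorem on each
    yields partial derivatives at nearby points, and their continuity brings them back to [x]. *)
Lemma class1_is_derive f x v : of_class 1 f ->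
  is_derive x v f (\sum_i coord v i * partial i f x).
Proof.
move=> [cf df].
set D := \sum_i _.
have H : (fun h => h^-1 *: ((f \o shift x) (h *: v) - f x)) @ 0^' --> D.
  apply/cvgrPdist_lt => e e0.
  (* The added 1 keeps [S] positive when v = 0 and makes the final estimate strict. *)
  pose S := `|v.1.1| + `|v.1.2| + `|v.2| + 1.
  have S0 : 0 < S by rewrite ltr_wpDl// !addr_ge0.
  have e1 : 0 < e / S by rewrite divr_gt0.
  have cont i : exists2 d : R, 0 < d & forall y, ball x d y ->
     `|partial i f x - partial i f y| < e / S.
    have [_ [c _]] := df i.
    by have /cvgrPdist_lt/(_ _ e1)/nbhs_ballP[d d0 Hd] := c x; exists d.
  have [d1 d10 H1] := cont 0; have [d2 d20 H2] := cont 1.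
  have [d3 d30 H3] := cont 2.
  pose d := Num.min d1 (Num.min d2 d3).
  have d0 : 0 < d by rewrite !lt_min d10 d20 d30.
  near=> h.
  have h0 : h != 0 by near: h; exact: nbhs_dnbhs_neq.
  have hd : `|h| * S < d.
    rewrite -ltr_pdivlMr//; near: h.
    apply/nbhs_dnbhs; exact: (@nbhs0_lt _ R^o _ (divr_gt0 d0 S0)).
  have hv (a : R) : `|a| <= S -> `|h * a| < d.
    by move=> aS; rewrite normrM (le_lt_trans _ hd)// ler_wpM2l.
  have hv1 : `|h * v.1.1| < d.
    by apply: hv; rewrite /S -!addrA lerDl !addr_ge0.
  have hv2 : `|h * v.1.2| < d.
    by apply: hv; rewrite /S addrAC (addrC `|_|) -!addrA lerDl !addr_ge0.
  have hv3 : `|h * v.2| < d.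
    by apply: hv; rewrite /S (addrC (_ + _) `|v.2|) -!addrA lerDl !addr_ge0.
  pose p1 : space3 R := (h * v.1.1) *: axis 0 + x.
  pose p2 : space3 R := (h * v.1.2) *: axis 1 + p1.
  pose p3 : space3 R := (h * v.2) *: axis 2 + p2.
  have p3E : p3 = h *: v + x.
    rewrite /p3 /p2 /p1 /axis/=; case: (v) (x) => -[a b] c [[a' b'] c'].
    by congr (_, _, _); rewrite /= /GRing.scale/=; ring.
  have [c1 c1h E1] := mvt_axis x (h * v.1.1) (fun x => (df 0).1 x).
  have [c2 c2h E2] := mvt_axis p1 (h * v.1.2) (fun x => (df 1).1 x).
  have [c3 c3h E3] := mvt_axis p2 (h * v.2) (fun x => (df 2).1 x).
  have dd : [/\ d <= d1, d <= d2 & d <= d3].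
    by rewrite /d !ge_min !lexx !orbT; split.
  have [dd1 dd2 dd3] := dd.
  move: (le_lt_trans c1h hv1) (le_lt_trans c2h hv2) (le_lt_trans c3h hv3).
  move: hv1 hv2 hv3; rewrite !ltr_norml.
  move=> /andP[k1 k1'] /andP[k2 k2'] /andP[k3 k3'] /andP[l1 l1'] /andP[l2 l2']
    /andP[l3 l3'].
  have B1 : `|partial 0 f x - partial 0 f (c1 *: axis 0 + x)| < e / S.
    apply: H1; apply/ball_space3.
    by split; rewrite ltr_norml /= /GRing.scale/=; apply/andP;
      clear - dd1 d0 k1 k1' l1 l1'; split; lra.
  have B2 : `|partial 1 f x - partial 1 f (c2 *: axis 1 + p1)| < e / S.
    apply: H2; apply/ball_space3.
    by split; rewrite ltr_norml /p1 /= /GRing.scale/=; apply/andP;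
      clear - dd2 d0 k1 k1' l2 l2'; split; lra.
  have B3 : `|partial 2 f x - partial 2 f (c3 *: axis 2 + p2)| < e / S.
    apply: H3; apply/ball_space3.
    by split; rewrite ltr_norml /p2 /p1 /= /GRing.scale/=; apply/andP;
      clear - dd3 d0 k1 k1' k2 k2' l3 l3'; split; lra.
  have -> : (f \o shift x) (h *: v) - f x =
    h * (v.1.1 * partial 0 f (c1 *: axis 0 + x) +
         v.1.2 * partial 1 f (c2 *: axis 1 + p1) +
         v.2 * partial 2 f (c3 *: axis 2 + p2)).
    rewrite /= -p3E; move: E1 E2 E3; rewrite -/p1 -/p2 -/p3.
    by clear; move=> E1 E2 E3; lra.
  rewrite /D big_ord3 /coord/=.
  move: B1 B2 B3.
  move: (partial 0 f x) (partial 0 f (c1 *: axis 0 + x)) (partial 1 f x)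
    (partial 1 f (c2 *: axis 1 + p1)) (partial 2 f x)
    (partial 2 f (c3 *: axis 2 + p2)) => a1 b1 a2 b2 a3 b3 B1 B2 B3.
  rewrite /GRing.scale/= mulKf//.
  rewrite (_ : _ - _ = v.1.1 * (a1 - b1) + v.1.2 * (a2 - b2) + v.2 * (a3 - b3)); last by ring.
  rewrite -ltr_norml.
  apply: (@le_lt_trans _ _ ((`|v.1.1| + `|v.1.2| + `|v.2|) * (e / S))).
    rewrite !mulrDl (le_trans (ler_normD _ _))// lerD//; last first.
      by rewrite normrM ler_wpM2l// ltW.
    by rewrite (le_trans (ler_normD _ _))// lerD// normrM ler_wpM2l// ltW.
  rewrite -[ltRHS](divfK (lt0r_neq0 S0)) [ltRHS]mulrC ltr_pM2r// /S ltrDl//.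
constructor; first by apply/cvg_ex; exists D.
exact: cvg_lim H.
Unshelve. all: by end_near.
Qed.

End directional.

(** * The divergence theorem along rays *)

Section radial_divergence.
Context {R : realType}.
Local Notation T := (measurableTypeR R).
Local Notation lambda := (@lebesgue_measure R).
Variables (r1 r2 : R) (phi : space3 R -> R) (W w : R -> R).
Hypotheses (r1_gt0 : 0 < r1) (r12 : r1 < r2) (phi1 : of_class 1 phi).
Hypotheses (dW : forall r, is_derive r (1 : R) W (w r)) (cw : continuous w).

Let cphi : continuous phi := phi1.1.
Let dphi i : continuous (partial i phi).
Proof. by have [_ /(_ i)[_ []]] := phi1. Qed.

Let cW : continuous W.
Proof.
by move=> r; apply/differentiable_continuous/derivable1_diffP; have [] := dW r.
Qed.

Let G0 (x : space3 R) : R := phi x * w (enorm x).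
Let G i (x : space3 R) : R := partial i phi x * W (enorm x).

Let cG0 : continuous G0.
Proof.
move=> x; apply: cvgM; first exact: cphi.
by apply: (@continuous_comp _ _ _ (@enorm R) w); [exact: continuous_enorm|exact: cw].
Qed.

Let cG i : continuous (G i).
Proof.
move=> x; apply: cvgM; first exact: dphi.
by apply: (@continuous_comp _ _ _ (@enorm R) W); [exact: continuous_enorm|exact: cW].
Qed.

(** For r >= 0 this is the derivative in r of W(r) phi(r omega), omega being the unit vector with
    angles [z.1]. *)
Let Psi (z : T * T * T) : R := G0 (spherical z.2 z.1) +
  \sum_i coord (spherical 1 z.1) i * G i (spherical z.2 z.1).

Let measurable_spherical2 :
  measurable_fun setT (fun z : T * T * T => spherical z.2 z.1 : space3 R).
Proof.
have m1 := @measurable_fst _ _ (T * T)%type T.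
have ms1 := measurableT_comp (@measurable_spherical R 1) m1.
have mc i := measurableT_comp (@measurable_coord R i) ms1.
have m2 : measurable_fun setT (fun z : T * T * T => z.2 : R) by meas.
rewrite (_ : (fun z => _) = (fun z : T * T * T =>
  (z.2 * coord (spherical 1 z.1) 0, z.2 * coord (spherical 1 z.1) 1,
   z.2 * coord (spherical 1 z.1) 2))); last first.
  by apply/funext => z; rewrite /spherical /coord /= !mul1r.
apply: measurable_fun_pair; first apply: measurable_fun_pair;
  by apply: measurable_funM => //; exact: mc.
Qed.

Let mPsi : measurable_fun setT Psi.
Proof.
have m1 := @measurable_fst _ _ (T * T)%type T.
have ms1 := measurableT_comp (@measurable_spherical R 1) m1.
have mc i := measurableT_comp (@measurable_coord R i) ms1.
apply: measurable_funD.
  exact: (measurableT_comp (continuous_measurable_space3 cG0) measurable_spherical2).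
apply: measurable_sum => i; apply: measurable_funM; first exact: mc.
exact: (measurableT_comp (continuous_measurable_space3 (@cG i)) measurable_spherical2).
Qed.

Let Psi_bound : exists2 M, 0 <= M & forall t (r : R), 0 <= r <= r2 -> `|Psi (t, r)| <= M.
Proof.
have [M0 M00 H0] := continuous_bounded_ball r2 cG0.
have HG i : {M | 0 <= M & forall x, enorm x <= r2 -> `|G i x| <= M}.
  by apply/cid2; exact: continuous_bounded_ball.
pose M i := s2val (HG i).
exists (M0 + \sum_i M i).
  by apply: addr_ge0 => //; apply: sumr_ge0 => i _; exact: (s2valP (HG i)).
move=> t r /andP[r0 rr2]; rewrite (le_trans (ler_normD _ _))// lerD//.
  by apply: H0; rewrite enorm_spherical.
rewrite (le_trans (ler_norm_sum _ _ _))// ler_sum// => i _.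
rewrite normrM -[leRHS]mul1r ler_pM//.
  by rewrite (le_trans (coord_le_enorm _ _))// enorm_spherical.
by apply: (s2valP' (HG i)); rewrite enorm_spherical.
Qed.

Let is_derive_Psi t (r : R) : 0 <= r ->
  is_derive r (1 : R) (fun s : R => W s * phi (spherical s t)) (Psi (t, r)).
Proof.
move=> r0.
have E : (fun s : R => phi (spherical s t)) = (fun s : R => phi (s *: spherical 1 t + 0)).
  by apply/funext => s; rewrite addr0 -sphericalE.
have D2 : is_derive r (1 : R) (fun s : R => phi (spherical s t))
   (\sum_i coord (spherical 1 t) i * partial i phi (spherical r t)).
  rewrite E; have := class1_is_derive (r *: spherical 1 t + 0) (spherical 1 t) phi1.
  move=> /(@is_derive_line R _ _ phi 0 (spherical 1 t) r _).1.
  by rewrite addr0 -sphericalE.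
have D := is_deriveM (dW r) D2; apply: (@is_derive_eq _ _ _ _ _ _ _ _ D).
rewrite /Psi /G0 /G /= enorm_spherical// addrC /GRing.scale/=; congr (_ + _).
by rewrite mulr_sumr; apply: eq_bigr => i _; ring.
Qed.

Let continuous_spherical t : continuous (fun s : R => spherical s t : space3 R).
Proof.
move=> s; rewrite (_ : (fun s => _) = (fun s : R => s *: (spherical 1 t : space3 R))).
  exact: (@scalel_continuous R (space3 R) (spherical 1 t)).
by apply/funext => s'; rewrite -sphericalE.
Qed.

Let continuous_Psi t : continuous (fun s : R => Psi (t, s)).
Proof.
have cc (F : space3 R -> R) : continuous F -> continuous (fun s : R => F (spherical s t)).
  by move=> cF s; apply: (@continuous_comp _ _ _ (fun s : R => spherical s t : space3 R) F);
   [exact: continuous_spherical|exact: cF].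
rewrite (_ : (fun s => _) = (fun s : R => G0 (spherical s t) +
    (coord (spherical 1 t) 0 * G 0 (spherical s t) +
     coord (spherical 1 t) 1 * G 1 (spherical s t) +
     coord (spherical 1 t) 2 * G 2 (spherical s t)))); last first.
  by apply/funext => s; rewrite /Psi big_ord3.
have cG' i (s : R) : coord (spherical 1 t) i * G i (spherical s' t) @[s' --> s] -->
    coord (spherical 1 t) i * G i (spherical s t).
  by apply: cvgM; [exact: cvg_cst|exact: cc (@cG i) s].
by move=> s; apply: cvgD; [exact: cc cG0 s|apply: cvgD; [apply: cvgD|]]; exact: cG'.
Qed.

Let FTC t : (\int[lambda]_(r in `[r1, r2]) (Psi (t, r))%:E =
  (W r2 * phi (spherical r2 t) - W r1 * phi (spherical r1 t))%:E)%E.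
Proof.
have D (r : R) : r1 <= r -> is_derive r (1 : R) (fun s : R => W s * phi (spherical s t)) (Psi (t, r)).
  by move=> rr; apply: is_derive_Psi; rewrite (le_trans (ltW r1_gt0)).
have C (r : R) : r1 <= r -> {for r, continuous (fun s : R => W s * phi (spherical s t))}.
  by move=> /D[+ _] => /derivable1_diffP/differentiable_continuous.
rewrite (@continuous_FTC2 _ (fun r => Psi (t, r)) (fun r => W r * phi (spherical r t)))//.
- exact/continuous_subspaceT/continuous_Psi.
- split.
  + by move=> r; rewrite in_itv/= => /andP[/ltW/D[]].
  + by apply: cvg_at_right_filter; apply: C.
  + by apply: cvg_at_left_filter; apply: C; exact: ltW.
- move=> r; rewrite in_itv/= => /andP[/ltW/D H _].
  by rewrite derive1E derive_val.
Qed.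

Let h (t : T * T) : R := \1_(@angles R) t * sin t.1.

Let mh : measurable_fun setT h.
Proof.
apply: measurable_funM; last by meas.
by apply: measurable_indic; exact: measurable_angles.
Qed.

Let I (r : T) : R := \1_(`]r1, r2[%classic : set T) r.

Let mI : measurable_fun setT I.
Proof. by apply: measurable_indic; exact: measurable_itv. Qed.

(** With X = x W(|x|) / |x|^3 this is phi div X + X . grad phi, the divergence of phi X. *)
Let div_integrand (x : space3 R) : R :=
  phi x * (w (enorm x) / enorm x ^+ 2) +
  (\sum_i coord x i * partial i phi x) * (W (enorm x) / enorm x ^+ 3).

Let angles_fin : (sfprod lambda lambda (@angles R) < +oo)%E.
Proof.
rewrite /sfprod/angles product_measure1E/=; [|exact: measurable_itv|exact: measurable_itv].
by rewrite !lebesgue_measure_itv/=; do 2 case: ifPn => _; rewrite -?EFinB ?mule0 ?mul0e -?EFinM ltry.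
Qed.

Let measurable_div_integrand : measurable_fun setT div_integrand.
Proof.
have me := @measurable_enorm R.
have mk (k : R -> R) : continuous k ->
    measurable_fun setT (fun x : space3 R => k (enorm x)).
  by move=> ck; apply: (measurableT_comp _ me); exact: continuous_measurable_fun.
have mV n : measurable_fun setT (fun x : space3 R => (enorm x ^+ n)^-1 : R).
  by apply: (measurableT_comp measurable_inv); exact: measurable_funX.
apply: measurable_funD.
  apply: measurable_funM; first exact: continuous_measurable_space3.
  by apply: measurable_funM; [exact: mk|exact: mV].
apply: measurable_funM; last by apply: measurable_funM; [exact: mk|exact: mV].
apply: measurable_sum => i; apply: measurable_funM; first exact: measurable_coord.
exact: continuous_measurable_space3.
Qed.

(** The r^2 of the Jacobian cancels the 1/r^2 of the divergence term and reduces x / r^3 to the unit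
    vector in the gradient term, leaving [Psi]. *)
Let polar_integral : (\int[volume]_(x in shell r1 r2) (div_integrand x)%:E =
  \int[sfprod (sfprod lambda lambda) lambda]_z (h z.1 * (I z.2 * Psi z))%:E)%E.
Proof.
rewrite integral_mkcond.
transitivity (\int[volume]_x (((EFin \o div_integrand) \_ (shell r1 r2)) x * (cst 1 x)%:E))%E.
  by apply: eq_integral => x _; rewrite mule1.
rewrite (transfer_integral _ _ _ spherical_transfer)//; last 2 first.
- exact: ball_density_ge0.
- apply/measurable_restrict => //; first exact: measurable_shell.
  exact/measurable_funTS/measurable_EFinP.
apply: eq_integral => -[t r] _; rewrite /ball_density patchE /pos_indic/= /h /I.
(* Radii r <= 0 carry weight 0 on both sides, and [enorm_spherical] applies to the others. *)
have [r0|r0] := ltP 0 r; last first.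
  rewrite !(mul0r, mulr0) mule0 (_ : \1_(`]r1, r2[%classic) r = 0) ?(mul0r, mulr0)//.
  by rewrite indicE memNset//= in_itv/= => /andP[/(lt_trans r1_gt0)]; rewrite ltNge r0.
have -> : (spherical r t \in shell r1 r2) = (r \in (`]r1, r2[%classic : set T)).
  by apply/idP/idP; rewrite !inE /shell/= enorm_spherical ?(ltW r0)// in_itv.
have -> : \1_(`]r1, r2[%classic) r = (r \in (`]r1, r2[%classic : set T))%:R :> R by rewrite indicE.
case: (r \in _); last by rewrite !(mul0r, mulr0) mul0e.
rewrite !mul1r /= -EFinM /div_integrand /Psi /G0 /G /= enorm_spherical ?(ltW r0)//.
congr (_%:E); rewrite [X in _ + X * _](_ : _ = r * \sum_i coord (spherical 1 t) i * partial i phi (spherical r t)); last first.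
  by rewrite mulr_sumr; apply: eq_bigr => i _; rewrite coord_spherical mulrA.
rewrite [X in _ = _ * (_ + X)](_ : _ = (\sum_i coord (spherical 1 t) i * partial i phi (spherical r t)) * W r); last first.
  by rewrite mulr_suml; apply: eq_bigr => i _; rewrite mulrA.
by field; exact: lt0r_neq0.
Qed.

Let J (z : T * T * T) : R := h z.1 * (I z.2 * Psi z).

Let h_le1 t : `|h t| <= 1.
Proof.
rewrite /h normrM -[leRHS]mulr1 ler_pM//; last first.
  by rewrite ler_norml sin_geN1 sin_le1.
by rewrite indicE; case: (_ \in _); rewrite ?normr1 ?normr0.
Qed.

(** Fubini for a signed integrand requires this; [J] is bounded and vanishes off a box of finite
    measure. *)
Let integrable_J : (sfprod (sfprod lambda lambda) lambda).-integrable setT (EFin \o J).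
Proof.
have mJ : measurable_fun setT J.
  apply: measurable_funM; first exact: (measurable_fstX mh).
  by apply: measurable_funM => //; exact: (measurable_sndX mI).
pose A : set (T * T * T) := @angles R `*` (`]r1, r2[%classic : set T).
have mA : measurable A by apply: measurableX; [exact: measurable_angles|exact: measurable_itv].
rewrite (_ : EFin \o J = (EFin \o J) \_ A); last first.
  apply/funext => -[t r]; rewrite patchE; case: ifPn => // Atr.
  rewrite /J /h /I /= !indicE; have [At|At] := boolP (t \in angles); last by rewrite !mul0r.
  have [Ir|Ir] := boolP (r \in _); last by rewrite !(mul0r, mulr0).
  by case/negP: Atr; move: At Ir; rewrite !inE.
apply/(integrable_mkcond _ mA); apply: measurable_bounded_integrable => //.
- rewrite [X in (X < _)%E]product_measure1E//; last exact: measurable_angles.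
  rewrite lte_mul_pinfty ?ge0_fin_numE// /= lebesgue_measure_itv/=.
  by case: ifPn => _; rewrite -?EFinB ltry.
- exact: measurable_funTS.
- have [M M0 HM] := Psi_bound; exists M; split; first exact: num_real.
  move=> N MN /= -[t r] [_ /=]; rewrite in_itv/= => /andP[rr1 rr2].
  rewrite (le_trans _ (ltW MN))// /J normrM -[leRHS]mul1r ler_pM//.
  rewrite normrM -[leRHS]mul1r ler_pM//.
    by rewrite /I indicE; case: (_ \in _); rewrite ?normr1 ?normr0.
  by apply: HM; rewrite (ltW rr2) ltW// (lt_trans r1_gt0).
Qed.

Let inner t : (\int[lambda]_r (J (t, r))%:E =
  (h t * (W r2 * phi (spherical r2 t) - W r1 * phi (spherical r1 t)))%:E)%E.
Proof.
have cP : {within `[r1, r2], continuous (fun r : R => Psi (t, r))}.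
  exact/continuous_subspaceT/continuous_Psi.
have iP : lambda.-integrable `[r1, r2] (fun r => (Psi (t, r))%:E).
  by apply: continuous_compact_integrable => //; exact: segment_compact.
have iP' : lambda.-integrable `]r1, r2[ (fun r => (Psi (t, r))%:E).
  by apply: integrableS iP => //; exact: subset_itv_oo_cc.
have E : (fun r : T => (I r * Psi (t, r))%:E) = (fun r => (Psi (t, r))%:E) \_ `]r1, r2[.
  by apply/funext => r; rewrite patchE /I indicE; case: (_ \in _); rewrite ?mul1r ?mul0r.
have iI : lambda.-integrable setT (fun r : T => (I r * Psi (t, r))%:E).
  rewrite E; exact: ((integrable_mkcond (fun r : T => (Psi (t, r))%:E) (measurable_itv `]r1, r2[)).1 iP').
rewrite /J /=; under eq_integral do rewrite EFinM.
rewrite integralZl// [RHS]EFinM; congr (_ * _)%E.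
rewrite E -integral_mkcond -FTC; apply/esym/integral_itv_bndoo.
by have /integrableP[] := iP'.
Qed.

Let integrable_h_phi (rho : R) : 0 <= rho ->
  (sfprod lambda lambda).-integrable setT (fun t => (h t * phi (spherical rho t))%:E).
Proof.
move=> rho0.
have ms : measurable_fun setT (fun t => phi (spherical rho t)).
  apply: measurableT_comp; first exact: continuous_measurable_space3.
  exact: measurable_spherical.
have -> : (fun t => (h t * phi (spherical rho t))%:E) =
   (EFin \o (fun t => h t * phi (spherical rho t))) \_ (@angles R).
  apply/funext => t; rewrite patchE; case: ifPn => // /negPf At.
  by rewrite /h indicE At !mul0r.
apply/(integrable_mkcond _ (@measurable_angles R)).
apply: measurable_bounded_integrable.
- exact: measurable_angles.
- exact: angles_fin.
- by apply: measurable_funTS; exact: measurable_funM.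
have [M M0 HM] := continuous_bounded_ball rho cphi; exists M; split; first exact: num_real.
move=> N MN /= t _; rewrite (le_trans _ (ltW MN))// normrM -[leRHS]mul1r ler_pM//.
by apply: HM; rewrite enorm_spherical.
Qed.

Let surface_integral (rho : R) : 0 < rho ->
  \int[surface rho]_(x in sphere rho) phi x =
  rho ^+ 2 * \int[sfprod lambda lambda]_t (h t * phi (spherical rho t)).
Proof.
move=> rho0; have irho := integrable_h_phi (ltW rho0).
rewrite -RintegralZl//; congr fine.
rewrite integral_mkcond.
transitivity (\int[surface rho]_x (((EFin \o phi) \_ (sphere rho)) x * (cst 1 x)%:E))%E.
  by apply: eq_integral => x _; rewrite mule1.
rewrite (transfer_integral _ _ _ (surface_transfer rho))//; last 2 first.
- move=> t; rewrite mulrCA mulr_ge0 ?sqr_ge0// angle_indicE mulrAC.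
  rewrite mulr_ge0 ?full_indic_ge0// arc_indicE.
  by case: (boolP (0 < _ < _)) => [/sin_gt0_pi/ltW|]; rewrite ?mul1r ?mul0r.
- apply/measurable_restrict => //; first exact: measurable_sphere.
  apply/measurable_funTS/measurable_EFinP; exact: continuous_measurable_space3 cphi.
apply: eq_integral => t _; rewrite patchE ifT; last first.
  by rewrite inE; exact: (enorm_spherical t (ltW rho0)).
by rewrite /h -EFinM; congr (_%:E); ring.
Qed.

(** In spherical coordinates the inner integral over r is that of an exact derivative, so only r1
    and r2 contribute; the quotients by r1^2 and r2^2 convert angular integrals into surface
    integrals. *)
Lemma radial_divergence :
  \int[volume]_(x in shell r1 r2) (phi x * (w (enorm x) / enorm x ^+ 2) +
    (\sum_i coord x i * partial i phi x) * (W (enorm x) / enorm x ^+ 3)) =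
  W r2 / r2 ^+ 2 * \int[surface r2]_(x in sphere r2) phi x -
  W r1 / r1 ^+ 2 * \int[surface r1]_(x in sphere r1) phi x.
Proof.
have r2_gt0 := lt_trans r1_gt0 r12.
have -> : \int[volume]_(x in shell r1 r2) (phi x * (w (enorm x) / enorm x ^+ 2) +
    (\sum_i coord x i * partial i phi x) * (W (enorm x) / enorm x ^+ 3)) =
    \int[sfprod lambda lambda]_t (W r2 * (h t * phi (spherical r2 t)) -
      W r1 * (h t * phi (spherical r1 t))).
  congr fine; rewrite polar_integral.
  transitivity (\int[sfprod lambda lambda]_t \int[lambda]_r (J (t, r))%:E)%E.
    exact/esym/(integral12_prod_meas1 integrable_J).
  by apply: eq_integral => t _; rewrite inner; congr (_%:E); ring.
have i1 := integrable_h_phi (ltW r1_gt0); have i2 := integrable_h_phi (ltW r2_gt0).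
rewrite RintegralB//; last 2 first.
- exact: (integrableZl measurableT (W r2) i2).
- exact: (integrableZl measurableT (W r1) i1).
rewrite !RintegralZl// !surface_integral//.
by congr (_ - _); field; exact: lt0r_neq0.
Qed.

End radial_divergence.

(** * Passage to H^1 *)

Section L2.
Context {R : realType}.
Variables (mu : {measure set (space3 R) -> \bar R}) (D : set (space3 R)).
Hypothesis mD : measurable D.
Implicit Types (u v c : space3 R -> R).

(** [fine] sends an infinite norm to 0, so this value is meaningful on [L2] functions, as [L2normE]
    records. *)
Definition L2norm u : R := fine ('N[mu]_2%:E[EFin \o (u \_ D)])%E.

Lemma L2norm_ge0 u : 0 <= L2norm u.
Proof. by apply: fine_ge0; exact: Lnorm_ge0. Qed.

Lemma L2P u : L2 mu D u <->
  measurable_fun D u /\ ('N[mu]_2%:E[EFin \o (u \_ D)] < +oo)%E.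
Proof.
rewrite /L2 inE; split => [/andP[]|[mu_ fu]].
  by rewrite !inE/= => /(measurable_restrictT _ mD).
apply/andP; rewrite !inE/=; split => //.
exact/(measurable_restrictT _ mD).
Qed.

Lemma L2normE u : L2 mu D u -> ('N[mu]_2%:E[EFin \o (u \_ D)])%E = (L2norm u)%:E.
Proof. by move=> /L2P[_ fu]; rewrite fineK// ge0_fin_numE// Lnorm_ge0. Qed.

Lemma L2_dominated u v : measurable_fun D u -> L2 mu D v ->
  (forall x, D x -> `|u x| <= `|v x|) -> L2 mu D u /\ L2norm u <= L2norm v.
Proof.
move=> mu_ Lv uv; have [mv fv] := (L2P v).1 Lv.
have H : ('N[mu]_2%:E[EFin \o (u \_ D)] <= 'N[mu]_2%:E[EFin \o (v \_ D)])%E.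
  rewrite unlock /=; apply: gt0_ler_poweR; rewrite ?invr_ge0//.
  - by rewrite in_itv/= leey integral_ge0.
  - by rewrite in_itv/= leey integral_ge0.
  have mp (f : space3 R -> R) : measurable_fun D f ->
      measurable_fun setT (fun x => (`|(EFin \o (f \_ D)) x| `^ 2)%E).
    move=> mf; apply: (measurableT_comp (measurable_poweR _ )).
    apply: measurableT_comp => //; apply/measurable_EFinP.
    exact/(measurable_restrictT _ mD).
  apply: ge0_le_integral => //; [exact: mp|exact: mp|].
  move=> x _ /=; rewrite lee_fin ge0_ler_powR ?nnegrE//.
  by rewrite !patchE; case: ifPn => //; rewrite inE => /uv.
have Lu : L2 mu D u by apply/L2P; split => //; exact: le_lt_trans H fv.
by split => //; rewrite -lee_fin -!L2normE.
Qed.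

Lemma L2B u v : L2 mu D u -> L2 mu D v -> L2 mu D (u \- v).
Proof.
rewrite /L2 => Lu Lv; rewrite (_ : _ \_ D = u \_ D - v \_ D).
  by rewrite rpredB ?lee1n.
by apply/funext => x; rewrite patchE !fctE !patchE; case: ifP; rewrite ?subr0.
Qed.

Lemma L2_cst (M : R) : (mu D < +oo)%E -> L2 mu D (cst M).
Proof.
move=> muD; apply/L2P; split => //.
rewrite unlock /=; apply: poweR_lty.
rewrite (_ : (fun x => _) = (cst (`|M%:E| `^ 2)%E) \_ D).
  by rewrite -integral_mkcond integral_cst// lte_mul_pinfty// ?poweR_ge0.
apply/funext => x; rewrite !patchE /=; case: ifP => //= _.
by rewrite normr0 powR0.
Qed.

Lemma L2_bounded u M : (mu D < +oo)%E -> measurable_fun D u ->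
  (forall x, D x -> `|u x| <= M) -> L2 mu D u.
Proof.
move=> muD mu_ uM; have [|//] := L2_dominated mu_ (L2_cst M muD).
by move=> x /uM h; rewrite (le_trans h)// ler_norm.
Qed.

(** Domination by M u, whose norm is known exactly by homogeneity. The factor [c] will be a
    component of a radial field or its divergence. *)
Lemma L2_mul_bounded c u M : measurable_fun D c -> (forall x, D x -> `|c x| <= M) ->
  L2 mu D u -> L2 mu D (c \* u) /\ L2norm (c \* u) <= `|M| * L2norm u.
Proof.
move=> mc cM Lu; have [mu_ _] := (L2P u).1 Lu.
have Lu' := Lu; rewrite /L2 in Lu'.
have E : (fun x => M * u x) \_ D = M *: (u \_ D).
  by apply/funext => x; rewrite patchE fctE patchE; case: ifP => // _; rewrite scaler0.
pose uL : LfunType mu (lee1n 2) := Lfun_Sub (lee1n 2) Lu'.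
have NE : ('N[mu]_2%:E[EFin \o ((fun x => M * u x)%R \_ D)] = `|M|%:E * (L2norm u)%:E)%E.
  rewrite -L2normE// E -[u \_ D]/(uL : _ -> _).
  exact: (LnormZ uL M).
have LMu : L2 mu D (fun x => M * u x).
  apply/L2P; split; first exact: measurable_funM.
  by rewrite NE -EFinM ltry.
have [|L1 le] := @L2_dominated (c \* u) _ (measurable_funM mc mu_) LMu.
  by move=> x Dx /=; rewrite !normrM ler_wpM2r// (le_trans (cM _ Dx))// ler_norm.
split => //; rewrite (le_trans le)// /L2norm NE.
by rewrite -EFinM.
Qed.

(** Hoelder's inequality with both exponents equal to 2, applied to the restrictions to [D]. *)
Lemma L2_mul_integrable u v : L2 mu D u -> L2 mu D v ->
  mu.-integrable D (fun x => (u x * v x)%:E) /\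
  `|\int[mu]_(x in D) (u x * v x)| <= L2norm u * L2norm v.
Proof.
move=> Lu Lv.
have /Lfun1_integrable L1 : (u \_ D \* v \_ D)%R \in Lfun mu 1 by exact: Lfun2_mul_Lfun1.
have E : EFin \o (u \_ D \* v \_ D)%R = (fun x => (u x * v x)%:E) \_ D.
  by apply/funext => x; rewrite patchE /= !patchE; case: ifP => // _; rewrite mulr0.
have I : mu.-integrable D (fun x => (u x * v x)%:E).
  by apply/(integrable_mkcond _ mD); rewrite -E.
split => //.
rewrite -lee_fin EFinM -!L2normE//.
apply: (@le_trans _ _ ('N[mu]_1[EFin \o (u \_ D \* v \_ D)%R])%E); last first.
  apply: hoelder => //.
  - by apply/(measurable_restrictT _ mD); have [] := (L2P u).1 Lu.
  - by apply/(measurable_restrictT _ mD); have [] := (L2P v).1 Lv.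
  - by rewrite [RHS]splitr !div1r.
rewrite Lnorm1 E EFin_normr_Rintegral//.
apply: le_trans (le_abse_integral _ mD _) _; first by have /integrableP[] := I.
rewrite [leLHS]integral_mkcond le_eqVlt; apply/orP; left; apply/eqP.
by apply: eq_integral => x _; rewrite !patchE; case: ifP => // _; rewrite abse0.
Qed.

End L2.

Section bilinear_limit.
Context {R : realType}.
Variables (mu : {measure set (space3 R) -> \bar R}) (D : set (space3 R)).
Hypothesis mD : measurable D.
Implicit Types (u v c : space3 R -> R).

Lemma L2_cvg_norm (u_ : nat -> space3 R -> R) u :
  (forall k, L2 mu D (u_ k)) -> L2 mu D u -> L2_cvg mu D u_ u ->
  L2norm mu D (u_ k \- u) @[k --> \oo] --> 0.
Proof.
move=> Lk Lu; rewrite /L2_cvg => /fine_cvgP[_]; exact.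
Qed.

(** Write u_k v_k - u v as (u_k - u)(v_k - v) + u (v_k - v) + (u_k - u) v and apply Cauchy-Schwarz
    to each term. Taking one factor equal to 1 gives the linear limits as well. *)
Lemma bilinear_limit c M (u_ v_ : nat -> space3 R -> R) u v :
  measurable_fun D c -> (forall x, D x -> `|c x| <= M) ->
  (forall k, L2 mu D (u_ k)) -> L2 mu D u -> L2_cvg mu D u_ u ->
  (forall k, L2 mu D (v_ k)) -> L2 mu D v -> L2_cvg mu D v_ v ->
  \int[mu]_(x in D) (c x * (u_ k x * v_ k x)) @[k --> \oo] -->
  \int[mu]_(x in D) (c x * (u x * v x)).
Proof.
move=> mc cM Lku Lu cu Lkv Lv cv.
have Cu := L2_cvg_norm Lku Lu cu; have Cv := L2_cvg_norm Lkv Lv cv.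
pose N := L2norm mu D.
have B f g : L2 mu D f -> L2 mu D g ->
    mu.-integrable D (fun x => (c x * (f x * g x))%:E) /\
    `|\int[mu]_(x in D) (c x * (f x * g x))| <= `|M| * (N f * N g).
  move=> Lf Lg; have [Lcf Ncf] := L2_mul_bounded mD mc cM Lf.
  have [I H] := L2_mul_integrable mD Lcf Lg; split.
    by apply: eq_integrable I => // x _ /=; rewrite mulrA.
  rewrite (@eq_Rintegral _ _ _ mu D (fun x => (c \* f) x * g x)); last first.
    by move=> x _ /=; rewrite mulrA.
  by rewrite (le_trans H)// mulrA ler_wpM2r// L2norm_ge0.
apply/subr_cvg0; apply: norm_cvg0 => /=.
pose bound k : R := `|M| * (N (u_ k \- u) * N (v_ k \- v)) +
  `|M| * (N u * N (v_ k \- v)) + `|M| * (N (u_ k \- u) * N v).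
apply: (@squeeze_cvgr _ _ _ _ (cst 0) bound); first last.
- have -> : 0 = `|M| * (0 * 0) + `|M| * (N u * 0) + `|M| * (0 * N v).
    by rewrite !(mulr0, mul0r, addr0).
  apply: cvgD; [apply: cvgD|]; apply: cvgM; try exact: cvg_cst;
  apply: cvgM; try exact: cvg_cst; by [exact: Cu|exact: Cv].
- exact: cvg_cst.
apply: nearW => k; rewrite normr_ge0 /=.
have Lduk := L2B (Lku k) Lu; have Ldvk := L2B (Lkv k) Lv.
have [I1 H1] := B _ _ Lduk Ldvk; have [I2 H2] := B _ _ Lu Ldvk.
have [I3 H3] := B _ _ Lduk Lv; have [Ik _] := B _ _ (Lku k) (Lkv k).
have [I0 _] := B _ _ Lu Lv.
rewrite -RintegralB//.
rewrite (@eq_Rintegral _ _ _ mu D (fun x => c x * ((u_ k \- u) x * (v_ k \- v) x) +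
   c x * (u x * (v_ k \- v) x) + c x * ((u_ k \- u) x * v x))); last first.
  by move=> x _ /=; ring.
rewrite RintegralD//; last exact: (integrableD mD I1 I2).
rewrite RintegralD//.
rewrite /bound (le_trans (ler_normD _ _))// lerD//.
by rewrite (le_trans (ler_normD _ _))// lerD//.
Qed.

End bilinear_limit.

(** * Finite measure of shell and spheres; bounds for radial fields *)

Section continuous_L2.
Context {R : realType}.
Local Notation T := (measurableTypeR R).
Local Notation lambda := (@lebesgue_measure R).

Lemma volume_shell_lty (r1 r2 : R) : (@volume R (shell r1 r2) < +oo)%E.
Proof.
pose K : set (space3 R) := (`[- r2, r2] `*` `[- r2, r2]) `*` `[- r2, r2].
pose I : set T := `[- r2, r2]%classic.
have mi : measurable I by exact: measurable_itv.
have mK : measurable K by apply: measurableX => //; exact: measurableX.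
have KE : (@volume R K < +oo)%E.
  have E : volume K = (lambda I * lambda I * lambda I)%E.
    rewrite /volume /= product_measure1E//; last exact: measurableX.
    by rewrite [X in (X * _)%E](product_measure1E lambda lambda mi mi).
  rewrite E /I /= lebesgue_measure_itv/=.
  by case: ifPn => _; rewrite -?EFinB -?EFinM ?mule0 ltry.
apply: le_lt_trans KE; apply: le_measure; rewrite ?inE//; first exact: measurable_shell.
move=> x /andP[_ xr2].
have H i : - r2 <= coord x i <= r2.
  by rewrite -ler_norml (le_trans (coord_le_enorm x i))// ltW.
by split; [split|]; rewrite /= in_itv/=; [exact: (H 0)|exact: (H 1)|exact: (H 2)].
Qed.

Lemma surface_lty (rho : R) A : measurable A -> (surface rho A < +oo)%E.
Proof.
move=> mA.
have -> : surface rho A = (\int[surface rho]_x ((\1_A x)%:E * (cst 1 x)%:E))%E.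
  under eq_integral do rewrite mule1.
  by rewrite integral_indic// setIT.
rewrite (@surface_transfer R rho)//; last exact/measurable_EFinP/measurable_indic.
have ma := @measurable_angles R.
apply: (@le_lt_trans _ _ (\int[sfprod lambda lambda]_t (rho ^+ 2 * \1_(@angles R) t)%:E)%E).
  apply: ge0_le_integral => //.
  - move=> t _; rewrite mule_ge0 ?lee_fin//.
    rewrite mulrCA mulr_ge0 ?sqr_ge0// angle_indicE mulrAC mulr_ge0 ?full_indic_ge0//.
    by rewrite arc_indicE; case: (boolP (0 < _ < _)) => [/sin_gt0_pi/ltW|]; rewrite ?mul1r ?mul0r.
  - apply: emeasurable_funM; apply/measurable_EFinP.
      apply: (measurableT_comp (measurable_indic mA)); exact: measurable_spherical.
    by apply: measurable_funM; [exact: measurable_indic|meas].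
  - by apply/measurable_EFinP; apply: measurable_funM => //; exact: measurable_indic.
  move=> t _; rewrite -EFinM lee_fin.
  have : 0 <= \1_(@angles R) t * sin t.1 <= \1_(@angles R) t.
    apply/andP; split.
      rewrite angle_indicE mulrAC mulr_ge0 ?full_indic_ge0//.
      by rewrite arc_indicE; case: (boolP (0 < _ < _)) => [/sin_gt0_pi/ltW|]; rewrite ?mul1r ?mul0r.
    by rewrite -[leRHS]mulr1 ler_wpM2l// sin_le1.
  move=> /andP[h0 h1].
  rewrite (_ : \1_angles t * (rho ^+ 2 * sin t.1) = rho ^+ 2 * (\1_angles t * sin t.1)); last by ring.
  rewrite -[leRHS]mul1r; apply: ler_pM => //.
  - by rewrite mulr_ge0 ?sqr_ge0 ?h0.
  - by rewrite ler_wpM2l ?sqr_ge0.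
under eq_integral do rewrite EFinM.
rewrite ge0_integralZl ?lee_fin ?sqr_ge0//; last exact/measurable_EFinP/measurable_indic.
rewrite integral_indic// setIT lte_mul_pinfty ?lee_fin ?sqr_ge0//.
rewrite [X in (X < _)%E]product_measure1E/=; [|exact: measurable_itv|exact: measurable_itv].
by rewrite !lebesgue_measure_itv/=; do 2 case: ifPn => _; rewrite -?EFinB ?mule0 ?mul0e -?EFinM ltry.
Qed.

Lemma continuous_L2_shell (r1 r2 : R) f : continuous f -> L2 volume (shell r1 r2) f.
Proof.
move=> cf; have [M M0 HM] := continuous_bounded_ball r2 cf.
apply: (@L2_bounded _ _ _ (measurable_shell r1 r2) _ M); first exact: volume_shell_lty.
  apply: measurable_funTS; exact: continuous_measurable_space3 cf.
by move=> x /andP[_ /ltW]; exact: HM.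
Qed.

Lemma continuous_L2_sphere (rho : R) f : continuous f -> L2 (surface rho) (sphere rho) f.
Proof.
move=> cf; have [M M0 HM] := continuous_bounded_ball rho cf.
apply: (@L2_bounded _ _ _ (measurable_sphere rho) _ M).
- by apply: surface_lty; exact: measurable_sphere.
- apply: measurable_funTS; exact: continuous_measurable_space3 cf.
- by move=> x xr; apply: HM; rewrite xr.
Qed.

Lemma L2_cvg_cst mu D (u : space3 R -> R) : L2_cvg mu D (fun=> u) u.
Proof.
rewrite /L2_cvg (_ : (fun k => _) = fun=> 0%E); first exact: cvg_cst.
apply/funext => k; rewrite (_ : EFin \o _ = cst 0%E) ?Lnorm0//.
by apply/funext => x; rewrite /= patchE /= subrr; case: ifP.
Qed.

Section radial_fields.
Variables (r1 r2 : R) (W w : R -> R).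
Hypotheses (r1_gt0 : 0 < r1) (r12 : r1 < r2).
Hypotheses (dW : forall r, is_derive r (1 : R) W (w r)) (cw : continuous w).

(* The field [x W(|x|) / |x|^3] has divergence [W'(|x|) / |x|^2]. *)
Definition divX (w : R -> R) (x : space3 R) : R := w (enorm x) / enorm x ^+ 2.
Definition fieldX (W : R -> R) (i : 'I_3) (x : space3 R) : R :=
  coord x i * (W (enorm x) / enorm x ^+ 3).

Let cW : continuous W.
Proof.
by move=> r; apply/differentiable_continuous/derivable1_diffP; have [] := dW r.
Qed.

Let mk (k : R -> R) : continuous k ->
  measurable_fun setT (fun x : space3 R => k (enorm x)).
Proof.
move=> ck; apply: (measurableT_comp _ measurable_enorm).
exact: continuous_measurable_fun.
Qed.

Let mV n : measurable_fun setT (fun x : space3 R => (enorm x ^+ n)^-1 : R).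
Proof.
apply: (measurableT_comp measurable_inv); apply: measurable_funX.
exact: measurable_enorm.
Qed.

Lemma measurable_divX : measurable_fun setT (divX w).
Proof. by apply: measurable_funM; [exact: mk|exact: mV]. Qed.

Lemma measurable_fieldX i : measurable_fun setT (fieldX W i).
Proof.
apply: measurable_funM; first exact: measurable_coord.
by apply: measurable_funM; [exact: mk|exact: mV].
Qed.

Let radial_bound (k : R -> R) : continuous k -> exists M, forall x : space3 R,
  shell r1 r2 x -> `|k (enorm x) / enorm x ^+ 2| <= M.
Proof.
move=> ck.
have cke : continuous (fun x : space3 R => k (enorm x)).
  by move=> x; apply: (@continuous_comp _ _ _ (@enorm R) k); [exact: continuous_enorm|exact: ck].
have [M M0 HM] := continuous_bounded_ball r2 cke.
exists (M / r1 ^+ 2) => x /andP[x1 x2]; rewrite normrM ler_pM//.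
  by apply: HM; exact: ltW.
rewrite normfV lef_pV2 ?posrE ?normr_gt0 ?expf_neq0 ?gt_eqF//; last 2 first.
- by rewrite (lt_trans r1_gt0).
- by rewrite exprn_gt0.
by rewrite normrX ler_pXn2r ?nnegrE// ?ger0_norm ?enorm_ge0// ltW.
Qed.

Lemma divX_bound : exists M, forall x, shell r1 r2 x -> `|divX w x| <= M.
Proof. exact: radial_bound cw. Qed.

(** The quotient [coord x i / enorm x] has modulus at most 1; what remains is bounded because |x| >
    r1. *)
Lemma fieldX_bound i : exists M, forall x, shell r1 r2 x -> `|fieldX W i x| <= M.
Proof.
have [M HM] := radial_bound cW; exists M => x xO; have /andP[x1 x2] := xO.
have x0 := lt_trans r1_gt0 x1.
apply: le_trans (HM x xO); rewrite (_ : fieldX W i x =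
  (coord x i / enorm x) * (W (enorm x) / enorm x ^+ 2)); last first.
  by rewrite /fieldX; field; exact: lt0r_neq0.
rewrite normrM -[leRHS]mul1r ler_wpM2r// normrM normfV (ger0_norm (enorm_ge0 x)).
by rewrite ler_pdivrMr// mul1r coord_le_enorm.
Qed.

End radial_fields.

End continuous_L2.

Section class1.
Context {R : realType}.
Implicit Types (f g : space3 R -> R).

Lemma class1M f g : of_class 1 f -> of_class 1 g ->
  of_class 1 (fun x => f x * g x) /\
  forall i x, partial i (fun x => f x * g x) x = f x * partial i g x + g x * partial i f x.
Proof.
move=> [cf df] [cg dg].
have E i x : is_derive x (axis i) (fun x => f x * g x)
    (f x * partial i g x + g x * partial i f x).
  have D1 := derivableP ((df i).1 x); have D2 := derivableP ((dg i).1 x).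
  exact: (is_deriveM D1 D2).
have P i x : partial i (fun x => f x * g x) x = f x * partial i g x + g x * partial i f x.
  by have [_] := E i x.
split => //; split; first by move=> x; apply: cvgM; [exact: cf|exact: cg].
move=> i; split; first by move=> x; have [] := E i x.
split => //.
rewrite (_ : partial i _ = fun x => f x * partial i g x + g x * partial i f x).
  have [_ [cdf _]] := df i; have [_ [cdg _]] := dg i.
  by move=> x; apply: cvgD; apply: cvgM; [exact: cf|exact: cdg|exact: cg|exact: cdf].
by apply/funext => x; rewrite P.
Qed.

Lemma class1B f g : of_class 1 f -> of_class 1 g ->
  of_class 1 (fun x => f x - g x) /\
  forall i x, partial i (fun x => f x - g x) x = partial i f x - partial i g x.
Proof.
move=> [cf df] [cg dg].
have E i x : is_derive x (axis i) (fun x => f x - g x)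
    (partial i f x - partial i g x).
  have D1 := derivableP ((df i).1 x); have D2 := derivableP ((dg i).1 x).
  exact: (is_deriveB D1 D2).
have P i x : partial i (fun x => f x - g x) x = partial i f x - partial i g x.
  by have [_] := E i x.
split => //; split; first by move=> x; apply: cvgB; [exact: cf|exact: cg].
move=> i; split; first by move=> x; have [] := E i x.
split => //.
rewrite (_ : partial i _ = fun x => partial i f x - partial i g x).
  have [_ [cdf _]] := df i; have [_ [cdg _]] := dg i.
  by move=> x; apply: cvgB; [exact: cdf|exact: cdg].
by apply/funext => x; rewrite P.
Qed.

Lemma class1_continuous_partial f i : of_class 1 f -> continuous (partial i f).
Proof. by move=> [_ /(_ i)[_ []]]. Qed.

End class1.

(** * Divergence and energy identities in H^1 *)

Section sobolev_limits.
Context {R : realType}.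
Variables (r1 r2 : R) (W w : R -> R).
Hypotheses (r1_gt0 : 0 < r1) (r12 : r1 < r2).
Hypotheses (dW : forall r, is_derive r (1 : R) W (w r)) (cw : continuous w).
Local Notation Omega := (shell r1 r2).

Let mO := measurable_shell r1 r2.
Let mS r := @measurable_sphere R r.

Let L2div : L2 volume Omega (divX w).
Proof.
have [M HM] := divX_bound r2 r1_gt0 cw.
apply: (@L2_bounded _ _ _ mO _ M) => //; first exact: volume_shell_lty.
apply: measurable_funTS; exact: measurable_divX.
Qed.

Let L2field i : L2 volume Omega (fieldX W i).
Proof.
have [M HM] := fieldX_bound r2 r1_gt0 dW i.
apply: (@L2_bounded _ _ _ mO _ M) => //; first exact: volume_shell_lty.
apply: measurable_funTS; exact: measurable_fieldX dW i.
Qed.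

(** [radial_divergence] with its integral split into separately integrable terms, a form in which
    each term has its own L^2 limit. *)
Lemma class1_divergence phi : of_class 1 phi ->
  \int[volume]_(x in Omega) (divX w x * phi x) +
  \sum_i \int[volume]_(x in Omega) (fieldX W i x * partial i phi x) =
  W r2 / r2 ^+ 2 * \int[surface r2]_(x in sphere r2) phi x -
  W r1 / r1 ^+ 2 * \int[surface r1]_(x in sphere r1) phi x.
Proof.
move=> phi1; rewrite -(radial_divergence r1_gt0 r12 phi1 dW cw).
have Lp := continuous_L2_shell r1 r2 phi1.1.
have Ld i := continuous_L2_shell r1 r2 (@class1_continuous_partial _ _ i phi1).
have [I0 _] := L2_mul_integrable mO L2div Lp.
have I i : volume.-integrable Omega (fun x => (fieldX W i x * partial i phi x)%:E).
  by have [] := L2_mul_integrable mO (L2field i) (Ld i).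
have I01 := integrableD mO (I 0) (I 1).
have I012 := integrableD mO I01 (I 2).
transitivity (\int[volume]_(x in Omega) (divX w x * phi x +
    (fieldX W 0 x * partial 0 phi x + fieldX W 1 x * partial 1 phi x +
     fieldX W 2 x * partial 2 phi x))); last first.
  apply: eq_Rintegral => x _.
  rewrite big_ord3.
  rewrite /divX /fieldX.
  by move: (phi x) (partial _ _ _) => *; ring.
by rewrite big_ord3 (RintegralD mO I0 I012) (RintegralD mO I01 (I 2))
  (RintegralD mO (I 0) (I 1)).
Qed.

Let lim_mul (mu : {measure set (space3 R) -> \bar R}) (D : set (space3 R))
    (mD : measurable D) (c : space3 R -> R) (M : R) (u_ : nat -> space3 R -> R)
    (u : space3 R -> R) :
  (mu D < +oo)%E -> measurable_fun D c -> (forall x, D x -> `|c x| <= M) ->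
  (forall k, L2 mu D (u_ k)) -> L2 mu D u -> L2_cvg mu D u_ u ->
  \int[mu]_(x in D) (c x * u_ k x) @[k --> \oo] --> \int[mu]_(x in D) (c x * u x).
Proof.
move=> muD mc cM Lk Lu cu.
have L1 := L2_cst mD 1 muD.
have := bilinear_limit mD mc cM Lk Lu cu (fun=> L1) L1 (L2_cvg_cst mu D (cst 1)).
have E (f : space3 R -> R) : \int[mu]_(x in D) (c x * (f x * (cst 1 : space3 R -> R) x)) =
   \int[mu]_(x in D) (c x * f x).
  by apply: eq_Rintegral => x _; rewrite /= mulr1.
by rewrite E; under eq_fun do rewrite E.
Qed.

Let lim1 (mu : {measure set (space3 R) -> \bar R}) (D : set (space3 R)) (mD : measurable D) (u_ : nat -> space3 R -> R)
    (u : space3 R -> R) :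
  (mu D < +oo)%E ->
  (forall k, L2 mu D (u_ k)) -> L2 mu D u -> L2_cvg mu D u_ u ->
  \int[mu]_(x in D) u_ k x @[k --> \oo] --> \int[mu]_(x in D) u x.
Proof.
move=> muD Lk Lu cu.
have := @lim_mul mu D mD (cst 1) 1 u_ u muD _ _ Lk Lu cu.
have E (f : space3 R -> R) : \int[mu]_(x in D) ((cst 1 : space3 R -> R) x * f x) =
   \int[mu]_(x in D) f x.
  by apply: eq_Rintegral => x _; rewrite /= mul1r.
rewrite E; under eq_fun do rewrite E.
by apply => // x _; rewrite normr1.
Qed.

(** The sequence in [trace] converges in value, gradient and boundary value at once, and each term
    of the identity is a continuous linear functional of one of these. *)
Lemma sobolev_divergence v H S : sobolev r1 r2 v H S ->
  \int[volume]_(x in Omega) (divX w x * v x) +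
  \sum_i \int[volume]_(x in Omega) (fieldX W i x * H i x) =
  W r2 / r2 ^+ 2 * \int[surface r2]_(x in sphere r2) S x -
  W r1 / r1 ^+ 2 * \int[surface r1]_(x in sphere r1) S x.
Proof.
move=> [Lv [LH _] LS1 LS2 [phi [phi1 cv cH cS1 cS2]]].
have Lp k := continuous_L2_shell r1 r2 (phi1 k).1.
have Ld k i := continuous_L2_shell r1 r2 (@class1_continuous_partial _ _ i (phi1 k)).
have Ls k r := continuous_L2_sphere r (phi1 k).1.
have [M HM] := divX_bound r2 r1_gt0 cw.
have vO := @volume_shell_lty R r1 r2.
have sO r : (surface r (@sphere R r) < +oo)%E by apply: surface_lty; exact: mS.
have C1 : \int[volume]_(x in Omega) (divX w x * phi k x) +
    \sum_i \int[volume]_(x in Omega) (fieldX W i x * partial i (phi k) x) @[k --> \oo] -->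
    \int[volume]_(x in Omega) (divX w x * v x) +
    \sum_i \int[volume]_(x in Omega) (fieldX W i x * H i x).
  have Ci i : \int[volume]_(x in Omega) (fieldX W i x * partial i (phi k) x) @[k --> \oo]
      --> \int[volume]_(x in Omega) (fieldX W i x * H i x).
    have [Mi HMi] := fieldX_bound r2 r1_gt0 dW i.
    apply: (lim_mul mO vO _ HMi (fun k => Ld k i) (LH i) (cH i)).
    apply: measurable_funTS; exact: measurable_fieldX dW i.
  rewrite big_ord3; under eq_fun do rewrite big_ord3.
  apply: cvgD; last by apply: cvgD; [apply: cvgD|]; exact: Ci.
  apply: (lim_mul mO vO _ HM Lp Lv cv).
  apply: measurable_funTS; exact: measurable_divX.
have C2 : W r2 / r2 ^+ 2 * \int[surface r2]_(x in sphere r2) phi k x -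
    W r1 / r1 ^+ 2 * \int[surface r1]_(x in sphere r1) phi k x @[k --> \oo] -->
    W r2 / r2 ^+ 2 * \int[surface r2]_(x in sphere r2) S x -
    W r1 / r1 ^+ 2 * \int[surface r1]_(x in sphere r1) S x.
  apply: cvgB; apply: cvgM; try exact: cvg_cst.
    exact: (lim1 (mS r2) (sO r2) (fun k => Ls k r2) LS2 cS2).
  exact: (lim1 (mS r1) (sO r1) (fun k => Ls k r1) LS1 cS1).
move: C1; under eq_fun do rewrite class1_divergence//.
by move=> C1; exact: (cvg_unique (@Rhausdorff R) C1 C2).
Qed.

(** The square of an H^1 function need not be in H^1, so squares are taken before the limit: the
    identity for phi_k^2, with gradient 2 phi_k grad phi_k, has bilinear terms to which
    [bilinear_limit] applies. *)
Lemma sobolev_energy v H S : sobolev r1 r2 v H S ->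
  \int[volume]_(x in Omega) (divX w x * (v x * v x)) +
  2 * \sum_i \int[volume]_(x in Omega) (fieldX W i x * (v x * H i x)) =
  W r2 / r2 ^+ 2 * \int[surface r2]_(x in sphere r2) (S x * S x) -
  W r1 / r1 ^+ 2 * \int[surface r1]_(x in sphere r1) (S x * S x).
Proof.
move=> [Lv [LH _] LS1 LS2 [phi [phi1 cv cH cS1 cS2]]].
have Lp k := continuous_L2_shell r1 r2 (phi1 k).1.
have Ld k i := continuous_L2_shell r1 r2 (@class1_continuous_partial _ _ i (phi1 k)).
have Ls k r := continuous_L2_sphere r (phi1 k).1.
have [M HM] := divX_bound r2 r1_gt0 cw.
have C1 : \int[volume]_(x in Omega) (divX w x * (phi k x * phi k x)) +
    2 * \sum_i \int[volume]_(x in Omega) (fieldX W i x * (phi k x * partial i (phi k) x))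
     @[k --> \oo] -->
    \int[volume]_(x in Omega) (divX w x * (v x * v x)) +
    2 * \sum_i \int[volume]_(x in Omega) (fieldX W i x * (v x * H i x)).
  have Ci i : \int[volume]_(x in Omega) (fieldX W i x * (phi k x * partial i (phi k) x))
      @[k --> \oo] --> \int[volume]_(x in Omega) (fieldX W i x * (v x * H i x)).
    have [Mi HMi] := fieldX_bound r2 r1_gt0 dW i.
    apply: (bilinear_limit mO _ HMi Lp Lv cv (fun k => Ld k i) (LH i) (cH i)).
    apply: measurable_funTS; exact: measurable_fieldX dW i.
  rewrite big_ord3; under eq_fun do rewrite big_ord3.
  apply: cvgD; last first.
    by apply: cvgM; [exact: cvg_cst|apply: cvgD; [apply: cvgD|]; exact: Ci].
  apply: (bilinear_limit mO _ HM Lp Lv cv Lp Lv cv).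
  apply: measurable_funTS; exact: measurable_divX.
have sq r T : (forall k, L2 (surface r) (sphere r) (phi k)) -> L2 (surface r) (sphere r) T ->
    L2_cvg (surface r) (sphere r) phi T ->
    \int[surface r]_(x in sphere r) (phi k x * phi k x) @[k --> \oo] -->
    \int[surface r]_(x in sphere r) (T x * T x).
  move=> Lk LT cT.
  have := @bilinear_limit _ (surface r) _ (mS r) (cst 1) 1 phi phi T T _ _ Lk LT cT Lk LT cT.
  have E (f : space3 R -> R) : \int[surface r]_(x in sphere r)
     ((cst 1 : space3 R -> R) x * f x) = \int[surface r]_(x in sphere r) f x.
    by apply: eq_Rintegral => x _; rewrite /= mul1r.
  rewrite E; under eq_fun do rewrite E.
  by apply => // x _; rewrite normr1.
have C2 : W r2 / r2 ^+ 2 * \int[surface r2]_(x in sphere r2) (phi k x * phi k x) -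
    W r1 / r1 ^+ 2 * \int[surface r1]_(x in sphere r1) (phi k x * phi k x) @[k --> \oo] -->
    W r2 / r2 ^+ 2 * \int[surface r2]_(x in sphere r2) (S x * S x) -
    W r1 / r1 ^+ 2 * \int[surface r1]_(x in sphere r1) (S x * S x).
  by apply: cvgB; apply: cvgM; [exact: cvg_cst|exact: sq|exact: cvg_cst|exact: sq].
have E k : \int[volume]_(x in Omega) (divX w x * (phi k x * phi k x)) +
    2 * \sum_i \int[volume]_(x in Omega) (fieldX W i x * (phi k x * partial i (phi k) x)) =
    W r2 / r2 ^+ 2 * \int[surface r2]_(x in sphere r2) (phi k x * phi k x) -
    W r1 / r1 ^+ 2 * \int[surface r1]_(x in sphere r1) (phi k x * phi k x).
  have [sq1 dsq] := class1M (phi1 k) (phi1 k).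
  rewrite -(class1_divergence sq1); congr (_ + _).
  rewrite mulr_sumr; apply: eq_bigr => i _.
  have [Mi HMi] := fieldX_bound r2 r1_gt0 dW i.
  have mXi : measurable_fun Omega (fieldX W i).
    apply: measurable_funTS; exact: measurable_fieldX dW i.
  have [LX _] := L2_mul_bounded mO mXi HMi (Lp k).
  have [I _] := L2_mul_integrable mO LX (Ld k i).
  rewrite -RintegralZl//; last by apply: eq_integrable I => // x _ /=; rewrite mulrA.
  by apply: eq_Rintegral => x _; rewrite dsq; ring.
move: C1; under eq_fun do rewrite E.
by move=> C1; exact: (cvg_unique (@Rhausdorff R) C1 C2).
Qed.

End sobolev_limits.

(** * Radial functions in the Sobolev space *)

Lemma integrable_bounded_support d (X : measurableType d) (R : realType)
    (m : {measure set X -> \bar R}) (A : set X) (f : X -> R) (C : R) :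
  measurable A -> (m A < +oo)%E -> measurable_fun setT f ->
  (forall x, A x -> `|f x| <= C) -> (forall x, ~ A x -> f x = 0) ->
  m.-integrable setT (EFin \o f).
Proof.
move=> mA mAoo mf fC f0.
have -> : EFin \o f = (EFin \o f) \_ A.
  apply/funext => x; rewrite patchE; case: ifPn => //.
  by rewrite notin_setE => /f0 /= ->.
apply/(integrable_mkcond _ mA); apply: measurable_bounded_integrable => //.
  exact: measurable_funTS.
exists C; split; first exact: num_real.
by move=> N CN x /fC h /=; exact: le_trans h (ltW CN).
Qed.

(** * Integration by parts against test functions *)

Section axis_integral.
Context {R : realType}.
Local Notation T := (measurableTypeR R).
Local Notation lambda := (@lebesgue_measure R).
Variables (psi : space3 R -> R) (i : 'I_3) (M : R).
Hypotheses (dpsi : forall x : space3 R, derivable psi x (axis i)).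
Hypotheses (cpsi : continuous (partial i psi)).
Hypotheses (psi0 : forall x j, M < `|coord x j| -> psi x = 0).
Hypotheses (dpsi0 : forall x j, M < `|coord x j| -> partial i psi x = 0).

Let f := partial i psi.

Let coord_line (p : space3 R) (s : R) : coord (s *: axis i + p) i = s + coord p i.
Proof.
by case: (ord3P i) => ->; rewrite /coord/= /GRing.scale/= mulr1.
Qed.

Let line_integral (p : space3 R) : (\int[lambda]_s (f (s *: axis i + p))%:E = 0)%E.
Proof.
(* For |s| >= N the i-th coordinate s + p_i exceeds [M] in modulus, so [psi] and its derivative
   vanish there: the integral reduces to [-N, N], with both end values 0. *)
pose N := `|M| + `|coord p i| + 1.
have N0 : 0 < N by rewrite ltr_wpDl// addr_ge0.
have out (s : R) : N <= `|s| -> M < `|coord (s *: axis i + p) i|.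
  move=> Ns; rewrite coord_line; apply: (@lt_le_trans _ _ (`|s| - `|coord p i|)).
    rewrite ltrBrDr (lt_le_trans _ Ns)// /N -addrA ler_ltD ?ler_norm//.
    by rewrite ltrDl.
  by rewrite lerBlDr -[leLHS]/`|s| -{1}(addrK (coord p i) s) (le_trans (ler_normB _ _)).
pose g (s : R) : R := psi (s *: axis i + p).
have dg (s : R) : is_derive s (1 : R) g (f (s *: axis i + p)).
  have D : is_derive (s *: axis i + p) (axis i) psi (f (s *: axis i + p)).
    exact: (derivableP (@dpsi (s *: axis i + p))).
  exact: ((@is_derive_line R _ _ psi p (axis i) s _).1 D).
have cg : continuous g.
  by move=> s; apply/differentiable_continuous/derivable1_diffP; have [] := dg s.
have cline : continuous (fun s : R => s *: axis i + p : space3 R).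
  move=> s; apply: cvgD; last exact: cvg_cst.
  exact: (@scalel_continuous R (space3 R) (axis i)).
have cf : continuous (fun s : R => f (s *: axis i + p)).
  move=> s; apply: (@continuous_comp _ _ _ (fun s : R => s *: axis i + p : space3 R) f).
    exact: cline.
  exact: cpsi.
transitivity (\int[lambda]_(s in `[(- N)%R, N]%classic) (f (s *: axis i + p))%:E)%E.
  rewrite [RHS]integral_mkcond; apply: eq_integral => s _; rewrite patchE.
  case: ifPn => //; rewrite notin_setE /= in_itv/= -ler_norml => /negP sN.
  rewrite /f (dpsi0 (j := i))//; apply: out; apply: ltW.
  by rewrite ltNge.
rewrite (@continuous_FTC2 _ _ g).
- rewrite /g (psi0 (j := i)) ?(psi0 (j := i))// ?subee//; apply: out.
    by rewrite normrN ger0_norm// ltW.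
  by rewrite ger0_norm// ltW.
- by rewrite -subr_gt0 opprK addr_gt0.
- exact: continuous_subspaceT.
- split.
  + by move=> s _; have [] := dg s.
  + exact: cvg_at_right_filter (cg _).
  + exact: cvg_at_left_filter (cg _).
- by move=> s _; rewrite derive1E; have [_] := dg s.
Qed.

Let mf : measurable_fun setT f.
Proof. exact: continuous_measurable_space3 cpsi. Qed.

Let I : set T := `[- M, M]%classic.
Let mI : measurable I. Proof. exact: measurable_itv. Qed.
Let I_fin : (lambda I < +oo)%E.
Proof. by rewrite /I /= lebesgue_measure_itv/=; case: ifPn => _; rewrite -?EFinB ltry. Qed.

Let notI x : ~ I x -> M < `|x : R|.
Proof.
by rewrite /I /= in_itv/= -ler_norml => /negP; rewrite -ltNge.
Qed.

Let f_bound : exists2 C, 0 <= C & forall x, `|f x| <= C.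
Proof.
have [C C0 HC] := continuous_bounded_box M cpsi; exists C => // x.
have [x1|x1] := leP `|x.1.1| M; last by rewrite /f (dpsi0 (j := 0))// normr0.
have [x2|x2] := leP `|x.1.2| M; last by rewrite /f (dpsi0 (j := 1))// normr0.
have [x3|x3] := leP `|x.2| M; last by rewrite /f (dpsi0 (j := 2))// normr0.
exact: HC.
Qed.

(** The integral along every line parallel to axis i is 0; each axis needs its own order in Fubini
    to be integrated innermost. *)
Lemma axis_integral : (\int[volume]_x (partial i psi x)%:E = 0)%E.
Proof.
have [C C0 HC] := f_bound.
have mII : measurable (I `*` I) by exact: measurableX.
have II_fin : (sfprod lambda lambda (I `*` I) < +oo)%E.
  rewrite [X in (X < _)%E](product_measure1E lambda lambda mI mI).
  by rewrite lte_mul_pinfty// ge0_fin_numE.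
have i3 : (sfprod (sfprod lambda lambda) lambda).-integrable setT (EFin \o f).
  apply: (@integrable_bounded_support _ _ _ _ ((I `*` I) `*` I) _ C) => //.
  - exact: measurableX.
  - rewrite [X in (X < _)%E](product_measure1E (sfprod lambda lambda) lambda mII mI).
    by rewrite lte_mul_pinfty// ge0_fin_numE.
  - move=> [[x y] z] /= /not_andP[/not_andP[]|] /notI h.
    + exact: (@dpsi0 _ 0).
    + exact: (@dpsi0 _ 1).
    + exact: (@dpsi0 _ 2).
have i2 z : (sfprod lambda lambda).-integrable setT (fun xy => (f (xy, z))%:E).
  apply: (@integrable_bounded_support _ _ _ _ (I `*` I) (fun xy => f (xy, z)) C) => //.
  - exact: (measurableT_comp mf (pair2_measurable z)).
  - move=> [x y] /= /not_andP[] /notI h.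
    + exact: (@dpsi0 _ 0).
    + exact: (@dpsi0 _ 1).
have L x y z s : s *: axis i + ((x, y), z) =
    ((s * (i == 0 :> nat)%:R + x, s * (i == 1 :> nat)%:R + y),
      s * (i == 2 :> nat)%:R + z) :> space3 R by [].
have [i0|i0|i0] := ord3P i.
- transitivity (\int[lambda]_z \int[sfprod lambda lambda]_xy (f (xy, z))%:E)%E.
    exact/esym/(integral21_prod_meas1 i3).
  apply: integral0_eq => z _.
  transitivity (\int[lambda]_y \int[lambda]_x (f ((x, y), z))%:E)%E.
    exact/esym/(integral21_prod_meas1 (i2 z)).
  apply: integral0_eq => y _; rewrite -[RHS](line_integral ((0, y), z)).
  by apply: eq_integral => x _; rewrite L i0 /= !mulr0 mulr1 !add0r addr0.
- transitivity (\int[lambda]_z \int[sfprod lambda lambda]_xy (f (xy, z))%:E)%E.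
    exact/esym/(integral21_prod_meas1 i3).
  apply: integral0_eq => z _.
  transitivity (\int[lambda]_x \int[lambda]_y (f ((x, y), z))%:E)%E.
    exact/esym/(integral12_prod_meas1 (i2 z)).
  apply: integral0_eq => x _; rewrite -[RHS](line_integral ((x, 0), z)).
  by apply: eq_integral => y _; rewrite L i0 /= !mulr0 mulr1 !add0r addr0.
- transitivity (\int[sfprod lambda lambda]_xy \int[lambda]_z (f (xy, z))%:E)%E.
    exact/esym/(integral12_prod_meas1 i3).
  apply: integral0_eq => -[x y] _; rewrite -[RHS](line_integral ((x, y), 0)).
  by apply: eq_integral => z _; rewrite L i0 /= !mulr0 mulr1 !add0r addr0.
Qed.

End axis_integral.

Section class1_sobolev.
Context {R : realType}.
Variables (r1 r2 : R).
Local Notation Omega := (shell r1 r2).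

(** The complement of the closed support is open, so the function vanishes near the point and its
    partial derivatives vanish with it. *)
Lemma test_function_out (phi : space3 R -> R) : test_function Omega phi ->
  forall x, ~ Omega x -> phi x = 0 /\ forall i, partial i phi x = 0.
Proof.
move=> [_ _ sub] x xO.
have xc : ~ closure [set x | phi x != 0] x by move=> /sub.
split.
  apply/eqP/negPn/negP => px; apply: xc; exact: subset_closure.
move=> i.
have N0 : \forall y \near x, phi y = 0.
  have : open (~` closure [set x | phi x != 0]) by exact/closed_openC/closed_closure.
  rewrite openE => /(_ x xc); apply: filterS => y yc.
  by apply/eqP/negPn/negP => py; apply: yc; exact: subset_closure.
rewrite /partial (near_eq_derive (g := cst 0)) ?derive_cst//.
Unshelve. all: by end_near.
Qed.

(** The product u phi and its derivative vanish off the shell, so the integral of d_i (u phi) over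
    the shell is one over the whole space, which is 0. *)
Lemma class1_weak_gradient u : of_class 1 u -> weak_gradient Omega u (fun i => partial i u).
Proof.
move=> u1 phi tphi i; have out := test_function_out tphi.
have phi1 : of_class 1 phi by case: tphi.
have mO := measurable_shell r1 r2.
have [up1 dup] := class1M u1 phi1.
have Lu := continuous_L2_shell r1 r2 u1.1.
have Lphi := continuous_L2_shell r1 r2 phi1.1.
have Ldu := continuous_L2_shell r1 r2 (@class1_continuous_partial _ _ i u1).
have Ldphi := continuous_L2_shell r1 r2 (@class1_continuous_partial _ _ i phi1).
have [I1 _] := L2_mul_integrable mO Lu Ldphi.
have [I2 _] := L2_mul_integrable mO Ldu Lphi.
apply/eqP; rewrite -subr_eq0 opprK -RintegralD//; apply/eqP.
have far x j : r2 < `|coord x j| -> ~ Omega x.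
  move=> h /andP[_ xr2]; have := coord_le_enorm x j.
  by rewrite leNgt (lt_trans xr2 h).
rewrite /Rintegral integral_mkcond.
transitivity (fine (\int[volume]_x (partial i (fun x => u x * phi x) x)%:E)); last first.
  rewrite (@axis_integral _ _ i r2)//.
  - by move=> x; have [_ /(_ i)[]] := up1.
  - exact: class1_continuous_partial.
  - by move=> x j /far/out[-> _]; rewrite mulr0.
  - by move=> x j /far/out[p0 dp]; rewrite dup p0 dp !(mulr0, mul0r) addr0.
congr fine; apply: eq_integral => x _; rewrite patchE dup; case: ifPn => [_|].
  by rewrite /= [phi x * _]mulrC.
by rewrite notin_setE => /out[-> ->]; rewrite mulr0 mul0r addr0.
Qed.

(** The explicit solutions play [v] and their regular extensions play [u]: the latter, as a constant
    sequence, witnesses the trace. *)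
Lemma class1_sobolev u v : of_class 1 u -> (forall x, Omega x -> v x = u x) ->
  sobolev r1 r2 v (fun i => partial i u) u.
Proof.
move=> u1 vu.
have E : v \_ Omega = u \_ Omega.
  by apply/funext => x; rewrite !patchE; case: ifPn => //; rewrite inE => /vu.
have Du i := @class1_continuous_partial _ _ i u1.
split.
- rewrite /L2 E; exact: continuous_L2_shell u1.1.
- split=> [i|phi tphi i]; first exact: continuous_L2_shell.
  rewrite -(class1_weak_gradient u1 tphi); apply: eq_Rintegral => x.
  by rewrite inE => /vu ->.
- exact: continuous_L2_sphere u1.1.
- exact: continuous_L2_sphere u1.1.
- exists (fun=> u); split => //.
  + have := L2_cvg_cst volume Omega u; rewrite /L2_cvg.
    rewrite (_ : (u \- v) \_ Omega = (u \- u) \_ Omega)//.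
    by apply/funext => x; rewrite !patchE; case: ifPn => //; rewrite inE /= => /vu ->.
  + by move=> i; exact: L2_cvg_cst.
  + exact: L2_cvg_cst.
  + exact: L2_cvg_cst.
Qed.

End class1_sobolev.

(** * C^1 extension of radial functions across the origin *)

Section linear_extension.
Context {R : realType}.
Variables (k0 dk0 : R -> R) (a : R).
Hypothesis a0 : 0 < a.
Hypothesis d0 : forall s : R, 0 < s -> is_derive s (1 : R) k0 (dk0 s).
Hypothesis c0 : forall s : R, 0 < s -> {for s, continuous dk0}.

Definition extend_linearly (s : R) : R :=
  if a <= s then k0 s else k0 a + (s - a) * dk0 a.

Lemma continuous_extend_derivative : continuous (fun s : R => dk0 (Num.max s a)).
Proof.
move=> s; apply: (@continuous_comp _ _ _ (fun s : R => Num.max s a) dk0).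
  by apply: continuous_max; [exact: cvg_id|exact: cvg_cst].
by apply: c0; rewrite lt_max a0 orbT.
Qed.

Lemma is_derive_extend (s : R) : is_derive s (1 : R) extend_linearly (dk0 (Num.max s a)).
Proof.
have [sa|as_|->] := ltgtP s a.
- have D : is_derive s (1 : R) (fun s : R => k0 a + (s - a) * dk0 a) (dk0 a).
    have D1 : is_derive s (1 : R) (fun s : R => s - a) 1.
      have D2 := is_deriveB (is_derive_id s (1 : R)) (is_derive_cst a s (1 : R)).
      by apply: (@is_derive_eq _ _ _ _ _ _ _ _ D2); rewrite subr0.
    have D3 := is_deriveD (is_derive_cst (k0 a) s (1 : R))
      (is_deriveM D1 (is_derive_cst (dk0 a) s (1 : R))).
    apply: (@is_derive_eq _ _ _ _ _ _ _ _ D3).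
    by rewrite add0r scaler0 add0r [_ *: 1]mulr1.
  apply: near_eq_is_derive D; near=> t.
  by rewrite /extend_linearly leNgt ifF//; apply/negbTE; rewrite negbK; near: t; exact: lt_nbhsl.
- apply: near_eq_is_derive (d0 (lt_trans a0 as_)); near=> t.
  by rewrite /extend_linearly ifT// ltW//; near: t; exact: lt_nbhsr.
(* At the junction the difference quotient is that of [k0] for increments to the right and
   constantly [dk0 a] to the left. *)
set d := dk0 a.
have H0 : (fun h => h^-1 *: ((k0 \o shift a) (h *: (1 : R)) - k0 a)) @ 0^' --> d.
  by rewrite /d; have [D1 D2] := d0 a0; move: D1; rewrite /derivable => /cvg_ex[l Dl];
    rewrite -D2 /derive (cvg_lim _ Dl).
have H : (fun h => h^-1 *: ((extend_linearly \o shift a) (h *: (1 : R)) - extend_linearly a))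
    @ 0^' --> d.
  apply/cvgrPdist_lt => e e0; near=> h.
  have h0 : h != 0 by near: h; exact: nbhs_dnbhs_neq.
  rewrite /extend_linearly lexx /=; case: ifPn => ha.
    by near: h; move/cvgrPdist_lt : H0; exact.
  rewrite addrAC subrr add0r [h *: 1]mulr1 addrK /GRing.scale/= mulKf//.
  by rewrite subrr normr0.
constructor; first by apply/cvg_ex; exists d.
exact: cvg_lim H.
Unshelve. all: by end_near.
Qed.

End linear_extension.

Section radial_functions.
Context {R : realType}.
Variables (A B C D E : R).

Definition radf (t : R) : R := A * t ^+ 4 + B * t ^+ 2 + C * t + D / t + E.
(* [radW t] is [t^2 * radf' t], so that grad (radf |x|) = [fieldX radW] has
   divergence [divX radw]. *)
Definition radW (t : R) : R := 4 * A * t ^+ 5 + 2 * B * t ^+ 3 + C * t ^+ 2 - D.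
Definition radw (t : R) : R := 20 * A * t ^+ 4 + 6 * B * t ^+ 2 + 2 * C * t.

Lemma is_derive_radW (r : R) : is_derive r (1 : R) radW (radw r).
Proof.
rewrite /radW.
have H n : is_derive r (1 : R) (fun t : R => t ^+ n.+1) (n.+1%:R * r ^+ n).
  have D1 := is_deriveX n.+1 (is_derive_id r (1 : R)).
  rewrite (_ : (fun t => _) = (id : R -> R) ^+ n.+1); last by rewrite exprfctE.
  by apply: (@is_derive_eq _ _ _ _ _ _ _ _ D1); rewrite [_ *: 1]mulr1 mulr_natl.
have D1 := is_deriveB (is_deriveD (is_deriveD (is_deriveZ (4 * A) (H 4)) (is_deriveZ (2 * B) (H 2)))
  (is_deriveZ C (H 1))) (is_derive_cst D r (1 : R)).
apply: (@is_derive_eq _ _ _ _ _ _ _ _ D1).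
by rewrite /radw /GRing.scale/= subr0; ring.
Qed.

Lemma continuous_radw : continuous radw.
Proof.
move=> r; rewrite /radw.
have H n : (fun t : R => t ^+ n) @ r --> r ^+ n by exact: exprn_continuous.
apply: cvgD; [apply: cvgD|]; apply: cvgM; try exact: cvg_cst; try exact: H.
exact: cvg_id.
Qed.

(** For s > 0 this is [radf] at the square root of s, so that k0 (|x|^2) = radf |x| away from the
    origin. *)
Let k0 (s : R) : R := A * s ^+ 2 + B * s + C * Num.sqrt s + D * (Num.sqrt s)^-1 + E.
Let dk0 (s : R) : R := 2 * A * s + B + C * (2 * Num.sqrt s)^-1
  - D * ((Num.sqrt s ^+ 2)^-1 * (2 * Num.sqrt s)^-1).

Let is_derive_k0 (s : R) : 0 < s -> is_derive s (1 : R) k0 (dk0 s).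
Proof.
move=> s0; have q0 : Num.sqrt s != 0 by rewrite gt_eqF// sqrtr_gt0.
have D1 := is_derive1_sqrt s0; have D2 := is_deriveV q0 D1.
have D3 := is_deriveX 2 (is_derive_id s (1 : R)).
have D4 := is_deriveD (is_deriveD (is_deriveD (is_deriveD (is_deriveZ A D3)
  (is_deriveZ B (is_derive_id s (1 : R)))) (is_deriveZ C D1)) (is_deriveZ D D2))
  (is_derive_cst E s (1 : R)).
apply: (@is_derive_eq _ _ _ _ _ _ _ _ D4).
rewrite /dk0 /GRing.scale/=; move: (Num.sqrt s) => q.
by ring.
Qed.

Let continuous_dk0 (s : R) : 0 < s -> {for s, continuous dk0}.
Proof.
move=> s0; have q0 : Num.sqrt s != 0 by rewrite gt_eqF// sqrtr_gt0.
have cs : Num.sqrt t @[t --> s] --> Num.sqrt s by exact: sqrt_continuous.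
have c2 : (2 * Num.sqrt t)^-1 @[t --> s] --> (2 * Num.sqrt s)^-1.
  by apply: cvgV; [rewrite mulf_neq0|apply: cvgM => //; exact: cvg_cst].
apply: cvgB; [apply: cvgD; [apply: cvgD|]|].
- by apply: cvgM; [exact: cvg_cst|exact: cvg_id].
- exact: cvg_cst.
- by apply: cvgM; [exact: cvg_cst|exact: c2].
- apply: cvgM; [exact: cvg_cst|apply: cvgM => //; apply: cvgV].
    by rewrite expf_neq0.
  by apply: cvgM.
Qed.

Lemma is_derive_sqnorm (x : space3 R) i : is_derive x (axis i) sqnorm (2 * coord x i).
Proof.
have H : is_derive (0 : R) (1 : R) (fun h => sqnorm (h *: axis i + x)) (2 * coord x i).
  have -> : (fun h : R => sqnorm (h *: axis i + x)) =
      (fun h => h ^+ 2 + (2 * coord x i) * h + sqnorm x).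
    apply/funext => h; rewrite /sqnorm /coord /axis /=.
    by case: (ord3P i) => -> /=; rewrite /GRing.scale/=; ring.
  have D3 := is_deriveX 2 (is_derive_id (0 : R) (1 : R)).
  have D4 := is_deriveD (is_deriveD D3 (is_deriveZ (2 * coord x i) (is_derive_id (0 : R) (1 : R))))
     (is_derive_cst (sqnorm x) (0 : R) (1 : R)).
  apply: (@is_derive_eq _ _ _ _ _ _ _ _ D4).
  by rewrite /GRing.scale/=; ring.
have := (@is_derive_line R _ _ sqnorm x (axis i) 0 _).2 H.
by rewrite scale0r add0r.
Qed.

(* As a function of |x|^2, [radf] is smooth away from 0; it is replaced by its
   tangent line for |x| < r1, which also removes the singularity of |x| at 0. *)
Lemma radial_extension (r1 : R) : 0 < r1 -> exists u : space3 R -> R,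
  [/\ of_class 1 u, forall x, r1 <= enorm x -> u x = radf (enorm x)
    & forall x i, r1 <= enorm x -> partial i u x = fieldX radW i x].
Proof.
move=> r10; pose a := r1 ^+ 2; have a0 : 0 < a by rewrite exprn_gt0.
pose k := extend_linearly k0 dk0 a; pose dk (s : R) := dk0 (Num.max s a).
have Dk (s : R) : is_derive s (1 : R) k (dk s).
  by apply: is_derive_extend => //; exact: is_derive_k0.
have ck : continuous k.
  by move=> s; apply/differentiable_continuous/derivable1_diffP; have [] := Dk s.
have cdk : continuous dk by apply: continuous_extend_derivative => //; exact: continuous_dk0.
pose u (x : space3 R) := k (sqnorm x).
have Du x i : is_derive x (axis i) u (dk (sqnorm x) * (2 * coord x i)).
  have D1 := is_derive_sqnorm x i.
  have D2 : is_derive (0 : R) (1 : R) (fun h => sqnorm (h *: axis i + x)) (2 * coord x i).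
    by apply: ((@is_derive_line R _ _ sqnorm x (axis i) 0 _).1 _); rewrite scale0r add0r.
  have E0 : sqnorm (0 *: axis i + x) = sqnorm x by rewrite scale0r add0r.
  have D3 := @is_derive1_comp _ k (fun h : R => sqnorm (h *: axis i + x)) 0 _ _
     (Dk (sqnorm (0 *: axis i + x))) D2.
  have := (@is_derive_line R _ _ u x (axis i) 0 _).2 D3.
  by rewrite scale0r add0r.
have Pu i : partial i u = fun x => dk (sqnorm x) * (2 * coord x i).
  by apply/funext => x; have [] := Du x i.
have cdks : continuous (fun x : space3 R => dk (sqnorm x)).
  by move=> x; apply: (@continuous_comp _ _ _ (@sqnorm R) dk);
    [exact: continuous_sqnorm|exact: cdk].
have ax (x : space3 R) : r1 <= enorm x -> a <= sqnorm x.
  by move=> h; rewrite -sqr_enorm ler_pXn2r ?nnegrE ?enorm_ge0// ltW.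
have sq (x : space3 R) : Num.sqrt (enorm x ^+ 2) = enorm x.
  by rewrite sqrtr_sqr ger0_norm ?enorm_ge0.
exists u; split.
- split.
    move=> x; apply: (@continuous_comp _ _ _ (@sqnorm R) k).
      exact: continuous_sqnorm.
    exact: ck.
  move=> i; split; first by move=> x; have [] := Du x i.
  split => //; rewrite Pu => x; apply: cvgM; first exact: cdks.
  by apply: cvgM; [exact: cvg_cst|exact: continuous_coord].
- move=> x rx; rewrite /u /k /extend_linearly ax// -sqr_enorm /k0 sq /radf.
  by rewrite -exprM.
- move=> x i rx; have r0 : enorm x != 0 by rewrite gt_eqF// (lt_le_trans r10).
  rewrite Pu /dk (max_idPl (ax _ rx)) -sqr_enorm /dk0 sq /fieldX /radW.
  move: (coord x i) (enorm x) r0 => c r r0.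
  by field.
Qed.

End radial_functions.

(** * L^2 norms of squares and differences *)

Section L2_difference.
Context {R : realType}.
Variables (mu : {measure set (space3 R) -> \bar R}) (D : set (space3 R)).
Hypothesis mD : measurable D.
Implicit Types (u v : space3 R -> R).

Lemma L2norm_sqr u : L2 mu D u -> L2norm mu D u ^+ 2 = \int[mu]_(x in D) (u x * u x).
Proof.
move=> Lu; apply: EFin_inj.
have [I _] := L2_mul_integrable mD Lu Lu.
rewrite /Rintegral fineK; last exact: integral_fune_fin_num.
have := @poweR_Lnorm _ _ _ mu (EFin \o (u \_ D)) 2 _.
rewrite L2normE// poweR_EFin powR_mulrn ?L2norm_ge0// => ->//.
rewrite [RHS]integral_mkcond; apply: eq_integral => x _.
rewrite !patchE /= patchE powR_mulrn//; case: ifP => _; last by rewrite normr0 expr0n.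
by rewrite real_normK ?num_real.
Qed.

Lemma L2norm0_ae u : L2 mu D u -> \int[mu]_(x in D) (u x * u x) = 0 ->
  {ae mu, forall x, D x -> u x = 0}.
Proof.
move=> Lu; rewrite -L2norm_sqr// => /eqP; rewrite sqrf_eq0 => /eqP u0.
have := L2normE mD Lu; rewrite u0 => /Lnorm_eq0_eq0.
have [mu_ _] := (L2P mu mD u).1 Lu.
have mE : measurable_fun setT (EFin \o (u \_ D)).
  exact/measurable_EFinP/(measurable_restrictT _ mD).
move=> /(_ mE); rewrite lte_fin => /(_ (ltr0Sn _ _)).
apply: filterS => x /= /(_ I) [+] Dx.
by rewrite patchE ifT// inE.
Qed.

Lemma L2normB u v : L2 mu D u -> L2 mu D v ->
  L2norm mu D (u \- v) <= L2norm mu D u + L2norm mu D v.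
Proof.
move=> Lu Lv; have Luv := L2B Lu Lv.
have [mu_ _] := (L2P mu mD u).1 Lu. have [mv _] := (L2P mu mD v).1 Lv.
rewrite -lee_fin EFinD -!L2normE//.
have -> : (u \- v) \_ D = (u \_ D \+ (fun x => - (v \_ D) x))%R.
  by apply/funext => x; rewrite /= !patchE; case: ifP => //= _; rewrite subr0.
have -> : 'N[mu]_2[EFin \o (v \_ D)]%E = 'N[mu]_2[EFin \o (fun x => - (v \_ D) x)%R]%E.
  by rewrite -oppe_Lnorm; apply: eq_Lnorm => x.
apply: eminkowski.
- exact/(measurable_restrictT _ mD).
- by apply: measurable_funN; exact/(measurable_restrictT _ mD).
- by rewrite lee1n.
Qed.

Lemma L2_cvgB (u_ v_ : nat -> space3 R -> R) u v :
  (forall k, L2 mu D (u_ k)) -> L2 mu D u -> L2_cvg mu D u_ u ->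
  (forall k, L2 mu D (v_ k)) -> L2 mu D v -> L2_cvg mu D v_ v ->
  L2_cvg mu D (fun k => u_ k \- v_ k) (u \- v).
Proof.
move=> Lku Lu cu Lkv Lv cv.
have Cu := L2_cvg_norm Lku Lu cu; have Cv := L2_cvg_norm Lkv Lv cv.
rewrite /L2_cvg.
have Lk k : L2 mu D ((u_ k \- v_ k) \- (u \- v)) by apply: L2B; exact: L2B.
under eq_fun do rewrite L2normE//.
apply: cvg_EFin; first exact: nearW.
rewrite /comp /=.
apply: (@squeeze_cvgr _ _ _ _ (cst 0) (fun k => L2norm mu D (u_ k \- u) + L2norm mu D (v_ k \- v))).
- apply: nearW => k; rewrite L2norm_ge0/=.
  have -> : (u_ k \- v_ k) \- (u \- v) = (u_ k \- u) \- (v_ k \- v).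
    by apply/funext => x /=; ring.
  by apply: L2normB; exact: L2B.
- exact: cvg_cst.
- by rewrite -[X in _ --> X](addr0 0); exact: cvgD.
Qed.

End L2_difference.

(** * The mixed problems *)

Section problems.
Context {R : realType}.
Variables (r1 r2 : R).
Hypotheses (r1_gt0 : 0 < r1) (r12 : r1 < r2).
Local Notation Omega := (shell r1 r2).

Let mO := measurable_shell r1 r2.
Let mS r := @measurable_sphere R r.
Let r2_gt0 : 0 < r2 := lt_trans r1_gt0 r12.

Let integrable_cst_mul r c (S : space3 R -> R) : L2 (surface r) (sphere r) S ->
  \int[surface r]_(x in sphere r) (c * S x) = c * \int[surface r]_(x in sphere r) S x.
Proof.
move=> LS; have L1 : L2 (surface r) (sphere r) (cst 1).
  by apply: L2_cst => //; apply: surface_lty; exact: mS.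
have [I _] := L2_mul_integrable (mS r) L1 LS.
rewrite RintegralZl//; apply: eq_integrable I => // x _ /=.
by rewrite mul1r.
Qed.

(** Here [radW r / r ^+ 2] is the derivative of [radf] at r; the inner boundary term carries a minus
    sign because the outward normal there points to the origin. Boundary conditions are not yet
    imposed, so both problems can specialize this identity. *)
Lemma radial_weak_form (A B C D E : R) (U : space3 R -> R) :
  (forall x, Omega x -> U x = radf A B C D E (enorm x)) ->
  exists G T, [/\ sobolev r1 r2 U G T,
    forall x, sphere r1 x -> T x = radf A B C D E r1 &
    forall v H S, sobolev r1 r2 v H S ->
      \int[volume]_(x in Omega) (\sum_i G i x * H i x) =
      - (\int[volume]_(x in Omega) (divX (radw A B C) x * v x)) +
      radW A B C D r2 / r2 ^+ 2 * \int[surface r2]_(x in sphere r2) S x -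
      radW A B C D r1 / r1 ^+ 2 * \int[surface r1]_(x in sphere r1) S x].
Proof.
move=> UE; have [u [u1 uE du]] := radial_extension A B C D E r1_gt0.
exists (fun i => partial i u), u; split.
- apply: class1_sobolev => // x xO; rewrite UE// uE//.
  by move: xO => /andP[/ltW].
- by move=> x xr; rewrite uE xr.
move=> v H S vHS; have [Lv [LH _] _ _ _] := vHS.
have := sobolev_divergence r1_gt0 r12 (@is_derive_radW R A B C D)
  (@continuous_radw R A B C) vHS.
set Y := \sum_i _; move=> HY.
have -> : \int[volume]_(x in Omega) (\sum_i partial i u x * H i x) = Y.
  have I i : volume.-integrable Omega (fun x => (fieldX (radW A B C D) i x * H i x)%:E).
    have Ldu := continuous_L2_shell r1 r2 (@class1_continuous_partial _ _ i u1).
    have [I _] := L2_mul_integrable mO Ldu (LH i).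
    apply: eq_integrable I => // x; rewrite inE => /andP[/ltW x1 _].
    by rewrite du.
  rewrite /Y big_ord3.
  rewrite -(RintegralD mO (I 0) (I 1)) -(RintegralD mO (integrableD mO (I 0) (I 1)) (I 2)).
  apply: eq_Rintegral => x; rewrite inE => /andP[/ltW x1 _].
  by rewrite big_ord3 !du.
by rewrite -[LHS](addKr (\int[volume]_(x in Omega) (divX (radw A B C) x * v x))) HY addrA.
Qed.

Let int_div A B C (F v : space3 R -> R) :
  (forall x, Omega x -> F x = - divX (radw A B C) x) ->
  L2 volume Omega v ->
  \int[volume]_(x in Omega) (divX (radw A B C) x * v x) =
  - (\int[volume]_(x in Omega) (F x * v x)).
Proof.
move=> FE Lv; have [M HM] := divX_bound r2 r1_gt0 (@continuous_radw R A B C).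
have md : measurable_fun Omega (divX (radw A B C)).
  apply: measurable_funTS; apply: measurable_divX; exact: continuous_radw.
have Ld : L2 volume Omega (divX (radw A B C)).
  by apply: (L2_bounded mO (volume_shell_lty r1 r2) md HM).
have [I _] := L2_mul_integrable mO Ld Lv.
apply: oppr_inj; rewrite opprK -mulN1r -RintegralZl//; apply: eq_Rintegral => x.
by rewrite inE => /FE ->; rewrite mulN1r mulNr.
Qed.

(** The inner flux is paired with a test trace that vanishes almost everywhere, so only the outer
    flux, equal to -q, survives. *)
Lemma dirichlet_radial (A B C D E b q : R) (F U : space3 R -> R) :
  (forall x, Omega x -> U x = radf A B C D E (enorm x)) ->
  (forall x, Omega x -> F x = - divX (radw A B C) x) ->
  radf A B C D E r1 = b -> radW A B C D r2 / r2 ^+ 2 = - q ->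
  dirichlet_solution r1 r2 F b q U.
Proof.
move=> UE FE bE qE; have [G [T [HU TE HG]]] := radial_weak_form UE.
exists G, T; split => //.
  by apply/nearW => x /TE ->.
move=> v H S vHS S0; rewrite (HG _ _ _ vHS) qE; have [Lv _ LS1 LS2 _] := vHS.
rewrite (int_div FE Lv) (integrable_cst_mul q LS2) opprK.
have -> : \int[surface r1]_(x in sphere r1) S x = 0.
  transitivity (fine (\int[surface r1]_(x in sphere r1) (cst 0%E x))%E); last first.
    by rewrite integral_cst// mul0e.
  congr fine; apply: ae_eq_integral => //.
  - by apply/measurable_EFinP; have [] := (L2P _ (mS r1) S).1 LS1.
  - by apply: filterS S0 => x /= S0 /S0 ->.
by rewrite mulr0 subr0 mulNr.
Qed.

(** On the inner sphere -dU/dn is the radial derivative [radW r1 / r1 ^+ 2]; under the Robin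
    condition the inner flux cancels the boundary integral of the weak form. *)
Lemma robin_radial (alpha A B C D E b q : R) (F U : space3 R -> R) :
  (forall x, Omega x -> U x = radf A B C D E (enorm x)) ->
  (forall x, Omega x -> F x = - divX (radw A B C) x) ->
  radW A B C D r1 / r1 ^+ 2 = alpha * (radf A B C D E r1 - b) ->
  radW A B C D r2 / r2 ^+ 2 = - q ->
  robin_solution r1 r2 alpha F b q U.
Proof.
move=> UE FE bE qE; have [G [T [HU TE HG]]] := radial_weak_form UE.
exists G, T; split => //.
move=> v H S vHS; rewrite (HG _ _ _ vHS) qE bE; have [Lv _ LS1 LS2 _] := vHS.
rewrite (int_div FE Lv) (integrable_cst_mul q LS2) opprK.
rewrite [X in _ + X](@eq_Rintegral _ _ _ (surface r1) (sphere r1)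
  (fun x => (alpha * (radf A B C D E r1 - b)) * S x)); last first.
  by move=> x; rewrite inE => /TE ->.
by rewrite (integrable_cst_mul _ LS1) mulNr subrK.
Qed.

(** * Differences of solutions and uniqueness *)

Lemma sobolevB u1 G1 T1 u2 G2 T2 :
  sobolev r1 r2 u1 G1 T1 -> sobolev r1 r2 u2 G2 T2 ->
  sobolev r1 r2 (u1 \- u2) (fun i => G1 i \- G2 i) (T1 \- T2).
Proof.
move=> [Lu1 [LG1 W1] LS1 LR1 [p1 [p11 c1 cG1 cS1 cR1]]].
move=> [Lu2 [LG2 W2] LS2 LR2 [p2 [p21 c2 cG2 cS2 cR2]]].
split.
- exact: L2B.
- split; first by move=> i; exact: L2B.
  move=> phi tphi i.
  have phi1 : of_class 1 phi by case: tphi.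
  have Lphi := continuous_L2_shell r1 r2 phi1.1.
  have Ldphi := continuous_L2_shell r1 r2 (@class1_continuous_partial _ _ i phi1).
  have [I1 _] := L2_mul_integrable mO Lu1 Ldphi.
  have [I2 _] := L2_mul_integrable mO Lu2 Ldphi.
  have [J1 _] := L2_mul_integrable mO (LG1 i) Lphi.
  have [J2 _] := L2_mul_integrable mO (LG2 i) Lphi.
  transitivity (\int[volume]_(x in Omega) (u1 x * partial i phi x - u2 x * partial i phi x)).
    by apply: eq_Rintegral => x _ /=; rewrite mulrBl.
  rewrite (RintegralB mO I1 I2) W1// W2//.
  transitivity (- \int[volume]_(x in Omega) (G1 i x * phi x - G2 i x * phi x)).
    by rewrite (RintegralB mO J1 J2) opprK opprB addrC.
  by congr (- _); apply: eq_Rintegral => x _ /=; rewrite mulrBl.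
- exact: L2B.
- exact: L2B.
- have D1 k i := @class1_continuous_partial _ _ i (p11 k).
  have D2 k i := @class1_continuous_partial _ _ i (p21 k).
  exists (fun k x => p1 k x - p2 k x); split.
  + by move=> k; have [] := class1B (p11 k) (p21 k).
  + apply: (L2_cvgB mO) => // k; apply: continuous_L2_shell; [exact: (p11 k).1|exact: (p21 k).1].
  + move=> i.
    have -> : (fun k => partial i (fun x => p1 k x - p2 k x)) =
       (fun k => partial i (p1 k) \- partial i (p2 k)).
      by apply/funext => k; apply/funext => x; have [_ ->] := class1B (p11 k) (p21 k).
    by apply: (L2_cvgB mO) => // k; exact: continuous_L2_shell.
  + apply: (L2_cvgB (mS r1)) => // k; apply: continuous_L2_sphere; [exact: (p11 k).1|exact: (p21 k).1].
  + apply: (L2_cvgB (mS r2)) => // k; apply: continuous_L2_sphere; [exact: (p11 k).1|exact: (p21 k).1].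
Qed.

(* The field [X = (1 - (r2 / |x|)^3) x / 3] has divergence 1 and is tangent to
   the outer sphere, so integrating [div (v^2 X)] controls v by its gradient
   and its trace on the inner sphere. *)
Lemma sobolev_zero v H S : sobolev r1 r2 v H S ->
  (forall i, \int[volume]_(x in Omega) (H i x * H i x) = 0) ->
  \int[surface r1]_(x in sphere r1) (S x * S x) = 0 ->
  {ae volume, forall x, Omega x -> v x = 0}.
Proof.
move=> vHS H0 S0; have [Lv [LH _] LS1 LS2 _] := vHS.
apply: (L2norm0_ae mO Lv).
(* These coefficients give W(t) = (t^3 - r2^3) / 3 and w(t) = t^2, so W(r2) = 0 and [divX w] is 1 on
   the shell. *)
pose W := radW 0 (1 / 6) 0 (r2 ^+ 3 / 3); pose w : R -> R := radw 0 (1 / 6) 0.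
have dW (r : R) : is_derive r (1 : R) W (w r) by exact: is_derive_radW.
have cw : continuous w by exact: continuous_radw.
have := sobolev_energy r1_gt0 r12 dW cw vHS.
have -> : W r2 = 0 by rewrite /W /radW; field.
rewrite S0 !mul0r mulr0 subr0.
(* The gradient has norm 0, so Cauchy-Schwarz annihilates the cross term and the energy identity is
   left with the integral of v^2. *)
have -> : \sum_i \int[volume]_(x in Omega) (fieldX W i x * (v x * H i x)) = 0.
  apply: big1 => i _.
  have [M HM] := fieldX_bound r2 r1_gt0 dW i.
  have mX : measurable_fun Omega (fieldX W i).
    apply: measurable_funTS; exact: measurable_fieldX dW i.
  have [LX _] := L2_mul_bounded mO mX HM Lv.
  have [_ CS] := L2_mul_integrable mO LX (LH i).
  have N0 : L2norm volume Omega (H i) = 0.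
    by apply/eqP; rewrite -sqrf_eq0 L2norm_sqr// H0.
  rewrite N0 mulr0 normr_le0 in CS.
  rewrite -[RHS](eqP CS); apply: eq_Rintegral => x _ /=; exact: mulrA.
rewrite mulr0 addr0 => <-; apply: eq_Rintegral => x; rewrite inE => /andP[x1 _].
have x0 : enorm x != 0 by rewrite gt_eqF// (lt_trans r1_gt0).
rewrite (_ : divX w x = 1) ?mul1r// /divX /w /radw.
by field.
Qed.

Let sum_sqr_zero (K : 'I_3 -> space3 R -> R) :
  (forall i, L2 volume Omega (K i)) ->
  \int[volume]_(x in Omega) (\sum_i K i x * K i x) <= 0 ->
  forall i, \int[volume]_(x in Omega) (K i x * K i x) = 0.
Proof.
move=> LK HK i.
have I j : volume.-integrable Omega (fun x => (K j x * K j x)%:E).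
  by have [] := L2_mul_integrable mO (LK j) (LK j).
have P j : 0 <= \int[volume]_(x in Omega) (K j x * K j x).
  by rewrite -L2norm_sqr// sqr_ge0.
have E : \int[volume]_(x in Omega) (\sum_i K i x * K i x) =
    \sum_i \int[volume]_(x in Omega) (K i x * K i x).
  rewrite big_ord3.
  rewrite -(RintegralD mO (I 0) (I 1)) -(RintegralD mO (integrableD mO (I 0) (I 1)) (I 2)).
  by apply: eq_Rintegral => x _; rewrite big_ord3.
have {}HK : \sum_i \int[volume]_(x in Omega) (K i x * K i x) == 0.
  by rewrite eq_le -{1}E HK sumr_ge0.
by move: HK; rewrite psumr_eq0// => /allP/(_ i (mem_index_enum _))/eqP.
Qed.

Let gradB (G1 G2 K : 'I_3 -> space3 R -> R) :
  (forall i, L2 volume Omega (G1 i)) -> (forall i, L2 volume Omega (G2 i)) ->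
  (forall i, L2 volume Omega (K i)) ->
  (forall i, K i = G1 i \- G2 i) ->
  \int[volume]_(x in Omega) (\sum_i K i x * K i x) =
  \int[volume]_(x in Omega) (\sum_i G1 i x * K i x) -
  \int[volume]_(x in Omega) (\sum_i G2 i x * K i x).
Proof.
move=> L1 L2' LK KE.
have I (G : 'I_3 -> space3 R -> R) : (forall i, L2 volume Omega (G i)) ->
    volume.-integrable Omega (fun x => (\sum_i G i x * K i x)%:E).
  move=> LG.
  have J j : volume.-integrable Omega (fun x => (G j x * K j x)%:E).
    by have [] := L2_mul_integrable mO (LG j) (LK j).
  apply: eq_integrable (integrableD mO (integrableD mO (J 0) (J 1)) (J 2)) => //.
  by move=> x _; rewrite big_ord3.
rewrite -(RintegralB mO (I _ L1) (I _ L2')); apply: eq_Rintegral => x _.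
by rewrite -sumrB; apply: eq_bigr => i _; rewrite -mulrBl; congr (_ * _); rewrite KE.
Qed.

(** The difference has trace 0 on the inner sphere, hence may be tested in both problems; the
    right-hand sides coincide, so its gradient has zero L^2 norm. *)
Lemma dirichlet_unique F b q u1 u2 :
  dirichlet_solution r1 r2 F b q u1 -> dirichlet_solution r1 r2 F b q u2 ->
  {ae volume, forall x, Omega x -> u1 x = u2 x}.
Proof.
move=> [G1 [T1 [H1 T1b S1]]] [G2 [T2 [H2 T2b S2]]].
have H12 := sobolevB H1 H2.
have T0 : {ae surface r1, forall x, sphere r1 x -> (T1 \- T2) x = 0}.
  by apply: filterS2 T1b T2b => x E1 E2 xr /=; rewrite E1// E2// subrr.
have [Lw [LK _] Ls1 _ _] := H12.
have LG1 : forall i, L2 volume Omega (G1 i) by case: H1 => _ [].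
have LG2 : forall i, L2 volume Omega (G2 i) by case: H2 => _ [].
have K0 : forall i, \int[volume]_(x in Omega) ((G1 i \- G2 i) x * (G1 i \- G2 i) x) = 0.
  apply: (sum_sqr_zero LK).
  rewrite (gradB LG1 LG2 LK (fun=> erefl)) (S1 _ _ _ H12 T0) (S2 _ _ _ H12 T0).
  by rewrite subrr.
have S0 : \int[surface r1]_(x in sphere r1) ((T1 \- T2) x * (T1 \- T2) x) = 0.
  transitivity (fine (\int[surface r1]_(x in sphere r1) (cst 0%E x))%E); last first.
    by rewrite integral_cst// mul0e.
  congr fine; apply: ae_eq_integral => //.
  - by have [/integrableP[]] := L2_mul_integrable (mS r1) Ls1 Ls1.
  - by apply: filterS T0 => x /= T0 /T0 ->; rewrite mul0r.
have := sobolev_zero H12 K0 S0.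
by apply: filterS => x /= w0 /w0/eqP; rewrite subr_eq0 => /eqP.
Qed.

(** For the difference d, testing and subtracting yields that the integral of |grad d|^2 plus alpha
    times that of the squared inner trace is 0; as alpha > 0, both vanish. *)
Lemma robin_unique alpha F b q u1 u2 : 0 < alpha ->
  robin_solution r1 r2 alpha F b q u1 -> robin_solution r1 r2 alpha F b q u2 ->
  {ae volume, forall x, Omega x -> u1 x = u2 x}.
Proof.
move=> alpha0 [G1 [T1 [H1 S1]]] [G2 [T2 [H2 S2]]].
have H12 := sobolevB H1 H2.
have [Lw [LK _] Ls1 _ _] := H12.
have LG1 : forall i, L2 volume Omega (G1 i) by case: H1 => _ [].
have LG2 : forall i, L2 volume Omega (G2 i) by case: H2 => _ [].
have LT1 : L2 (surface r1) (sphere r1) T1 by case: H1.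
have LT2 : L2 (surface r1) (sphere r1) T2 by case: H2.
have L1 c : L2 (surface r1) (sphere r1) (cst c).
  by apply: L2_cst => //; apply: surface_lty; exact: mS.
have J T : L2 (surface r1) (sphere r1) T ->
    \int[surface r1]_(x in sphere r1) (alpha * (T x - b) * (T1 \- T2) x) =
    alpha * \int[surface r1]_(x in sphere r1) ((T x - b) * (T1 \- T2) x) /\
    (surface r1).-integrable (sphere r1) (fun x => ((T x - b) * (T1 \- T2) x)%:E).
  move=> LT; have [I _] := L2_mul_integrable (mS r1) (L2B LT (L1 b)) Ls1.
  split => //; rewrite -RintegralZl//.
  by apply: eq_Rintegral => x _; rewrite mulrA.
have [E1 I1] := J _ LT1; have [E2 I2] := J _ LT2.
have EB : \int[surface r1]_(x in sphere r1) ((T1 \- T2) x * (T1 \- T2) x) =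
    \int[surface r1]_(x in sphere r1) ((T1 x - b) * (T1 \- T2) x) -
    \int[surface r1]_(x in sphere r1) ((T2 x - b) * (T1 \- T2) x).
  rewrite -(RintegralB (mS r1) I1 I2); apply: eq_Rintegral => x _.
  by rewrite -mulrBl; congr (_ * _); rewrite /= opprB addrA subrK.
have P : 0 <= \int[surface r1]_(x in sphere r1) ((T1 \- T2) x * (T1 \- T2) x).
  by rewrite -L2norm_sqr// sqr_ge0.
have GB := gradB LG1 LG2 LK (fun=> erefl).
have := S1 _ _ _ H12; have := S2 _ _ _ H12; rewrite E1 E2 => V2 V1.
have V : \int[volume]_(x in Omega) (\sum_i (G1 i \- G2 i) x * (G1 i \- G2 i) x) +
  alpha * \int[surface r1]_(x in sphere r1) ((T1 \- T2) x * (T1 \- T2) x) = 0.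
  by rewrite GB EB mulrBr addrACA -opprD V1 V2 subrr.
have K0 : forall i, \int[volume]_(x in Omega) ((G1 i \- G2 i) x * (G1 i \- G2 i) x) = 0.
  apply: (sum_sqr_zero LK).
  by rewrite -[leRHS]V lerDl mulr_ge0// ltW.
have S0 : \int[surface r1]_(x in sphere r1) ((T1 \- T2) x * (T1 \- T2) x) = 0.
  have G0 : 0 <= \int[volume]_(x in Omega) (\sum_i (G1 i \- G2 i) x * (G1 i \- G2 i) x).
    by apply: Rintegral_ge0 => x _; apply: sumr_ge0 => i _; rewrite -expr2 sqr_ge0.
  apply/eqP; rewrite eq_le P andbT -(pmulr_rle0 _ alpha0).
  by rewrite -[leRHS]V lerDr.
have := sobolev_zero H12 K0 S0.
by apply: filterS => x /= w0 /w0/eqP; rewrite subr_eq0 => /eqP.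
Qed.

(** * Changing the source on a null set *)

Let int_congr (F F' v : space3 R -> R) : measurable_fun Omega F -> measurable_fun Omega F' ->
  {ae volume, forall x, Omega x -> F x = F' x} -> L2 volume Omega v ->
  \int[volume]_(x in Omega) (F x * v x) = \int[volume]_(x in Omega) (F' x * v x).
Proof.
move=> mF mF' FF Lv; have [mv _] := (L2P _ mO v).1 Lv.
congr fine; apply: ae_eq_integral => //.
- by apply/measurable_EFinP; exact: measurable_funM.
- by apply/measurable_EFinP; exact: measurable_funM.
- by apply: filterS FF => x /= FF /FF ->.
Qed.

(** The adjoint source u - zd involves an arbitrary solution [u], which equals the explicit state
    only almost everywhere; this brings the adjoint problem to the explicit source before uniqueness
    is invoked. *)
Lemma dirichlet_congr F F' b q u : measurable_fun Omega F -> measurable_fun Omega F' ->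
  {ae volume, forall x, Omega x -> F x = F' x} ->
  dirichlet_solution r1 r2 F b q u -> dirichlet_solution r1 r2 F' b q u.
Proof.
move=> mF mF' FF [G [T [H1 H2 H3]]]; exists G, T; split => // v H S vHS S0.
by rewrite (H3 _ _ _ vHS S0) (int_congr mF mF' FF)//; case: vHS.
Qed.

Lemma robin_congr alpha F F' b q u : measurable_fun Omega F -> measurable_fun Omega F' ->
  {ae volume, forall x, Omega x -> F x = F' x} ->
  robin_solution r1 r2 alpha F b q u -> robin_solution r1 r2 alpha F' b q u.
Proof.
move=> mF mF' FF [G [T [H1 H3]]]; exists G, T; split => // v H S vHS.
by rewrite (H3 _ _ _ vHS) (int_congr mF mF' FF)//; case: vHS.
Qed.

Lemma dirichlet_measurable F b q u : dirichlet_solution r1 r2 F b q u -> measurable_fun Omega u.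
Proof. by move=> [G [T [[Lu _ _ _ _] _ _]]]; have [] := (L2P _ mO u).1 Lu. Qed.

Lemma robin_measurable alpha F b q u :
  robin_solution r1 r2 alpha F b q u -> measurable_fun Omega u.
Proof. by move=> [G [T [[Lu _ _ _ _] _]]]; have [] := (L2P _ mO u).1 Lu. Qed.

End problems.

Theorem lemma4p1 (R : realType) (r1 r2 g q b zd alpha : R) :
  0 < r1 -> r1 < r2 -> 0 < alpha ->
  (let F1 := g * r1 ^+ 2 * r2 ^+ 3 *
               (- (1 / 9) * (r2 / r1) ^+ 3 + 1 / 5 * (r2 / r1) ^+ 2 - 1 / 18)
             + q * r2 ^+ 4 * (1 / 3 * (r2 / r1) - 1 / 2)
             - r2 ^+ 3 / 3 * (b - zd) in
   let F2 := g * (r1 ^+ 4 / 9) * (7 / 40 - (r2 / r1) ^+ 3)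
             + q * r1 * (r2 ^+ 2 / 3) + r1 ^+ 2 / 6 * (b - zd) - F1 / r1 in
   let U (x : space3 R) : R := let r := enorm x in
     g * (r1 ^+ 2 / 3) *
       (1 / 2 - 1 / 2 * (r / r1) ^+ 2 + (r2 / r1) ^+ 3
        - r2 / r * (r2 / r1) ^+ 2)
     + q * (r2 ^+ 2 / r1) * (r1 / r - 1) + b in
   let P (x : space3 R) : R := let r := enorm x in
     g * r1 ^+ 2 * (r ^+ 2 / 6) *
       (1 / 20 * (r / r1) ^+ 2 + r2 / r * (r2 / r1) ^+ 2
        - 1 / 3 * (r2 / r1) ^+ 3 - 1 / 6)
     + q * r2 ^+ 2 * (r / 2) * (r / (3 * r1) - 1)
     - r ^+ 2 / 6 * (b - zd) + F1 / r + F2 in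
   [/\ dirichlet_solution r1 r2 (cst g) b q U,
       dirichlet_solution r1 r2 (fun x => U x - zd) 0 0 P
     & forall u p : space3 R -> R,
         dirichlet_solution r1 r2 (cst g) b q u ->
         dirichlet_solution r1 r2 (fun x => u x - zd) 0 0 p ->
         {ae volume, forall x, shell r1 r2 x -> u x = U x} /\
         {ae volume, forall x, shell r1 r2 x -> p x = P x}])
  /\
  (let F1a := g * r1 ^+ 2 * r2 ^+ 3 *
                (- (1 / 9) * (r2 / r1) ^+ 3 * (1 + 1 / (alpha * r1))
                 + 1 / 5 * (r2 / r1) ^+ 2 - 1 / 18 * (1 - 2 / (alpha * r1)))
              + q * r2 ^+ 4 *
                (1 / 3 * (r2 / r1) * (1 + 1 / (alpha * r1)) - 1 / 2)
              - r2 ^+ 3 / 3 * (b - zd) in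
   let F2a := g * (r1 ^+ 4 / 9) *
                (7 / 40 - 7 / (10 * alpha * r1)
                 + 1 / (alpha ^+ 2 * r1 ^+ 2)
                 - (r2 / r1) ^+ 3 *
                   (1 - 1 / (alpha * r1) + 1 / (alpha ^+ 2 * r1 ^+ 2)))
              + q * r1 * (r2 ^+ 2 / 3) *
                (1 - 1 / (alpha * r1) + 1 / (alpha ^+ 2 * r1 ^+ 2))
              + r1 ^+ 2 / 6 * (b - zd) * (1 - 2 / (alpha * r1))
              - F1a / r1 * (1 + 1 / (alpha * r1)) in
   let Ua (x : space3 R) : R := let r := enorm x in
     g * (r1 ^+ 2 / 3) *
       (1 / 2 - 1 / (alpha * r1) - 1 / 2 * (r / r1) ^+ 2
        + (r2 / r1) ^+ 3 * (1 + 1 / (alpha * r1))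
        - r2 / r * (r2 / r1) ^+ 2)
     + q * (r2 ^+ 2 / r1) * (r1 / r - 1 - 1 / (alpha * r1)) + b in
   let Pa (x : space3 R) : R := let r := enorm x in
     g * r1 ^+ 2 * (r ^+ 2 / 6) *
       (1 / 20 * (r / r1) ^+ 2 + r2 / r * (r2 / r1) ^+ 2
        - 1 / 3 * (r2 / r1) ^+ 3 * (1 + 1 / (alpha * r1))
        - 1 / 6 + 1 / (3 * alpha * r1))
     + q * r2 ^+ 2 * (r / 2) *
       (r / (3 * r1) - 1 + r / (3 * alpha * r1 ^+ 2))
     - r ^+ 2 / 6 * (b - zd) + F1a / r + F2a in
   [/\ robin_solution r1 r2 alpha (cst g) b q Ua,
       robin_solution r1 r2 alpha (fun x => Ua x - zd) 0 0 Pa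
     & forall u p : space3 R -> R,
         robin_solution r1 r2 alpha (cst g) b q u ->
         robin_solution r1 r2 alpha (fun x => u x - zd) 0 0 p ->
         {ae volume, forall x, shell r1 r2 x -> u x = Ua x} /\
         {ae volume, forall x, shell r1 r2 x -> p x = Pa x}]).
Proof.
move=> r1_gt0 r12 alpha_gt0; have r2_gt0 := lt_trans r1_gt0 r12.
have r1N0 : r1 != 0 by exact: lt0r_neq0.
have r2N0 : r2 != 0 by exact: lt0r_neq0.
have aN0 : alpha != 0 by exact: lt0r_neq0.
have pos (x : space3 R) : shell r1 r2 x -> enorm x != 0.
  by move=> /andP[x1 _]; rewrite gt_eqF// (lt_trans r1_gt0).
have mO := measurable_shell r1 r2.
split.
- move=> F1 F2 U P.
  have HU : dirichlet_solution r1 r2 (cst g) b q U.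
    (* The coefficient of r^2 solves -6 B = g, that of 1/r gives the flux -q at r2, and the constant
       gives the value b at r1. *)
    apply: (@dirichlet_radial _ _ _ r1_gt0 r12 0 (- g / 6) 0
      (- g * r2 ^+ 3 / 3 + q * r2 ^+ 2)
      (g * r1 ^+ 2 / 3 * (1 / 2 + (r2 / r1) ^+ 3) - q * r2 ^+ 2 / r1 + b)).
    + move=> x /pos; rewrite /U /radf; move: (enorm x) => r rN0.
      by field; rewrite rN0 r1N0.
    + move=> x /pos; rewrite /divX /radw /=; move: (enorm x) => r rN0.
      by field.
    + by rewrite /radf; field.
    + by rewrite /radW; field.
  have HP : dirichlet_solution r1 r2 (fun x => U x - zd) 0 0 P.
    (* [A], [B], [C] match -20 A r^2 - 6 B - 2 C / r with U - zd term by term; [F1] then makes the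
       flux at r2 vanish and [F2] the value at r1. *)
    apply: (@dirichlet_radial _ _ _ r1_gt0 r12 (g / 120)
      (- (g * r1 ^+ 2 / 6) * (1 / 3 * (r2 / r1) ^+ 3 + 1 / 6)
         + q * r2 ^+ 2 / (6 * r1) - (b - zd) / 6)
      (g * r2 ^+ 3 / 6 - q * r2 ^+ 2 / 2) F1 F2).
    + move=> x /pos; rewrite /P /radf; generalize F1 F2 (enorm x) => f1 f2 r rN0.
      by field; rewrite rN0 r1N0.
    + move=> x /pos; rewrite /U /divX /radw /=; move: (enorm x) => r rN0.
      by field; rewrite rN0 r1N0.
    + by rewrite /radf /F2 /F1; field.
    + by rewrite /radW /F1; field; rewrite r1N0 r2N0.
  split => // u p Hu Hp.
  have uU := dirichlet_unique r1_gt0 r12 Hu HU; split => //.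
  apply: (dirichlet_unique r1_gt0 r12 _ HP).
  apply: dirichlet_congr Hp.
  + by apply: measurable_funB => //; exact: dirichlet_measurable Hu.
  + by apply: measurable_funB => //; exact: dirichlet_measurable HU.
  + by apply: filterS uU => x /= uU /uU ->.
- move=> F1a F2a Ua Pa.
  have HU : robin_solution r1 r2 alpha (cst g) b q Ua.
    (* The equation and the outer flux are as in the Dirichlet case, so only the constant changes:
       it is solved from the Robin condition at r1. *)
    apply: (@robin_radial _ _ _ r1_gt0 r12 alpha 0 (- g / 6) 0
      (- g * r2 ^+ 3 / 3 + q * r2 ^+ 2)
      (g * r1 ^+ 2 / 3 * (1 / 2 - 1 / (alpha * r1) + (r2 / r1) ^+ 3 * (1 + 1 / (alpha * r1)))
       - q * r2 ^+ 2 / r1 * (1 + 1 / (alpha * r1)) + b)).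
    + move=> x /pos; rewrite /Ua /radf; move: (enorm x) => r rN0.
      by field; rewrite rN0 r1N0 aN0.
    + move=> x /pos; rewrite /divX /radw /=; move: (enorm x) => r rN0.
      by field.
    + by rewrite /radf /radW; field; rewrite r1N0 aN0.
    + by rewrite /radW; field.
  have HP : robin_solution r1 r2 alpha (fun x => Ua x - zd) 0 0 Pa.
    (* The new constant of [Ua] alters [B] alone among the coefficients matched with the source;
       [F1a] follows from zero flux at r2 and [F2a] from the homogeneous Robin condition. *)
    apply: (@robin_radial _ _ _ r1_gt0 r12 alpha (g / 120)
      (- (g * r1 ^+ 2 / 6) * (1 / 3 * (r2 / r1) ^+ 3 * (1 + 1 / (alpha * r1)) + 1 / 6
          - 1 / (3 * alpha * r1))
         + q * r2 ^+ 2 / (6 * r1) * (1 + 1 / (alpha * r1)) - (b - zd) / 6)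
      (g * r2 ^+ 3 / 6 - q * r2 ^+ 2 / 2) F1a F2a).
    + move=> x /pos; rewrite /Pa /radf; generalize F1a F2a (enorm x) => f1 f2 r rN0.
      by field; rewrite rN0 r1N0 aN0.
    + move=> x /pos; rewrite /Ua /divX /radw /=; move: (enorm x) => r rN0.
      by field; rewrite rN0 r1N0 aN0.
    + by rewrite /radf /radW /F2a; generalize F1a => f1; field; rewrite r1N0 aN0.
    + by rewrite /radW /F1a; field; rewrite r1N0 r2N0 aN0.
  split => // u p Hu Hp.
  have uU := robin_unique r1_gt0 r12 alpha_gt0 Hu HU; split => //.
  apply: (robin_unique r1_gt0 r12 alpha_gt0 _ HP).
  apply: robin_congr Hp.
  + by apply: measurable_funB => //; exact: robin_measurable Hu.
  + by apply: measurable_funB => //; exact: robin_measurable HU.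
  + by apply: filterS uU => x /= uU /uU ->.
Qed.
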